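(* Let $\mathcal G_1,\mathcal G_2$ be a matched pair of measured subgroupoids of a measured groupoid $\mathcal G$. Let $$\mathfrak a:L^\infty(\mathcal G_2,\mu_2)\to L^\infty(\mathcal G_2,\mu_2)\,{}_{s_2}\star_{r_1}L^\infty(\mathcal G_1,\mu_1),\qquad \hat{\mathfrak a}:L^\infty(\mathcal G_1,\mu_1)\to L^\infty(\mathcal G_1,\mu_1)\,{}_{r_1}\star_{s_2}L^\infty(\mathcal G_2,\mu_2)$$ be defined, for $f\in L^\infty(\mathcal G_2,\mu_2)$ and $h\in L^\infty(\mathcal G_1,\mu_1)$ and almost every $(g_2,g_1)$ with $g_i\in\mathcal G_i$, $s(g_2)=r(g_1)$, by $$\mathfrak a(f)(g_2,g_1)=f(p_2(g_2g_1)),\qquad \hat{\mathfrak a}(h)(g_1,g_2)=h(p_1(g_2g_1)).$$ Then $(s_2,\mathfrak a)$ is a right action of $\mathfrak G(\mathcal G_1)$ on $L^\infty(\mathcal G_2,\mu_2)$, and $(r_1,\hat{\mathfrak a})$ is a left action of $\mathfrak G(\mathcal G_2)$ on $L^\infty(\mathcal G_1,\mu_1)$. Moreover, identifying both fibre products with $L^\infty(\mathcal G,\mu)$ through the map $(g_2,g_1)\mapsto g_2g_1$, one has $\mathfrak a\circ r_2=\hat{\mathfrak a}\circ s_1=m$ and $\mathfrak a\circ s_2=s$ as representations of $L^\infty(\mathcal G^0,\nu)$.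
   Context: A measured groupoid $(\mathcal G,(\lambda^u)_{u\in\mathcal G^0},\nu)$ is a Hausdorff, $\sigma$-compact, (second countable) locally compact groupoid with unit space $\mathcal G^0$, $r(g)=gg^{-1}$, $s(g)=g^{-1}g$ ($gg'$ is defined iff $s(g)=r(g')$), a left Haar system $(\lambda^u)$ ($\lambda^u$ has support $\mathcal G^u=r^{-1}(u)$) and a quasi-invariant Radon measure $\nu$ on $\mathcal G^0$; $\mu=\int\lambda^u d\nu(u)$. Closed subgroupoids $\mathcal G_1,\mathcal G_2$, with Haar systems $(\lambda_i^u)$, form a matched pair if $\mathcal G_1\cap\mathcal G_2=\mathcal G^0$, $\mathcal G_1\mathcal G_2=\{g_1g_2:g_i\in\mathcal G_i,\ s(g_1)=r(g_2)\}$ is $\mu$-conegligible, and $\nu$ is quasi-invariant for the three Haar systems. $\mu_i=\int\lambda_i^ud\nu(u)$; $r_i,s_i$ are the restrictions of $r,s$ to $\mathcal G_i$. For $\mu$-almost every $g$, $g=p_1(g)p_2(g)$ uniquely with $p_i(g)\in\mathcal G_i$; $m(g)=s(p_1(g))=r(p_2(g))$. The letters $r_i,s_i,s,m$ also denote the representations $f\mapsto f\circ r_i$, etc., of $L^\infty(\mathcal G^0,\nu)$. The fibre product $L^\infty(\mathcal G_2,\mu_2)\,{}_{s_2}\star_{r_1}L^\infty(\mathcal G_1,\mu_1)$ over $L^\infty(\mathcal G^0,\nu)$ is $L^\infty$ of $\mathcal G_2\,{}_{s_2}\times_{r_1}\mathcal G_1=\{(g_2,g_1):s(g_2)=r(g_1)\}$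 with the measure $F\mapsto\int\int F(g_2,g_1)d\lambda_1^{s(g_2)}(g_1)d\mu_2(g_2)$, and $L^\infty(\mathcal G_1,\mu_1)\,{}_{r_1}\star_{s_2}L^\infty(\mathcal G_2,\mu_2)$ is its flip; $(g_2,g_1)\mapsto g_2g_1$ identifies this measure space, up to null sets and equivalence of measures, with $(\mathcal G,\mu)$. For a measured groupoid $\mathcal H$, $\mathfrak G(\mathcal H)$ is the commutative measured quantum groupoid with basis $N=L^\infty(\mathcal H^0)$, algebra $L^\infty(\mathcal H)$, $\alpha=r$, $\beta=s$, coproduct $\Gamma_{\mathcal H}(f)(x,y)=f(xy)$ for $s(x)=r(y)$. If $\mathfrak G$ is a measured quantum groupoid with basis $N$, algebra $M$, representations $\alpha,\beta$ of $N$ (resp. $N^o$) and coproduct $\Gamma$, a right (resp. left) action of $\mathfrak G$ on a von Neumann algebra $A$ is a pair $(b,\mathfrak a)$ where $b:N\to A$ is an injective $*$-antihomomorphism (resp. homomorphism), $\mathfrak a:A\to A\,{}_b\star_\alpha M$ (resp. $A\,{}_b\star_\beta M$) is an injective $*$-homomorphism, $\mathfrak a(b(n))=1\otimes\beta(n)$ (resp. $1\otimes\alpha(n)$) for all $n\in N$, and $(\mathfrak a\star\mathrm{id})\mathfrak a=(\mathrm{id}\star\Gamma)\mathfrak a$ (resp. $(\mathfrak a\star\mathrm{id})\mathfrak a=(\mathrm{id}\star\varsigma\Gamma)\mathfrak a$, with $\varsigma$ the flip). *)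

(* Defs.v *)
From HB Require Import structures.
From mathcomp Require Import all_boot all_order all_algebra.
From mathcomp Require Import complex.
From mathcomp Require Import all_classical all_reals all_analysis.

Set Implicit Arguments.
Unset Strict Implicit.
Unset Printing Implicit Defensive.

Import Order.TTheory GRing.Theory Num.Theory.
Import numFieldNormedType.Exports.

Local Open Scope classical_set_scope.
Local Open Scope ring_scope.

(* Algebraic groupoids, presented by their arrows.  The product [gmul] is a
   total function, but nothing is said about [gmul g h] unless [g] and [h] are
   composable; units are identified with identity arrows. *)
Record groupoid (G : Type) := Groupoid {
  gmul : G -> G -> G;
  ginv : G -> G;
  rng g := gmul g (ginv g);
  src g := gmul (ginv g) g;
  ginvK : forall g, ginv (ginv g) = g;
  gmulA : forall g h k, src g = rng h -> src h = rng k ->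
    [/\ src (gmul g h) = rng k, src g = rng (gmul h k)
      & gmul (gmul g h) k = gmul g (gmul h k)];
  gmulKl : forall g h, src g = rng h -> gmul (ginv g) (gmul g h) = h;
  gmulKr : forall g h, src g = rng h -> gmul (gmul g h) (ginv h) = g
}.

Definition units (G : Type) (Q : groupoid G) : set G := [set g | rng Q g = g].

Definition composable (G : Type) (Q : groupoid G) : set (G * G) :=
  [set z | src Q z.1 = rng Q z.2].

Definition subgroupoid (G : Type) (Q : groupoid G) (H : set G) :=
  (forall g, H g -> H (ginv Q g)) /\
  (forall g h, H g -> H h -> src Q g = rng Q h -> H (gmul Q g h)).

(* [rfib Q H u] is H^u = H `&` r^{-1}(u). *)
Definition rfib (G : Type) (Q : groupoid G) (H : set G) (u : G) : set G :=
  H `&` [set h | rng Q h = u].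

Definition sigma_compact (G : topologicalType) :=
  exists K : nat -> set G, (forall n, compact (K n)) /\ \bigcup_n K n = setT.

Definition topological_groupoid (G : topologicalType) (Q : groupoid G) :=
  continuous (ginv Q) /\
  {within composable Q, continuous (fun z => gmul Q z.1 z.2)}.

Notation borel G := (g_sigma_algebraType (@open G)).

Section measured_groupoids.
Context {R : realType} {G : ptopologicalType}.
Variable Q : groupoid G.
Implicit Types (m nu : {measure set (borel G) -> \bar R}) (H : set G).
Implicit Types lam : G -> {measure set (borel G) -> \bar R}.

Definition radon m :=
  [/\ forall K : set G, compact K -> (m K < +oo)%E,
      forall B : set (borel G), measurable B ->
        m B = ereal_inf [set m U | U in [set U : set G | open U /\ B `<=` U]]
    & forall U : set G, open U ->
        m U = ereal_sup [set m K | K in [set K : set G | compact K /\ K `<=` U]]].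

Definition msupport m : set G :=
  [set x | forall U : set G, open U -> U x -> (0 < m U)%E].

(* Restricted to [H], these are the real functions of C_c(H); their values
   outside [H] are irrelevant. *)
Definition Cc H (f : G -> R) :=
  {within H, continuous f} /\
  exists K : set G, [/\ compact K, K `<=` H &
    forall x, H x -> ~ K x -> f x = 0].

(* Left Haar system of the closed subgroupoid [H] (of the whole groupoid when
   [H = setT]).  Radon measures on the closed set [H] are identified with the
   Radon measures on [G] that it supports.  Only the values of [lam] at units
   matter. *)
Record haar_system H lam : Prop := HaarSystem {
  haar_radon : forall u, (H `&` units Q) u -> radon (lam u);
  haar_support : forall u, (H `&` units Q) u -> msupport (lam u) = rfib Q H u;
  haar_continuous : forall f, Cc H f ->
    {within H `&` units Q, continuous (fun u => \int[lam u]_(h in H) f h)};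
  haar_invariant : forall f, Cc H f -> forall g, H g ->
    \int[lam (src Q g)]_(h in rfib Q H (src Q g)) f (gmul Q g h)
      = \int[lam (rng Q g)]_(h in rfib Q H (rng Q g)) f h
}.

(* The measure \int lam^u d nu(u); it is used as a set function. *)
Definition haar_integral lam nu (A : set (borel G)) : \bar R :=
  (\int[nu]_(u in units Q) lam u A)%E.

Definition measure_equiv d (T : measurableType d) (m1 m2 : set T -> \bar R) :=
  m1 `<< m2 /\ m2 `<< m1.

Definition quasi_invariant lam nu :=
  measure_equiv (haar_integral lam nu)
    (pushforward (haar_integral lam nu) (ginv Q : borel G -> borel G)).

(* [nu] is a measure on the closed subset [units Q] of [G]. *)
Record measured_groupoid lam nu : Prop := MeasuredGroupoid {
  mg_hausdorff : hausdorff_space G;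
  mg_sigma_compact : sigma_compact G;
  mg_second_countable : @second_countable G;
  mg_locally_compact : locally_compact [set: G];
  mg_topological : topological_groupoid Q;
  mg_haar : haar_system setT lam;
  mg_radon : radon nu;
  mg_units : nu (~` units Q) = 0%E;
  mg_quasi_invariant : quasi_invariant lam nu
}.

Definition prodset H1 H2 : set G :=
  [set g | exists g1 g2,
    [/\ H1 g1, H2 g2, src Q g1 = rng Q g2 & g = gmul Q g1 g2]].

Record matched_pair lam nu H1 lam1 H2 lam2 : Prop := MatchedPair {
  mp_closed1 : closed H1;
  mp_closed2 : closed H2;
  mp_sub1 : subgroupoid Q H1;
  mp_sub2 : subgroupoid Q H2;
  mp_haar1 : haar_system H1 lam1;
  mp_haar2 : haar_system H2 lam2;
  mp_cap : H1 `&` H2 = units Q;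
  mp_conegligible : (haar_integral lam nu).-negligible (~` prodset H1 H2);
  mp_quasi_invariant : quasi_invariant lam nu;
  mp_quasi_invariant1 : quasi_invariant lam1 nu;
  mp_quasi_invariant2 : quasi_invariant lam2 nu
}.

(* The factorization g = p_1(g) p_2(g): it is unique on H1 H2 as soon as
   H1 `&` H2 consists of units.  Outside H1 H2 the junk value is (r(g), s(g)),
   which still belongs to H1 x H2. *)
Definition factor H1 H2 (g : G) : G * G :=
  xget (rng Q g, src Q g) [set z : G * G |
    [/\ H1 z.1, H2 z.2, src Q z.1 = rng Q z.2 & g = gmul Q z.1 z.2]].

Definition p1 H1 H2 g := (factor H1 H2 g).1.
Definition p2 H1 H2 g := (factor H1 H2 g).2.
Definition mid H1 H2 g := src Q (p1 H1 H2 g).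

End measured_groupoids.

(* A measure space carried by the subset [mdom X] of [T].  The measure is kept
   as a set function so that iterated integrals can be used as measures before
   they are known to be sigma-additive. *)
Record mspace (R : realType) d (T : measurableType d) := MSpace {
  mdom : set T;
  mmeas : set T -> \bar R
}.
Arguments MSpace {R d T}.

(* Elements of the von Neumann algebra L^oo(X) are represented by complex
   functions on [T], two of them being the same element when [Linf_eq] holds;
   a map between such algebras is a map of representatives compatible with
   [Linf_eq]. *)
Section Linfty.
Context {R : realType}.
Local Notation C := R[i].

Definition Linf d (T : measurableType d) (X : mspace R T) : set (T -> C) :=
  [set f : T -> C | [/\ measurable_fun (mdom X) (fun x => complex.Re (f x)),
      measurable_fun (mdom X) (fun x => complex.Im (f x))
    & exists M : R, \forall x \ae mmeas X, mdom X x -> `|f x| <= (M%:C)%C]].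

Definition Linf_eq d (T : measurableType d) (X : mspace R T) (f g : T -> C) :=
  f = g %[ae mmeas X in mdom X].

(* On R[i], [z <= w] means that [w - z] is a nonnegative real. *)
Definition Linf_le d (T : measurableType d) (X : mspace R T) (f g : T -> C) :=
  \forall x \ae mmeas X, mdom X x -> f x <= g x.

Definition Linf_sa d (T : measurableType d) (X : mspace R T) : set (T -> C) :=
  [set f : T -> C | Linf X f /\ Linf_eq X (fun x => (f x)^*%C) f].

Definition is_sup d (T : measurableType d) (X : mspace R T)
    (F : set (T -> C)) (f : T -> C) :=
  [/\ Linf_sa X f, forall g, F g -> Linf_le X g f
    & forall h, Linf_sa X h -> (forall g, F g -> Linf_le X g h) ->
        Linf_le X f h].

Definition upward_directed d (T : measurableType d) (X : mspace R T)
    (F : set (T -> C)) :=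
  F !=set0 /\ forall f g, F f -> F g ->
    exists h, [/\ F h, Linf_le X f h & Linf_le X g h].

(* Normality: preservation of suprema of bounded upward directed sets of
   selfadjoint elements. *)
Record vn_map d d' (T : measurableType d) (T' : measurableType d')
    (X : mspace R T) (Y : mspace R T') (a : (T -> C) -> (T' -> C)) : Prop :=
  VnMap {
  vn_Linf : forall f, Linf X f -> Linf Y (a f);
  vn_eq : forall f g, Linf X f -> Linf X g ->
    Linf_eq X f g -> Linf_eq Y (a f) (a g);
  vn_add : forall f g, Linf X f -> Linf X g ->
    Linf_eq Y (a (fun x => f x + g x)) (fun y => a f y + a g y);
  vn_scale : forall (c : C) f, Linf X f ->
    Linf_eq Y (a (fun x => c * f x)) (fun y => c * a f y);
  vn_star : forall f, Linf X f ->
    Linf_eq Y (a (fun x => (f x)^*%C)) (fun y => (a f y)^*%C);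
  vn_one : Linf_eq Y (a (fun=> 1)) (fun=> 1);
  vn_normal : forall F f, F `<=` Linf_sa X -> upward_directed X F ->
    is_sup X F f -> is_sup Y (a @` F) (a f)
}.

Definition vn_hom d d' (T : measurableType d) (T' : measurableType d')
    (X : mspace R T) (Y : mspace R T') (a : (T -> C) -> (T' -> C)) :=
  vn_map X Y a /\ forall f g, Linf X f -> Linf X g ->
    Linf_eq Y (a (fun x => f x * g x)) (fun y => a f y * a g y).

Definition vn_antihom d d' (T : measurableType d) (T' : measurableType d')
    (X : mspace R T) (Y : mspace R T') (a : (T -> C) -> (T' -> C)) :=
  vn_map X Y a /\ forall f g, Linf X f -> Linf X g ->
    Linf_eq Y (a (fun x => f x * g x)) (fun y => a g y * a f y).

Definition vn_injective d d' (T : measurableType d) (T' : measurableType d')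
    (X : mspace R T) (Y : mspace R T') (a : (T -> C) -> (T' -> C)) :=
  forall f g, Linf X f -> Linf X g ->
    Linf_eq Y (a f) (a g) -> Linf_eq X f g.

End Linfty.

Definition flip (T T' : Type) (z : T * T') : T' * T := (z.2, z.1).

(* The flip of a measure space on T * T'. *)
Definition mflip (R : realType) d d' (T : measurableType d)
    (T' : measurableType d') (X : mspace R (T * T')%type) :
    mspace R (T' * T)%type :=
  MSpace [set z | mdom X (flip z)]
         (fun A => mmeas X [set z | A (flip z)]).

(* Fibre product over U of X along [p] and of the set [D] along [q], where [D]
   is fibred by the measures [k u] carried by D `&` q^{-1}(u): the set
   {(x, y) | p x = q y} with the measure
   F |-> \int \int F(x, y) d(k (p x))(y) d(mmeas X)(x). *)
Definition fibprod (R : realType) (U : Type) d d' (T : measurableType d)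
    (T' : measurableType d') (X : mspace R T) (p : T -> U)
    (D : set T') (q : T' -> U) (k : U -> set T' -> \bar R) :
    mspace R (T * T')%type :=
  MSpace [set z | [/\ mdom X z.1, D z.2 & p z.1 = q z.2]]
         (fun A => \int[mmeas X]_(x in mdom X) k (p x) (xsection A x))%E.

Section actions.
Context {R : realType} {G : ptopologicalType}.
Variables (Q : groupoid G) (nu : {measure set (borel G) -> \bar R}).
Implicit Types (H : set (borel G)) (lam : G -> {measure set (borel G) -> \bar R}).
Local Notation C := R[i].

(* The data of the measured quantum groupoid of (H, lam, nu), for H a closed
   subgroupoid containing all the units: basis N = L^oo(base), algebra
   M = L^oo(galg H lam), representations alpha, beta and coproduct Gamma. *)
Definition base : mspace R (borel G) := MSpace (units Q : set (borel G)) nu.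
Definition galg H lam : mspace R (borel G) :=
  MSpace H (haar_integral Q lam nu).
Definition alpha (n : borel G -> C) : borel G -> C := fun g => n (rng Q g).
Definition beta (n : borel G -> C) : borel G -> C := fun g => n (src Q g).
Definition Gamma (f : borel G -> C) : borel G * borel G -> C :=
  fun z => f (gmul Q z.1 z.2).
Definition flipGamma (f : borel G -> C) : borel G * borel G -> C :=
  fun z => Gamma f (flip z).

(* [(a * id) a = (id * Delta) a], where XM stands for the fibre product of X
   and M, and XMM for the fibre product of XM and M.  The maps [aid = a * id]
   and [idD = id * Delta] are the normal unital *-homomorphisms prescribed on
   elementary tensors (f (x) g)(x, y) = f x * g y; they are unique because these
   generate L^oo(XM). *)
Definition coaction_identity d (T : measurableType d) (X : mspace R T)
    (M : mspace R (borel G)) (XM : mspace R (T * borel G)%type)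
    (XMM : mspace R ((T * borel G) * borel G)%type)
    (a : (T -> C) -> (T * borel G -> C))
    (Delta : (borel G -> C) -> (borel G * borel G -> C)) :=
  exists aid idD : (T * borel G -> C) -> ((T * borel G) * borel G -> C),
  [/\ vn_hom XM XMM aid /\
      (forall f g, Linf X f -> Linf M g ->
        Linf_eq XMM (aid (fun z => f z.1 * g z.2))
                    (fun w => a f w.1 * g w.2)),
      vn_hom XM XMM idD /\
      (forall f g, Linf X f -> Linf M g ->
        Linf_eq XMM (idD (fun z => f z.1 * g z.2))
                    (fun w => f w.1.1 * Delta g (w.1.2, w.2)))
    & forall f, Linf X f -> Linf_eq XMM (aid (a f)) (idD (a f))].

(* Right action (b, a) of the measured quantum groupoid of H on L^oo(X), where
   b is composition with p : T -> H^0. *)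
Definition right_fib H lam d (T : measurableType d) (X : mspace R T)
    (p : T -> borel G) : mspace R (T * borel G)%type :=
  fibprod X p H (rng Q) (fun u => lam u).

Record right_action H lam d (T : measurableType d) (X : mspace R T)
    (p : T -> borel G) (a : (T -> C) -> (T * borel G -> C)) : Prop :=
  RightAction {
  ra_b : vn_antihom base X (fun n x => n (p x));
  ra_b_inj : vn_injective base X (fun n x => n (p x));
  ra_a : vn_hom X (right_fib H lam X p) a;
  ra_a_inj : vn_injective X (right_fib H lam X p) a;
  ra_base : forall n, Linf base n ->
    Linf_eq (right_fib H lam X p) (a (fun x => n (p x)))
            (fun z => beta n z.2);
  ra_coaction : coaction_identity X (galg H lam) (right_fib H lam X p)
    (right_fib H lam (right_fib H lam X p) (fun z => src Q z.2)) a Gamma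
}.

(* For left actions, the set [D] carrying the algebra acted upon is fibred over
   the units, with measures [k u] on the fibres of [p] and total measure
   \int (k u) d nu(u).  The fibre product with M along (p, s) is the flip of the
   fibre product of M and D, and it is again fibred over the units, along
   (x, h) |-> r(h), with fibre measures [left_ker k]. *)
Definition total_space d (T : measurableType d) (D : set T)
    (k : G -> set T -> \bar R) : mspace R T :=
  MSpace D (fun A => \int[nu]_(u in units Q) k u A)%E.

Definition left_fib H lam d (T : measurableType d) (D : set T)
    (p : T -> borel G) (k : G -> set T -> \bar R) :
    mspace R (T * borel G)%type :=
  mflip (fibprod (galg H lam) (src Q) D p k).

Definition left_ker H lam d (T : measurableType d) (D : set T)
    (p : T -> borel G) (k : G -> set T -> \bar R) (u : G) :
    set (T * borel G)%type -> \bar R :=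
  mmeas (mflip (fibprod (MSpace H (lam u)) (src Q) D p k)).

Record left_action H lam d (T : measurableType d) (D : set T)
    (p : T -> borel G) (k : G -> set T -> \bar R)
    (a : (T -> C) -> (T * borel G -> C)) : Prop := LeftAction {
  la_b : vn_hom base (total_space D k) (fun n x => n (p x));
  la_b_inj : vn_injective base (total_space D k) (fun n x => n (p x));
  la_a : vn_hom (total_space D k) (left_fib H lam D p k) a;
  la_a_inj : vn_injective (total_space D k) (left_fib H lam D p k) a;
  la_base : forall n, Linf base n ->
    Linf_eq (left_fib H lam D p k) (a (fun x => n (p x)))
            (fun z => alpha n z.2);
  la_coaction : coaction_identity (total_space D k) (galg H lam)
    (left_fib H lam D p k)
    (left_fib H lam (mdom (left_fib H lam D p k)) (fun z => rng Q z.2)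
       (left_ker H lam D p k)) a flipGamma
}.

Section matched.
Variables (H1 H2 : set (borel G))
  (lam1 lam2 : G -> {measure set (borel G) -> \bar R}).

(* G_2 x G_1 over s_2, r_1, and its flip. *)
Definition fib21 := right_fib H1 lam1 (galg H2 lam2) (src Q).
Definition fib12 := left_fib H2 lam2 H1 (rng Q) (fun u => lam1 u).

Definition mult21 (z : borel G * borel G) : borel G := gmul Q z.1 z.2.
Definition mult12 (z : borel G * borel G) : borel G := gmul Q z.2 z.1.

(* (g_2, g_1) |-> g_2 g_1 identifies G_2 x G_1 with G up to null sets and
   equivalence of measures.  It is injective because H1 `&` H2 consists of
   units, so what is left is that it carries the measure class of [fib21] to
   that of G. *)
Definition product_identification lam :=
  measure_equiv (haar_integral Q lam nu)
    (fun B : set (borel G) => mmeas fib21 (mdom fib21 `&` mult21 @^-1` B)).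

Definition mp_act (f : borel G -> C) : borel G * borel G -> C :=
  fun z => f (p2 Q H1 H2 (gmul Q z.1 z.2)).

Definition mp_dual_act (h : borel G -> C) : borel G * borel G -> C :=
  fun z => h (p1 Q H1 H2 (gmul Q z.2 z.1)).

End matched.
End actions.

(* Main.v *)
Require Import Defs.
From HB Require Import structures.
From mathcomp Require Import all_boot all_order all_algebra.
From mathcomp Require Import complex.
From mathcomp Require Import all_classical all_reals all_analysis.
From mathcomp Require Import measurable_realfun ring.
Set Implicit Arguments.
Unset Strict Implicit.
Unset Printing Implicit Defensive.
Import Order.TTheory GRing.Theory Num.Theory.
Import numFieldNormedType.Exports.
Local Open Scope classical_set_scope.
Local Open Scope ring_scope.

(* Every map of the statement is composition with a Borel map, and composition
   with a Borel map that pulls null sets back to null sets is a normal unital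
   *-homomorphism: an s-finite measure has the null sets of a finite one, for
   which a bounded directed supremum is the supremum of a sequence.  What is left
   is a pointwise identity of factorizations, p_2(g_2 g_1 h) = p_2(p_2(g_2 g_1) h)
   for the right action, and the transfer of null sets.

   The factors p_1, p_2 are Borel because the product G_1 x G_2 -> G is injective
   and continuous on a sigma-compact space.  A Haar system is a Borel kernel,
   left invariant on Borel sets, since indicators of open sets are increasing
   limits of functions in C_c.  Writing g as the inverse of a product g_2 g_1
   gives p_2(g) = g_2^{-1} and p_1(g) = g_1^{-1}, so p_1 and p_2 preserve null sets
   in both directions; left invariance, quasi-invariance and Fubini's theorem
   yield the other transfers. *)

(** * Pullbacks between L^oo spaces *)

(** Why countable suprema: an inequality between classes holds off a null set that depends on the
    element of the directed family, and only countably many such null sets may be united before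
    pulling them back. The identification of G_2 x G_1 with G and the inversion of arrows respect
    null sets only, not measures. Transfers are therefore stated as the vanishing of an integral of
    a nonnegative Borel function, a property that survives equivalence of measures and
    multiplication by a positive, possibly infinite, factor such as the total mass of a fibre. Two
    features of the encoding recur. The product [gmul] is unconstrained off composable pairs, so
    each map is compared, on the domain that matters, with a Borel map defined everywhere. Iterated
    integrals are mere set functions, so each fibre product is first shown to carry an s-finite
    measure. *)

Section finite_equivalent.
Context d (T : measurableType d) (R : realType).
Local Open Scope ereal_scope.

Lemma nneseries_eq0 (u : (\bar R)^nat) : (forall n, 0 <= u n) ->
  \sum_(n <oo) u n = 0 -> forall n, u n = 0.
Proof.
move=> u0; move=> + n; rewrite (@nneseriesD1 _ _ n xpredT)//.
move=> /eqP; rewrite padde_eq0//; last by apply: nneseries_ge0.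
by move=> /andP[/eqP].
Qed.

Lemma sfinite_equiv_finite (M : {sfinite_measure set T -> \bar R}) :
  exists2 P : {measure set T -> \bar R}, P setT < +oo &
    forall A, measurable A -> M A = 0 <-> P A = 0.
Proof.
pose m := sfinite_measure_seq M.
have mfin n : m n setT \is a fin_num by exact: fin_num_measure.
(* With this weight the n-th piece has mass at most 2^-(n+1), so [P] has total mass at most 1;
   positivity of the weights keeps the null sets. Adding 1 keeps the denominator away from 0. *)
have c_gt0 n : (0 < (1 + fine (m n setT))^-1 / (2 ^ n.+1)%:R :> R)%R.
  rewrite divr_gt0// ?invr_gt0 ?ltr0n ?expn_gt0//.
  by rewrite ltr_pwDl// fine_ge0.
pose c n : {nonneg R} := NngNum (ltW (c_gt0 n)).
pose P : {measure set T -> \bar R} := mseries (fun n => mscale (c n) (m n)) 0.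
exists P.
  rewrite /P /= /mseries (@le_lt_trans _ _ 1%:E) ?ltry//.
  apply: (le_trans _ (@epsilon_trick0 R 1%R xpredT ler01)).
  apply: lee_nneseries => // n _.
  rewrite [leLHS](_ : _ = (c n)%:num%:E * m n setT)//.
  rewrite -(fineK (mfin n)) -EFinM lee_fin mulrAC ler_pM2r ?invr_gt0 ?ltr0n ?expn_gt0//.
  have m0 : (0 <= fine (m n setT))%R by rewrite fine_ge0.
  rewrite mulrC ler_pdivrMr; last by rewrite ltr_pwDl.
  by rewrite mul1r lerDr.
have PE A n : mscale (c n) (m n) A = (c n)%:num%:E * m n A by [].
move=> A mA; rewrite sfinite_measure_seqP// -/m; split => h.
  have hA n : m n A = 0 by exact: (@nneseries_eq0 (fun n => m n A)).
  by apply: eseries0 => n _ _; rewrite [LHS]PE hA mule0.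
apply: eseries0 => n _ _.
have : mscale (c n) (m n) A = 0.
  by apply: (@nneseries_eq0 (fun n => mscale (c n) (m n) A)) => [k|//]; rewrite PE mule_ge0// lee_fin ltW.
by move/eqP; rewrite PE mule_eq0 eqe gt_eqF ?(c_gt0 n)//= => /eqP.
Qed.

Lemma eq_ae_null (m1 m2 : set T -> \bar R) (P : T -> Prop) :
  (forall A, measurable A -> m1 A = 0 -> m2 A = 0) ->
  (\forall x \ae m1, P x) -> \forall x \ae m2, P x.
Proof. by move=> h [A [mA A0 NA]]; exists A; split => //; exact: h. Qed.

Import HBNNSimple.

(** The integral evaluates a set function only on level sets of simple functions, which are
    measurable. This is how a bare set function is replaced by the bundled measure that agrees with
    it on measurable sets. *)
Lemma integral_eq_setfun (m1 m2 : set T -> \bar R) :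
  (forall A, measurable A -> m1 A = m2 A) ->
  forall D f, \int[m1]_(x in D) f x = \int[m2]_(x in D) f x.
Proof.
move=> h D f; rewrite /integral.
have sE (g : {nnsfun T >-> R}) : sintegral m1 g = sintegral m2 g.
  rewrite /sintegral; apply: eq_fsbigr => x _; rewrite h//.
have nE g : [set sintegral m1 h0 | h0 in [set h0 : {nnsfun T >-> R} |
      forall x : T, (h0 x)%:E <= g x]] =
    [set sintegral m2 h0 | h0 in [set h0 : {nnsfun T >-> R} |
      forall x : T, (h0 x)%:E <= g x]].
  by apply/seteqP; split=> _ [k kg <-]; exists k => //; rewrite sE.
by rewrite !nE.
Qed.

Lemma ge0_integral_eq0P (m : {measure set T -> \bar R}) D (f : T -> \bar R) :
  measurable D -> measurable_fun D f -> (forall x, 0 <= f x) ->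
  \int[m]_(x in D) f x = 0 <-> \forall x \ae m, D x -> f x = 0.
Proof.
move=> mD mf f0.
have -> : \int[m]_(x in D) f x = \int[m]_(x in D) `|f x|.
  by apply: eq_integral => x _; rewrite gee0_abs.
exact: ae_eq_integral_abs.
Qed.

End finite_equivalent.

(** * Countable subfamilies that realize directed suprema *)

Section directed_sup.
Context d (T : measurableType d) (R : realType).
Variables (P : {measure set T -> \bar R}) (D : set T).
Hypotheses (Pfin : (P setT < +oo)%E) (mD : measurable D).
Implicit Types g h : T -> R.

Let le_ae g h := \forall x \ae P, D x -> g x <= h x.

(* The sequence minimises the distance to the upper bound [f] in L^1. *)
Lemma directed_countable_sup (F : set (T -> R)) (f : T -> R) (M : R) :
  (forall g, F g -> measurable_fun D g) -> measurable_fun D f ->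
  (forall g, F g -> le_ae g f) ->
  F !=set0 ->
  (exists2 g, F g & \forall x \ae P, D x -> f x - g x <= M) ->
  (forall g h, F g -> F h -> exists k, [/\ F k, le_ae g k & le_ae h k]) ->
  exists2 h : nat -> T -> R, (forall n, F (h n)) &
    forall g, F g -> \forall x \ae P, D x ->
      forall z, (forall n, h n x <= z) -> g x <= z.
Proof.
move=> mF mf Ff F0 [g0 Fg0 g0M] dirF.
pose J g := (\int[P]_(x in D) `|f x - g x|%:E)%E.
have mdist (a b : T -> R) : measurable_fun D a -> measurable_fun D b ->
    measurable_fun D (fun x => `|a x - b x|%:E).
  move=> ma mb; apply/measurable_EFinP.
  by apply: measurableT_comp => //; exact: measurable_funB.
have J0 g : (0 <= J g)%E by apply: integral_ge0 => x _; rewrite lee_fin.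
have Jg0 : (J g0 < +oo)%E.
  apply: (@le_lt_trans _ _ (\int[P]_(x in D) (`|M|)%:E)%E).
    apply: ae_ge0_le_integral => //.
    - by apply: mdist => //; exact: mF.
    - have := g0M; have := Ff _ Fg0; rewrite /le_ae.
      apply: filterS2 => x h1 h2 Dx.
      rewrite lee_fin ger0_norm ?subr_ge0 ?h1//.
      by rewrite (le_trans (h2 Dx))// ler_norm.
  rewrite integral_cst// lte_mul_pinfty//.
  by rewrite (le_lt_trans _ Pfin)// le_measure ?inE.
pose c := ereal_inf (J @` F).
have c0 : (0 <= c)%E by apply: le_ereal_inf_tmp => _ [g _ <-].
have cfin : c \is a fin_num.
  rewrite ge0_fin_numE// (le_lt_trans _ Jg0)//.
  by apply: ge_ereal_inf; exists (J g0) => //; exists g0.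
have /choice[h Hh] : forall n : nat, exists g, F g /\ (J g < c + n.+1%:R^-1%:E)%E.
  move=> n.
  have [|_ [g Fg <-] Jg] := @lb_ereal_inf_adherent _ (J @` F) n.+1%:R^-1 _ cfin.
    by rewrite invr_gt0.
  by exists g.
exists h => [n|g Fg]; first by have [] := Hh n.
pose p n x := (Num.max (g x - h n x) 0)%:E.
have mg := mF _ Fg.
have mh n : measurable_fun D (h n) by apply: mF; have [] := Hh n.
have mp n : measurable_fun D (p n).
  apply/measurable_EFinP; apply: measurable_maxr => //.
  exact: measurable_funB.
have p0 n x : (0 <= p n x)%E by rewrite lee_fin le_max lexx orbT.
(* Take [k] in [F] above both [g] and [h n]. Since [h n], [k] and [f] are ordered, the integral of
   [p n] plus [J k] is at most [J (h n)]; as [J k] is at least the infimum [c] and [J (h n)] exceeds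
   it by less than 1/(n+1), the bound follows. *)
have pn n : (\int[P]_(x in D) p n x <= n.+1%:R^-1%:E)%E.
  have [Fhn Jhn] := Hh n.
  have [k [Fk gk hk]] := dirF _ _ Fg Fhn.
  have le1 : (\int[P]_(x in D) p n x + J k <= J (h n))%E.
    rewrite /J -ge0_integralD//; last first.
      by apply: mdist => //; exact: mF.
    apply: ae_ge0_le_integral => //.
    - by move=> x _; rewrite adde_ge0.
    - by apply: emeasurable_funD => //; apply: mdist => //; exact: mF.
    - exact: mdist.
    - have := Ff _ Fk; move: gk hk; rewrite /le_ae.
      apply: filterS3 => x h1 h2 h3 Dx; rewrite -EFinD lee_fin.
      rewrite ger0_norm ?subr_ge0 ?h3// ger0_norm; last first.
        by rewrite subr_ge0 (le_trans (h2 Dx))// h3.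
      rewrite -lerBrDr [leRHS](_ : _ = k x - h n x); last by ring.
      by rewrite ge_max lerD2r h1// subr_ge0 h2.
  have ck : (c <= J k)%E by apply: ge_ereal_inf; exists (J k) => //; exists k.
  have : (\int[P]_(x in D) p n x + c <= c + n.+1%:R^-1%:E)%E.
    rewrite (le_trans _ (ltW Jhn))// (le_trans _ le1)// leeD2l//.
  by rewrite addeC leeD2lE.
(* At a point x where the conclusion fails, there is a k such that [p n x] is at
   least 1/(k+1) for all n. *)
pose B (k : nat) := D `&` \bigcap_n [set x | h n x <= g x - k.+1%:R^-1].
have mB k : measurable (B k).
  have -> : B k = \bigcap_n (D `&` [set x | h n x <= g x - k.+1%:R^-1]).
    apply/seteqP; split=> [x [Dx hx] n _|x hx]; first by split=> //; exact: hx.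
    by split=> [|n _]; [have [] := hx 0%N I|have [] := hx n I].
  apply: bigcapT_measurable => n.
  by apply: measurable_fun_le => //; exact: measurable_funB.
(* Markov's inequality: P(B k)/(k+1) is at most the integral of [p n], hence at most 1/(n+1), for
   every n. *)
have PB k : P (B k) = 0%E.
  apply/eqP; rewrite -measure_le0; apply/lee_addgt0Pr => e e0; rewrite add0e.
  have [n nk] : exists n : nat, k.+1%:R / n.+1%:R <= e.
    have [n hn] : exists n : nat, k.+1%:R / e <= n%:R.
      exists (Num.truncn (k.+1%:R / e)).+1.
      by rewrite ltW//; apply: Num.Theory.truncnS_gt.
    exists n; rewrite ler_pdivrMr// mulrC -ler_pdivrMr//.
    by rewrite (le_trans hn)// ler_nat.
  apply: (@le_trans _ _ (k.+1%:R%:E * n.+1%:R^-1%:E)%E); last first.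
    by rewrite -EFinM lee_fin.
  rewrite -lee_pdivrMl// muleC -[X in (_ * X)%E](_ : (k.+1%:R^-1%:E) = _)//.
  rewrite muleC -integral_cst//.
  apply: le_trans (pn n).
  apply: (@le_trans _ _ (\int[P]_(x in B k) p n x)%E).
    apply: ge0_le_integral => //.
    - by move=> x _; rewrite lee_fin invr_ge0.
    - by apply: measurable_funS (mp n) => // x [].
    - move=> x [_ /(_ n I)/= hx]; rewrite lee_fin le_max.
      by rewrite lerBrDr addrC -lerBrDr hx.
  by apply: ge0_subset_integral => // x [].
apply: (@negligibleS _ _ _ _ (\bigcup_k B k)).
  move=> x /= /not_implyP[Dx /existsNP[z /not_implyP[hz /negP]]].
  rewrite -ltNge => zg.
  have [k hk] : exists k : nat, (g x - z)^-1 <= k.+1%:R.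
    exists (Num.truncn (g x - z)^-1); rewrite ltW//; exact: truncnS_gt.
  exists k => //; split => // n _ /=.
  rewrite (le_trans (hz n))// lerBrDr addrC -lerBrDr.
  rewrite -[leRHS]invrK lef_pV2// posrE ?invr_gt0 ?subr_gt0//.
apply: negligible_bigcup => k; exists (B k); split; [exact: mB|exact: PB|by []].
Qed.

End directed_sup.

Section Linf_pullback.
Context (R : realType).
Local Notation C := R[i].

(** The condition under which the set function [mmeas X] can be treated as a measure. The last field
    lets an integral over [mdom X] be replaced by one over the whole type. *)
Record sfinite_mspace d (T : measurableType d) (X : mspace R T) : Prop :=
  SfiniteMspace {
  sfinite_mdom : measurable (mdom X);
  sfinite_mmeas : exists M : {sfinite_measure set T -> \bar R},
    forall A, measurable A -> mmeas X A = M A;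
  sfinite_null : mmeas X (~` mdom X) = 0%E
}.

Section filter.
Context d (T : measurableType d) (X : mspace R T).
Hypothesis hX : sfinite_mspace X.

Lemma sfinite_ae_filter : Filter (almost_everywhere (mmeas X)).
Proof.
have [M hM] := sfinite_mmeas hX.
suff -> : almost_everywhere (mmeas X) = almost_everywhere M :> set_system T.
  exact: ae_filter_ringOfSetsType.
apply/funext => A; apply/propext; split.
  by apply: eq_ae_null => B mB; rewrite hM.
by apply: eq_ae_null => B mB; rewrite hM.
Qed.

Lemma sfinite_aeW (P : T -> Prop) : (forall x, P x) -> \forall x \ae mmeas X, P x.
Proof. by move=> h; have F := sfinite_ae_filter; apply: filterE. Qed.

Lemma sfinite_ae_foralln (P : nat -> T -> Prop) :
  (forall n, \forall x \ae mmeas X, P n x) ->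
  \forall x \ae mmeas X, forall n, P n x.
Proof.
have [M hM] := sfinite_mmeas hX => h.
have: \forall x \ae M, forall n, P n x.
  by apply: ae_foralln => n; apply: eq_ae_null (h n) => B mB; rewrite hM.
by apply: eq_ae_null => B mB; rewrite hM.
Qed.

Lemma Linf_saP (f : T -> C) : Linf_sa X f ->
  \forall x \ae mmeas X, mdom X x -> complex.Im (f x) = 0.
Proof.
move=> [_]; have F := sfinite_ae_filter.
apply: filterS => x /[apply]; case: (f x) => a b /= [/eqP].
by rewrite eq_sym -addr_eq0 -mulr2n mulrn_eq0/= => /eqP.
Qed.

Lemma Linf_leP (f g : T -> C) : Linf_sa X f -> Linf_sa X g ->
  Linf_le X f g <->
  \forall x \ae mmeas X, mdom X x -> complex.Re (f x) <= complex.Re (g x).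
Proof.
move=> /Linf_saP If /Linf_saP Ig; have F := sfinite_ae_filter; split.
  by apply: filterS => x /[apply]; rewrite lecE => /andP[].
move=> h; move: If Ig h; apply: filterS3 => x + + + Dx.
by move=> /(_ Dx) If /(_ Dx) Ig /(_ Dx) h; rewrite lecE If Ig eqxx.
Qed.

Lemma ler_Re_norm (z : C) (M : R) : `|z| <= (M%:C)%C -> `|complex.Re z| <= M.
Proof. by move=> h; have := le_trans (normc_ge_Re z) h; rewrite lecR. Qed.

(** Real parts are compared under an equivalent finite measure, which yields a sequence [h] in [F]
    dominating every element of [F]. The supremum of [h] is then itself a selfadjoint upper bound of
    [F], so minimality puts [f] below it. *)
Lemma is_sup_countable (F : set (T -> C)) (f : T -> C) :
  F `<=` Linf_sa X -> upward_directed X F -> is_sup X F f ->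
  exists2 h : nat -> T -> C, (forall n, F (h n)) &
    \forall x \ae mmeas X, mdom X x ->
      forall z : R, (forall n, complex.Re (h n x) <= z) -> complex.Re (f x) <= z.
Proof.
move=> Fsa [[g0 Fg0] dirF] [fsa Ff fsup].
have [M hM] := sfinite_mmeas hX.
have [P Pfin MP] := sfinite_equiv_finite M.
have toP (Q : T -> Prop) : (\forall x \ae mmeas X, Q x) -> \forall x \ae P, Q x.
  by apply: eq_ae_null => A mA; rewrite hM// => /MP; exact.
have ofP (Q : T -> Prop) : (\forall x \ae P, Q x) -> \forall x \ae mmeas X, Q x.
  by apply: eq_ae_null => A mA; rewrite hM// => /MP; exact.
have FX := sfinite_ae_filter.
have [[mf _ [Mf hMf]] _] := fsa.
have [[_ _ [Mg hMg]] _] := Fsa _ Fg0.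
pose F' := [set (fun x => complex.Re (g x)) | g in F].
have := @directed_countable_sup _ _ _ P (mdom X) Pfin (sfinite_mdom hX) F'
  (fun x => complex.Re (f x)) (Mf + Mg).
case.
- by move=> _ [g Fg <-]; have [[]] := Fsa _ Fg.
- exact: mf.
- by move=> _ [g Fg <-]; apply: toP; apply/Linf_leP => //; [exact: Fsa|exact: Ff].
- by exists (fun x => complex.Re (g0 x)); exists g0.
- exists (fun x => complex.Re (g0 x)); first by exists g0.
  apply: toP; move: hMf hMg; apply: filterS2 => x h1 h2 Dx.
  have {h1}/ler_Re_norm/ler_normlP[_ h1] := h1 Dx.
  have {h2}/ler_Re_norm/ler_normlP[h2 _] := h2 Dx.
  exact: lerD.
- move=> _ _ [a Fa <-] [b Fb <-]; have [c [Fc ac bc]] := dirF _ _ Fa Fb.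
  exists (fun x => complex.Re (c x)); split; first by exists c.
    by apply: toP; apply/Linf_leP => //; exact: Fsa.
  by apply: toP; apply/Linf_leP => //; exact: Fsa.
move=> h' Fh' hh'.
have /choice[h hE] : forall n, exists k, F k /\ (fun x => complex.Re (k x)) = h' n.
  by move=> n; have [k Fk <-] := Fh' n; exists k.
exists h => [n|]; first by have [] := hE n.
have {}hh' g : F g -> \forall x \ae mmeas X, mdom X x -> forall z,
    (forall n, complex.Re (h n x) <= z) -> complex.Re (g x) <= z.
  move=> Fg; apply: ofP; have := hh' _ (ex_intro2 _ _ g Fg erefl).
  apply: filterS => x /[apply] + z hz; apply => n.
  by have [_ <-] := hE n; exact: hz.
(* Truncation at the essential bound of [f] makes the real supremum [s] well behaved at every point.
   It changes nothing almost everywhere, because each [h n] lies below [f]. The index 0 in [sups]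
   means that the supremum is over the whole sequence. *)
pose t (n : nat) (x : T) : R := Num.min (complex.Re (h n x)) Mf.
pose s (x : T) : R := sups (t ^~ x) 0.
have tub x : has_ubound (range (t ^~ x)).
  by exists Mf => _ [n _ <-]; rewrite /t ge_min lexx orbT.
have ts n x : t n x <= s x.
  rewrite /s /sups; apply: ub_le_sup; last by exists n.
  by exists Mf => _ [k _ <-]; rewrite /t ge_min lexx orbT.
have sz x z : (forall n, t n x <= z) -> s x <= z.
  move=> tz; apply: ge_sup => [|_ [n _ <-] //].
  by exists (t 0%N x); exists 0%N.
have ms : measurable_fun (mdom X) s.
  apply: measurable_fun_sups => [x _|n]; first exact: tub.
  by apply: measurable_minr => //; have [/Fsa[[]]] := hE n.
have [[_ _ [M0 hM0]] _] := Fsa _ (proj1 (hE 0%N)).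
have ssa : Linf_sa X (fun x => (s x)%:C%C).
  split; last by apply: sfinite_aeW => x _; rewrite /= oppr0.
  split => //; exists (`|M0| + `|Mf|).
  move: hM0; apply: filterS => x /[apply] /ler_Re_norm/ler_normlP[h1 h2].
  rewrite normc_def /= expr0n addr0 sqrtr_sqr lecR.
  apply/ler_normlP; split.
    rewrite lerNl; apply: le_trans (ts 0%N x); rewrite /t le_min; apply/andP; split.
      rewrite lerNl (le_trans h1)// (le_trans (ler_norm _))// lerDl//.
    rewrite lerNl (le_trans (ler_norm _))// normrN lerDr//.
  apply: sz => n; rewrite /t ge_min; apply/orP; right.
  by rewrite (le_trans (ler_norm _))// lerDr.
have hMf' : \forall x \ae mmeas X, forall n, mdom X x -> complex.Re (h n x) <= Mf.
  apply: sfinite_ae_foralln => n; have [Fhn _] := hE n.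
  have /Linf_leP := Ff _ Fhn => /(_ (Fsa _ Fhn) fsa).
  move: hMf; apply: filterS2 => x + + Dx => /(_ Dx) + /(_ Dx).
  by move=> /ler_Re_norm/ler_normlP[_ h1] /le_trans; exact.
have Fs g : F g -> Linf_le X g (fun x => (s x)%:C%C).
  move=> Fg; apply/Linf_leP => //; first exact: Fsa.
  have := hh' _ Fg; move: hMf'; apply: filterS2 => x + + Dx.
  move=> h1 /(_ Dx); apply => n.
  by apply: le_trans (ts n x); rewrite /t le_min lexx h1.
have /Linf_leP := fsup _ ssa Fs => /(_ fsa ssa).
apply: filterS => x /[apply] /= h1 z hz; apply: (le_trans h1); apply: sz => n.
by rewrite /t ge_min hz.
Qed.

End filter.

(** * Composition with maps that reflect null sets *)

Section pullback.
Context d d' (T : measurableType d) (T' : measurableType d').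
Variables (X : mspace R T) (Y : mspace R T') (phi : T' -> T).

(** Everything is restricted to [mdom Y] because the maps of the statement involve [gmul], about
    which nothing is known off composable pairs. *)
Record nonsingular : Prop := Nonsingular {
  nonsingular_measurable : measurable_fun (mdom Y) phi;
  nonsingular_dom : forall y, mdom Y y -> mdom X (phi y);
  nonsingular_null : forall N, measurable N -> mmeas X N = 0%E ->
    mmeas Y (mdom Y `&` phi @^-1` N) = 0%E
}.

Hypotheses (hX : sfinite_mspace X) (hY : sfinite_mspace Y).

Lemma sfinite_conull A : measurable A ->
  mmeas Y (mdom Y `&` A) = 0%E <-> mmeas Y A = 0%E.
Proof.
move=> mA; have [M hM] := sfinite_mmeas hY.
have mD := sfinite_mdom hY; have mC := measurableC mD.
have mDA := measurableI _ _ mD mA.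
have := sfinite_null hY; rewrite !hM// => MC; split => h.
  apply: (@subset_measure0 _ _ _ M _ ((mdom Y `&` A) `|` ~` mdom Y)) => //.
  - exact: measurableU.
  - by move=> x Ax; have [Dx|nDx] := pselect (mdom Y x); [left|right].
  - by apply: null_set_setU => //.
by apply: (@subset_measure0 _ _ _ M _ A).
Qed.

(** Replaces [phi] by a total Borel map that agrees with it on the domain; in the applications
    [phi'] is obtained by putting [tmul] for [gmul]. *)
Lemma nonsingular_total (phi' : T' -> T) :
  measurable_fun setT phi' -> (forall y, mdom Y y -> phi y = phi' y) ->
  (forall y, mdom Y y -> mdom X (phi y)) ->
  (forall N, measurable N -> mmeas X N = 0%E -> mmeas Y (phi' @^-1` N) = 0%E) ->
  nonsingular.
Proof.
move=> mphi' pp pD pnull.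
have E N : mdom Y `&` phi @^-1` N = mdom Y `&` phi' @^-1` N.
  by apply/seteqP; split => y [Dy Ny]; split => //=; move: Ny; rewrite /= pp.
split => //.
  apply: (eq_measurable_fun phi'); first by move=> y /[!inE] /pp.
  exact: measurable_funTS.
move=> N mN N0; rewrite E; apply/sfinite_conull; last exact: pnull.
by rewrite -[X in measurable X]setTI; exact: mphi'.
Qed.

Hypothesis hphi : nonsingular.
Let mphi := nonsingular_measurable hphi.
Let phiD := nonsingular_dom hphi.
Let phi_null := nonsingular_null hphi.

Lemma pullback_ae (P : T -> Prop) :
  (\forall x \ae mmeas X, mdom X x -> P x) ->
  \forall y \ae mmeas Y, mdom Y y -> P (phi y).
Proof.
move=> [N [mN N0 hN]].
exists (mdom Y `&` phi @^-1` N); split.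
- by apply: mphi => //; exact: sfinite_mdom hY.
- exact: phi_null.
- by move=> y /= /not_implyP[Dy nP]; split => //; apply: hN => /= /(_ (phiD Dy)).
Qed.

Lemma pullback_Linf f : Linf X f -> Linf Y (fun y => f (phi y)).
Proof.
have mc (g : T -> R) : measurable_fun (mdom X) g ->
    measurable_fun (mdom Y) (fun y => g (phi y)).
  move=> mg; apply: (@measurable_comp _ _ _ _ _ _ (mdom X) g) => //.
    exact: sfinite_mdom hX.
  by move=> _ [y Dy <-]; exact: phiD.
move=> [mR mI [M hM]]; split; [exact: mc mR|exact: mc mI|exists M].
exact: pullback_ae hM.
Qed.

Lemma pullback_Linf_sa f : Linf_sa X f -> Linf_sa Y (fun y => f (phi y)).
Proof.
by move=> [Lf hf]; split; [exact: pullback_Linf|exact: pullback_ae hf].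
Qed.

Lemma pullback_vn_map : vn_map X Y (fun f y => f (phi y)).
Proof.
have FY := sfinite_ae_filter hY.
split.
- exact: pullback_Linf.
- by move=> f g _ _; exact: pullback_ae.
- by move=> f g _ _; exact: sfinite_aeW.
- by move=> c f _; exact: sfinite_aeW.
- by move=> f _; exact: sfinite_aeW.
- exact: sfinite_aeW.
move=> F f Fsa dirF supf; have [fsa Ff _] := supf; split.
- exact: pullback_Linf_sa.
- by move=> _ [g Fg <-]; exact: pullback_ae (Ff _ Fg).
move=> u usa hu.
(* For each [g] in [F] the pullback of [g] lies below [u] off a null set depending on [g]. The
   sequence [h] leaves countably many such sets, hence a single one. *)
have [h Fh hf] := is_sup_countable hX Fsa dirF supf.
apply/(Linf_leP hY _ usa); first exact: pullback_Linf_sa.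
have hn : \forall y \ae mmeas Y, forall n, mdom Y y ->
    complex.Re (h n (phi y)) <= complex.Re (u y).
  apply: (sfinite_ae_foralln hY) => n.
  apply/(Linf_leP hY _ usa); first exact/pullback_Linf_sa/Fsa/Fh.
  by apply: hu; exists (h n).
have := pullback_ae hf; move: hn; apply: filterS2 => y h1 h2 Dy.
by apply: h2 => // n; exact: h1.
Qed.

Lemma pullback_vn_hom : vn_hom X Y (fun f y => f (phi y)).
Proof.
split; first exact: pullback_vn_map.
by move=> f g _ _; exact: sfinite_aeW.
Qed.

Lemma pullback_vn_antihom : vn_antihom X Y (fun f y => f (phi y)).
Proof.
split; first exact: pullback_vn_map.
by move=> f g _ _; apply: sfinite_aeW => // x _; rewrite mulrC.
Qed.

(** The set [E] where two representatives differ is measurable, as equality can be tested on real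
    and imaginary parts. Its preimage lies where the pullbacks differ, so it is null, and the
    hypothesis brings nullity back to [E]. *)
Lemma pullback_vn_injective :
  (forall N, measurable N -> N `<=` mdom X ->
    mmeas Y (mdom Y `&` phi @^-1` N) = 0%E -> mmeas X N = 0%E) ->
  vn_injective X Y (fun f y => f (phi y)).
Proof.
move=> null f g [mRf mIf _] [mRg mIg _] [N [mN N0 hN]].
pose E := mdom X `&` ([set x | complex.Re (f x) != complex.Re (g x)] `|`
  [set x | complex.Im (f x) != complex.Im (g x)]).
have neqP (a b : C) : a <> b ->
    complex.Re a != complex.Re b \/ complex.Im a != complex.Im b.
  move=> ab; apply/orP; rewrite -negb_and; apply/negP => /andP[/eqP h1 /eqP h2].
  by apply: ab; case: a b h1 h2 => [? ?] [? ?] /= -> ->.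
have mE : measurable E.
  have mne (a b : T -> R) : measurable_fun (mdom X) a -> measurable_fun (mdom X) b ->
      measurable (mdom X `&` [set x | a x != b x]).
    move=> ma mb; rewrite [X in _ `&` X](_ : _ = (fun x => a x == b x) @^-1` [set false]).
      by apply: measurable_fun_eqr => //; exact: sfinite_mdom hX.
    by apply/seteqP; split => x /=; [move/negbTE|move=> ->].
  by rewrite /E setIUr; apply: measurableU; apply: mne.
exists E; split => //; last first.
  by move=> x /= /not_implyP[Dx /neqP].
apply: null => //; first by move=> x [].
have [M hM] := sfinite_mmeas hY.
have mpE : measurable (mdom Y `&` phi @^-1` E).
  by apply: mphi => //; exact: sfinite_mdom hY.
rewrite hM//; apply/eqP; rewrite -measure_le0 -N0 hM//.
apply: le_measure; rewrite ?inE//.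
move=> y [Dy [_ Ey]]; apply: hN => /= /(_ Dy) fg.
by move: Ey; rewrite /= fg !eqxx => -[].
Qed.

End pullback.
End Linf_pullback.

(** * S-finite kernels and fibre products *)

Notation pushforward_measure :=
  measure_function_pushforward__canonical__measure_function_Measure.

Section kernel_operations.
Context (R : realType).
Local Open Scope ereal_scope.

(** The kernel obtained has exactly the given measures [k x] as values, so integrals against it
    rewrite directly to integrals against [k x]; the series matters only for measurability and
    s-finiteness. *)
Lemma sfinite_kernel_of_series d d' (X : measurableType d) (Y : measurableType d')
    (k : X -> {measure set Y -> \bar R}) (s : nat -> X -> {measure set Y -> \bar R}) :
  (forall n U, measurable U -> measurable_fun setT (s n ^~ U)) ->
  (forall n, measure_fam_uub (s n)) ->
  (forall x U, measurable U -> k x U = \sum_(n <oo) s n x U) ->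
  exists k' : R.-sfker X ~> Y, forall x, k' x = k x.
Proof.
move=> ms us ks.
pose sm n := isKernel.Build _ _ X Y R (s n) (ms n).
pose sK n : R.-ker X ~> Y := HB.pack (s n) (sm n).
have mk U : measurable U -> measurable_fun setT (k ^~ U).
  move=> mU; rewrite (_ : k ^~ U = fun x => \sum_(n <oo) s n x U).
    apply: ge0_emeasurable_sum => // n _; exact: (ms n U mU).
  by apply/funext => x; rewrite ks.
pose km := isKernel.Build _ _ X Y R k mk.
have sub : exists2 s : (R.-ker X ~> Y)^nat, forall n, measure_fam_uub (s n) &
    forall x U, measurable U -> k x U = kseries s x U.
  by exists sK => // x U mU; rewrite ks.
pose ks' := isSFiniteKernel_subdef.Build _ _ X Y R k sub.
pose K : R.-sfker X ~> Y := HB.pack k km ks'.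
by exists K.
Qed.

Lemma eq_sfinite_kernel d d' (X : measurableType d) (Y : measurableType d')
    (k : X -> {measure set Y -> \bar R}) (K : R.-sfker X ~> Y) :
  (forall x U, measurable U -> k x U = K x U) ->
  exists k' : R.-sfker X ~> Y, forall x, k' x = k x.
Proof.
move=> kK; have [s sE] := sfinite_kernel K.
apply: (@sfinite_kernel_of_series _ _ _ _ _ s).
- by move=> n U mU; exact: measurable_kernel.
- by move=> n; exact: measure_uub.
- by move=> x U mU; rewrite kK// sE.
Qed.

(** The pushforward map may depend on the base point. Measurability in [x] is that of the sections
    of the preimage of a set under [g], measured by the finite pieces of [k]. *)
Lemma kernel_push d d' d'' (X : measurableType d) (Y : measurableType d')
    (Z : measurableType d'') (k : R.-sfker X ~> Y) (g : X * Y -> Z) :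
  measurable_fun setT g ->
  exists k' : R.-sfker X ~> Z, forall x A, k' x A = k x [set y | A (g (x, y))].
Proof.
move=> mg.
have [s ks] := sfinite_kernel k.
have mgx x : measurable_fun setT (fun y => g (x, y)) by exact: measurableT_comp.
pose K x := pushforward_measure (k x) (mgx x).
pose S n x := pushforward_measure (s n x) (mgx x).
have [||x U mU|K' K'E] := @sfinite_kernel_of_series _ _ X Z K S.
- move=> n U mU; rewrite (_ : S n ^~ U = fun x => s n x (xsection (g @^-1` U) x)).
    apply: measurable_fun_xsection_finite_kernel; rewrite inE -[X in measurable X]setTI.
    exact: mg.
  by apply/funext => x; rewrite xsectionE.
- move=> n; have [r hr] := measure_uub (s n); exists r => x.
  by rewrite /S /= /pushforward preimage_setT.
- by rewrite /K /= /pushforward ks// -[X in measurable X]setTI; apply: (mgx x) => //.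
by exists K' => x A; rewrite K'E.
Qed.

Lemma kernel_precomp d d' d'' (X : measurableType d) (Y : measurableType d')
    (Z : measurableType d'') (k : R.-sfker X ~> Z) (f : Y -> X) :
  measurable_fun setT f ->
  exists k' : R.-sfker Y ~> Z, forall y, k' y = k (f y).
Proof.
move=> mf; have [s ks] := sfinite_kernel k.
have [|||K' K'E] := @sfinite_kernel_of_series _ _ Y Z (k \o f) (fun n => s n \o f).
- by move=> n U mU; apply: (measurableT_comp (measurable_kernel (s n) _ mU)).
- by move=> n; have [r hr] := measure_uub (s n); exists r => x; exact: hr.
- by move=> x U mU; rewrite /= ks.
by exists K'.
Qed.

Lemma kernel_comp d d' d'' (X : measurableType d) (Y : measurableType d')
    (Z : measurableType d'') (l : R.-sfker X ~> Y) (k : R.-sfker (X * Y) ~> Z) :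
  exists k' : R.-sfker X ~> Z,
    (forall x A, k' x A = \int[l x]_y k (x, y) A) /\
    (forall x f, (forall z, 0 <= f z) -> measurable_fun setT f ->
      \int[k' x]_z f z = \int[l x]_y \int[k (x, y)]_z f z).
Proof.
exists (l \; k)%E; split=> // x f f0 mf; exact: integral_kcomp.
Qed.

Lemma kernel_measure d d' (X : measurableType d) (Y : measurableType d')
    (k : R.-sfker X ~> Y) x :
  exists M : {sfinite_measure set Y -> \bar R}, (M : {measure set Y -> \bar R}) = k x.
Proof.
pose H := isSFinite.Build _ _ _ (k x) (sfinite_kernel_measure k x).
pose M : {sfinite_measure set Y -> \bar R} := HB.pack (Measure.sort (k x)) H.
by exists M; apply: eq_measure.
Qed.

Lemma measure_kernel d d' (X : measurableType d) (Y : measurableType d')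
    (M : {sfinite_measure set Y -> \bar R}) :
  exists k : R.-sfker X ~> Y, forall x, k x = M :> {measure set Y -> \bar R}.
Proof.
have [|||K' K'E] := @sfinite_kernel_of_series _ _ X Y (fun=> M)
  (fun n => fun=> sfinite_measure_seq M n).
- by move=> n U mU; exact: measurable_cst.
- move=> n; have mfin : sfinite_measure_seq M n setT \is a fin_num.
    exact: fin_num_measure.
  (* A uniform bound in the sense of [measure_fam_uub] is strict, hence the added 1. *)
  exists (fine (sfinite_measure_seq M n setT) + 1)%R => x.
  by rewrite -[X in X < _](fineK mfin) lte_fin ltrDl.
- by move=> x U mU; exact: sfinite_measure_seqP.
by exists K'.
Qed.

Lemma measure_comp d d' (X : measurableType d) (Y : measurableType d')
    (M : {sfinite_measure set X -> \bar R}) (k : R.-sfker X ~> Y) :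
  exists M' : {sfinite_measure set Y -> \bar R},
    (forall A, M' A = \int[M]_x k x A) /\
    (forall f, (forall z, 0 <= f z) -> measurable_fun setT f ->
      \int[M']_z f z = \int[M]_x \int[k x]_z f z).
Proof.
(* A measure is a kernel over a one-point space, so integrating a kernel against a measure is a
   composition of kernels evaluated at [tt]. *)
have [KM KME] := measure_kernel unit M.
have [k2 k2E] := @kernel_precomp _ _ _ _ (unit * X)%type _ k snd measurable_snd.
have [k3 [k3E k3I]] := kernel_comp KM k2.
have [M' M'E] := kernel_measure k3 tt.
exists M'; split => [A|f f0 mf].
  rewrite -[LHS]/((M' : {measure set Y -> \bar R}) A) M'E k3E KME.
  by apply: eq_integral => x _; rewrite k2E.
rewrite -[LHS]/(\int[(M' : {measure set Y -> \bar R})]_z f z) M'E k3I// KME.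
by apply: eq_integral => x _; rewrite k2E.
Qed.

Lemma measure_prod_kernel d d' (X : measurableType d) (Y : measurableType d')
    (M : {sfinite_measure set X -> \bar R}) (k : R.-sfker X ~> Y) :
  exists M' : {sfinite_measure set (X * Y)%type -> \bar R},
    (forall A, M' A = \int[M]_x k x (xsection A x)) /\
    (forall f, (forall z, 0 <= f z) -> measurable_fun setT f ->
      \int[M']_z f z = \int[M]_x \int[k x]_y f (x, y)).
Proof.
have [k2 k2E] := @kernel_push _ _ _ _ _ (X * Y)%type k id (@measurable_id _ _ _).
have [M' [M'E M'I]] := measure_comp M k2.
exists M'; split => [A|f f0 mf].
  by rewrite M'E; apply: eq_integral => x _; rewrite k2E xsectionE.
rewrite M'I//; apply: eq_integral => x _.
have mp : measurable_fun setT (fun y : Y => (x, y)) by exact: measurable_pair1.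
transitivity (\int[pushforward (k x) (fun y => (x, y))]_z f z).
  by apply: integral_eq_setfun => A mA; rewrite k2E.
rewrite ge0_integral_pushforward//.
Qed.

Lemma measurable_kernel_xsection d d' (X : measurableType d) (Y : measurableType d')
    (k : R.-sfker X ~> Y) A : measurable A ->
  measurable_fun setT (fun x => k x (xsection A x)).
Proof.
move=> mA.
have [k2 k2E] := @kernel_push _ _ _ _ _ (X * Y)%type k id (@measurable_id _ _ _).
rewrite (_ : (fun x => _) = k2 ^~ A); first exact: measurable_kernel.
by apply/funext => x; rewrite k2E xsectionE.
Qed.

Lemma measure_push d d' (X : measurableType d) (Y : measurableType d')
    (M : {sfinite_measure set X -> \bar R}) (f : X -> Y) :
  measurable_fun setT f ->
  exists M' : {sfinite_measure set Y -> \bar R}, forall A, M' A = M (f @^-1` A).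
Proof.
move=> mf; have [k kE] := measure_kernel unit M.
have [|k2 k2E] := @kernel_push _ _ _ _ _ Y k (fun z => f z.2).
  exact: measurableT_comp.
have [M' M'E] := kernel_measure k2 tt; exists M' => A.
by rewrite -[LHS]/((M' : {measure set Y -> \bar R}) A) M'E k2E kE.
Qed.

Lemma integral_conull d (X : measurableType d) (m : {measure set X -> \bar R})
    (D : set X) (f : X -> \bar R) :
  measurable D -> m (~` D) = 0 -> measurable_fun setT f -> (forall x, 0 <= f x) ->
  \int[m]_(x in D) f x = \int[m]_x f x.
Proof.
move=> mD mD0 mf f0; rewrite [RHS](@ge0_negligible_integral _ _ _ _ _ (~` D))//.
  by rewrite setTD setCK.
exact: measurableC.
Qed.

(** * Fibre products as s-finite measure spaces *)

Section fibre_product.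
Context d d' (T : measurableType d) (T' : measurableType d') (U : Type).
Variables (X : mspace R T) (p : T -> U) (D : set T') (q : T' -> U)
  (k : U -> set T' -> \bar R) (K : R.-sfker T ~> T').
Hypotheses (hX : sfinite_mspace X)
  (kK : forall x, mdom X x -> forall A, measurable A -> k (p x) A = K x A).

(** The family [k] is indexed by a type without sigma-algebra, so measurability in the index makes
    no sense for it. The kernel [K] on [T] stands for [k (p x)] over the points of the domain. *)
Lemma fibprodE (M : {sfinite_measure set T -> \bar R}) A :
  (forall A, measurable A -> mmeas X A = M A) -> measurable A ->
  mmeas (fibprod X p D q k) A = \int[M]_(x in mdom X) K x (xsection A x).
Proof.
move=> hM mA; rewrite /= (integral_eq_setfun hM).
by apply: eq_integral => x /[!inE] Dx; rewrite kK//; exact: measurable_xsection.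
Qed.

Lemma fibprod_null A : measurable A ->
  mmeas (fibprod X p D q k) A = 0 <->
  \forall x \ae mmeas X, mdom X x -> K x (xsection A x) = 0.
Proof.
move=> mA; have [M hM] := sfinite_mmeas hX; rewrite (fibprodE hM)//.
have mD := sfinite_mdom hX.
have -> : (\forall x \ae mmeas X, mdom X x -> K x (xsection A x) = 0) <->
    (\forall x \ae M, mdom X x -> K x (xsection A x) = 0).
  by split; apply: eq_ae_null => B mB; rewrite hM.
apply: ge0_integral_eq0P => //.
by apply: measurable_funTS; exact: measurable_kernel_xsection.
Qed.

Lemma fibprod_sfinite :
  measurable (mdom (fibprod X p D q k)) ->
  (forall x, mdom X x -> K x (~` [set y | D y /\ p x = q y]) = 0) ->
  sfinite_mspace (fibprod X p D q k).
Proof.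
move=> mdm K0; have [M hM] := sfinite_mmeas hX.
have mD := sfinite_mdom hX.
split => //; last first.
  apply/fibprod_null; first exact: measurableC.
  apply: (sfinite_aeW hX) => x Dx.
  rewrite -[RHS](K0 _ Dx); congr (K x _); apply/seteqP; split => y.
    by move=> /xsectionP /= h [h1 h2]; apply: h.
  by move=> /= h; apply/xsectionP => /= -[h1 h2 h3]; apply: h.
have [M' [M'E _]] := measure_prod_kernel M K.
exists M' => A mA; rewrite (fibprodE hM)// M'E; apply: integral_conull => //.
  by apply: etrans (sfinite_null hX); apply/esym/hM/measurableC.
exact: measurable_kernel_xsection.
Qed.

End fibre_product.

Lemma measurable_flip d d' (T : measurableType d) (T' : measurableType d') :
  measurable_fun setT (@flip T T').
Proof. by apply: measurable_fun_pair. Qed.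

Lemma mflip_sfinite d d' (T : measurableType d) (T' : measurableType d')
    (X : mspace R (T * T')%type) : sfinite_mspace X -> sfinite_mspace (mflip X).
Proof.
move=> hX.
have mf B : measurable B -> measurable [set z : T' * T | B (flip z)].
  by move=> mB; rewrite -[X in measurable X]setTI; exact: measurable_flip.
have mf' B : measurable B -> measurable [set z : T * T' | B (flip z)].
  by move=> mB; rewrite -[X in measurable X]setTI; exact: measurable_flip.
split => /=.
- exact: (mf _ (sfinite_mdom hX)).
- have [M hM] := sfinite_mmeas hX.
  have [M' M'E] := measure_push M (@measurable_flip _ _ T T').
  by exists M' => A mA; rewrite hM ?M'E//; exact: mf'.
- rewrite -(sfinite_null hX); congr (mmeas X _).
  by apply/seteqP; split => -[].
Qed.

End kernel_operations.

(** * Groupoids and factorizations *)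

Section groupoid_theory.
Context (G : Type) (Q : groupoid G).
Local Notation mul := (gmul Q).
Local Notation inv := (ginv Q).
Local Notation r := (rng Q).
Local Notation s := (src Q).

Lemma src_inv g : s (inv g) = r g. Proof. by rewrite /src /rng ginvK. Qed.
Lemma rng_inv g : r (inv g) = s g. Proof. by rewrite /src /rng ginvK. Qed.

Lemma src_mul g h : s g = r h -> s (mul g h) = s h.
Proof. by move=> gh; have [] := gmulA gh (esym (rng_inv h)); rewrite rng_inv. Qed.

Lemma rng_mul g h : s g = r h -> r (mul g h) = r g.
Proof. by move=> gh; have [_ <-] := gmulA (src_inv g) gh; rewrite src_inv. Qed.

Lemma gmul_assoc g h k : s g = r h -> s h = r k -> mul (mul g h) k = mul g (mul h k).
Proof. by move=> gh hk; have [] := gmulA gh hk. Qed.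

Lemma mul_src g : mul g (s g) = g.
Proof. by have := gmulKl (src_inv g); rewrite ginvK. Qed.

Lemma rng_rng g : r (r g) = r g. Proof. by rewrite {2}/rng rng_mul ?rng_inv. Qed.
Lemma rng_src g : r (s g) = s g.
Proof. by rewrite {2}/src rng_mul ?rng_inv ?src_inv. Qed.
Lemma src_src g : s (s g) = s g. Proof. by rewrite {2}/src src_mul ?src_inv. Qed.

Lemma units_rng g : units Q (r g). Proof. exact: rng_rng. Qed.
Lemma units_src g : units Q (s g). Proof. exact: rng_src. Qed.

Lemma inv_mul g h : s g = r h -> inv (mul g h) = mul (inv h) (inv g).
Proof.
move=> gh.
have hg : s (inv h) = r (inv g) by rewrite src_inv rng_inv.
have e : s (mul g h) = r (mul (inv h) (inv g)) by rewrite src_mul// rng_mul// rng_inv.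
have e1 : s (mul g h) = r (inv h) by rewrite src_mul// rng_inv.
(* Insert (gh)^-1 (gh) before h^-1 g^-1: the product ((gh) h^-1) g^-1 collapses to r(g), which is a
   right unit for (gh)^-1. *)
rewrite -[RHS](gmulKl e) -(gmul_assoc e1 hg).
by rewrite gmulKr// -/(rng Q g) -(rng_mul gh) -src_inv mul_src.
Qed.

End groupoid_theory.

Section factorization.
Context (G : ptopologicalType) (Q : groupoid G).
Local Notation mul := (gmul Q).
Local Notation inv := (ginv Q).
Local Notation r := (rng Q).
Local Notation s := (src Q).
Variables (H1 H2 : set G).
Hypotheses (sub1 : subgroupoid Q H1) (sub2 : subgroupoid Q H2)
  (cap : H1 `&` H2 = units Q).

Lemma units_sub1 u : units Q u -> H1 u. Proof. by rewrite -cap => -[]. Qed.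
Lemma units_sub2 u : units Q u -> H2 u. Proof. by rewrite -cap => -[]. Qed.

(** The arrow h1^-1 g1 = h2 g2^-1 lies in both subgroupoids, hence is a unit; so g1 = h1, and
    cancellation gives g2 = h2. *)
Lemma factor_unique g1 g2 h1 h2 : H1 g1 -> H2 g2 -> H1 h1 -> H2 h2 ->
  s g1 = r g2 -> s h1 = r h2 -> mul g1 g2 = mul h1 h2 -> g1 = h1 /\ g2 = h2.
Proof.
move=> Hg1 Hg2 Hh1 Hh2 gg hh E.
have rr : r g1 = r h1 by rewrite -(rng_mul gg) E rng_mul.
have e : s (inv h1) = r g1 by rewrite src_inv.
have K : mul (mul (inv h1) g1) g2 = h2 by rewrite gmul_assoc// E gmulKl.
have e2 : s (mul (inv h1) g1) = r g2 by rewrite src_mul.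
have K2 : mul h2 (inv g2) = mul (inv h1) g1 by rewrite -K gmulKr.
have uu : units Q (mul (inv h1) g1).
  rewrite -cap; split; first by apply: (proj2 sub1) => //; exact: (proj1 sub1).
  rewrite -K2; apply: (proj2 sub2) => //; first exact: (proj1 sub2).
  by rewrite rng_inv -K src_mul.
have g1E : g1 = mul h1 (mul (inv h1) g1).
  by have := gmulKl e; rewrite ginvK.
have h1E : s h1 = mul (inv h1) g1.
  by rewrite -[RHS]uu rng_mul// rng_inv.
have gh : g1 = h1 by rewrite g1E -h1E mul_src.
split => //; rewrite -(gmulKl gg) -(gmulKl hh) E gh; congr mul.
Qed.

(** The junk value (r(g), s(g)) has the right range and source too. Identities that use only the
    range of p_1 and the source of p_2 therefore hold everywhere rather than almost everywhere. *)
Lemma factorP g : let z := Defs.factor Q H1 H2 g in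
  [/\ H1 z.1, H2 z.2, r z.1 = r g & s z.2 = s g].
Proof.
rewrite /Defs.factor; case: xgetP => [z _ /= [z1 z2 zz ->]|_ /=].
  by split => //; rewrite ?rng_mul ?src_mul.
split; [exact/units_sub1/units_rng|exact/units_sub2/units_src|exact: rng_rng|].
exact: src_src.
Qed.

Lemma factor_mul g1 g2 : H1 g1 -> H2 g2 -> s g1 = r g2 ->
  Defs.factor Q H1 H2 (mul g1 g2) = (g1, g2).
Proof.
move=> h1 h2 gg; rewrite /Defs.factor; case: xgetP => [z _ /= [z1 z2 zz E]|/(_ (g1, g2))].
  have [-> ->] := factor_unique h1 h2 z1 z2 gg zz E.
  exact: surjective_pairing.
by case.
Qed.

Lemma p1_in g : H1 (p1 Q H1 H2 g). Proof. by have [] := factorP g. Qed.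
Lemma p2_in g : H2 (p2 Q H1 H2 g). Proof. by have [] := factorP g. Qed.
Lemma rng_p1 g : r (p1 Q H1 H2 g) = r g. Proof. by have [] := factorP g. Qed.
Lemma src_p2 g : s (p2 Q H1 H2 g) = s g. Proof. by have [] := factorP g. Qed.
Lemma p1_mul g1 g2 : H1 g1 -> H2 g2 -> s g1 = r g2 -> p1 Q H1 H2 (mul g1 g2) = g1.
Proof. by move=> *; rewrite /p1 factor_mul. Qed.
Lemma p2_mul g1 g2 : H1 g1 -> H2 g2 -> s g1 = r g2 -> p2 Q H1 H2 (mul g1 g2) = g2.
Proof. by move=> *; rewrite /p2 factor_mul. Qed.

Lemma factor_prodset g : prodset Q H1 H2 g ->
  s (p1 Q H1 H2 g) = r (p2 Q H1 H2 g) /\ g = mul (p1 Q H1 H2 g) (p2 Q H1 H2 g).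
Proof. by move=> [g1 [g2 [h1 h2 e ->]]]; rewrite p1_mul// p2_mul. Qed.

(* Both sides are the second factor of (g h1) h2, with h1 h2 the factorization
   of [h], because g in H1 only alters the first factor. *)
Lemma p2_mull g h : H1 g -> s g = r h -> prodset Q H1 H2 h ->
  p2 Q H1 H2 (mul g h) = p2 Q H1 H2 h.
Proof.
move=> Hg gh [h1 [h2 [H1h H2h hh E]]]; move: gh; rewrite E rng_mul// => gh.
by rewrite -gmul_assoc// !p2_mul ?src_mul//; exact: (proj2 sub1).
Qed.

Lemma p1_mulr g h : H2 h -> s g = r h -> prodset Q H1 H2 g ->
  p1 Q H1 H2 (mul g h) = p1 Q H1 H2 g.
Proof.
move=> Hh gh [g1 [g2 [H1g H2g gg E]]]; move: gh; rewrite E src_mul// => gh.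
by rewrite gmul_assoc// !p1_mul// ?rng_mul//; exact: (proj2 sub2).
Qed.

End factorization.

(** * Borel sets and Borel maps on second countable and sigma-compact spaces *)

Section topology.
Context {G : ptopologicalType}.

Lemma second_countable_seq : @second_countable G ->
  exists b : nat -> set G, (forall n, open (b n)) /\
    forall x U, open U -> U x -> exists n, b n x /\ b n `<=` U.
Proof.
move=> [B cB [oB hB]].
have hB' x U : open U -> U x -> exists V, [/\ B V, V x & V `<=` U].
  move=> oU Ux; have [|V [BV Vx] VU] := hB x U; first exact: open_nbhs_nbhs.
  by exists V.
have /pfcard_geP[B0|[b]] := cB.
  have [V []] := hB' point setT openT I; by rewrite B0.
exists b; split => [n|x U oU Ux]; first by apply: oB; exact: funS.
have [V [BV Vx VU]] := hB' x U oU Ux.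
by have [n _ bn] := @surj _ _ _ _ b V BV; exists n; rewrite bn.
Qed.

Lemma measurable_open (U : set G) : open U -> measurable (U : set (borel G)).
Proof. by move=> oU; exact: sub_sigma_algebra. Qed.

Lemma measurable_closed (F : set G) : closed F -> measurable (F : set (borel G)).
Proof.
by move=> cF; rewrite -(setCK F); apply: measurableC; apply: measurable_open; exact: closed_openC.
Qed.

Lemma measurable_fun_open d (T : measurableType d) (D : set T) (f : T -> borel G) :
  (forall U : set G, open U -> measurable (D `&` f @^-1` U)) -> measurable_fun D f.
Proof.
move=> h; have := @measurability _ _ _ (borel G) D f (@open G) erefl.
by apply => _ [U oU <-]; exact: h.
Qed.

(** Closed sets are the convenient test sets for p_1 and p_2: within G_1 G_2 their preimages are
    continuous images of closed sets. *)
Lemma measurable_fun_closed d (T : measurableType d) (D : set T) (f : T -> borel G) :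
  measurable D ->
  (forall F : set G, closed F -> measurable (D `&` f @^-1` F)) -> measurable_fun D f.
Proof.
move=> mD h; apply: measurable_fun_open => U oU.
have -> : D `&` f @^-1` U = D `\` (D `&` f @^-1` (~` U)).
  apply/seteqP; split=> x [Dx]; first by move=> Ux; split => // -[].
  by move=> nU; split => //; apply: contrapT => nUx; exact: nU.
by apply: measurableD => //; apply: h; exact: open_closedC.
Qed.

Lemma measurable_fun_continuous (f : G -> G) : continuous f ->
  measurable_fun setT (f : borel G -> borel G).
Proof.
move=> cf; apply: measurable_fun_open => U oU; rewrite setTI.
by apply: measurable_open; exact: open_comp.
Qed.

Hypothesis sc : @second_countable G.

(** An open set of the product is a countable union of rectangles of basic open sets, so the product
    of the Borel sigma-algebras contains the Borel sets of the product topology. *)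
Lemma measurable_open_prod (W : set (G * G)) : open W ->
  measurable (W : set (borel G * borel G)).
Proof.
move=> oW; have [b [ob hb]] := second_countable_seq sc.
pose c (n m : nat) : set (borel G * borel G) :=
  if pselect (b n `*` b m `<=` W) then b n `*` b m else set0.
have -> : (W : set (borel G * borel G)) = \bigcup_n \bigcup_m c n m.
  apply/seteqP; split => [[x y] Wxy|z [n _ [m _]]]; last first.
    by rewrite /c; case: pselect => // h /h.
  move: oW; rewrite openE => /(_ _ Wxy) [[A B] [nA nB] AB].
  move: nA nB; rewrite /= !nbhsE => -[A' [oA' A'x] A'A] [B' [oB' B'y] B'B].
  have [n [bx bA]] := hb _ _ oA' A'x; have [m [by_ bB]] := hb _ _ oB' B'y.
  exists n => //; exists m => //; rewrite /c; case: pselect => // -[].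
  by move=> [u v] [/= /bA/A'A Au /bB/B'B Bv]; exact: AB.
apply: bigcupT_measurable => n; apply: bigcupT_measurable => m.
rewrite /c; case: pselect => //= h.
by apply: measurableX; exact: measurable_open.
Qed.

Lemma measurable_closed_prod (W : set (G * G)) : closed W ->
  measurable (W : set (borel G * borel G)).
Proof.
move=> cW; rewrite -(setCK W); apply: measurableC; apply: measurable_open_prod.
exact: closed_openC.
Qed.

Lemma measurable_fun_within_prod (A : set (G * G)) (f : G * G -> G) :
  closed A -> {within A, continuous f} ->
  measurable_fun (A : set (borel G * borel G)) (f : borel G * borel G -> borel G).
Proof.
move=> cA /subspace_continuousP cf.
apply: measurable_fun_open => U oU.
(* Relative continuity says that the set of [z] with [A z -> U (f z)] is a neighbourhood of each
   point of [A] that [f] sends into [U]. Its interior is thus an open set cutting out the preimage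
   in [A]. *)
have -> : A `&` f @^-1` U = A `&` interior [set z | A z -> U (f z)].
  apply/seteqP; split=> z [Az].
    move=> Uz; split => //; apply: (cf z Az); exact: open_nbhs_nbhs.
  by move=> /interior_subset /=; split => //; auto.
apply: measurableI; first exact: measurable_closed_prod.
by apply: measurable_open_prod; exact: open_interior.
Qed.

Lemma closed_eq_hausdorff (T : topologicalType) (f g : T -> G) : hausdorff_space G ->
  continuous f -> continuous g -> closed [set x | f x = g x].
Proof.
move=> hG cf cg; rewrite -[X in closed X]setCK; apply: open_closedC.
rewrite openE => x /= /eqP fg; move: hG; rewrite open_hausdorff.
move=> /(_ _ _ fg)[[A B] /= [/set_mem Afx /set_mem Bgx] [oA oB /eqP AB]].
have nB : nbhs x (g @^-1` B) := cg x B (open_nbhs_nbhs (conj oB Bgx)).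
have nA : nbhs x (f @^-1` A) := cf x A (open_nbhs_nbhs (conj oA Afx)).
change (nbhs x (~` [set x | f x = g x])).
apply: filterS (filterI nA nB) => y [Ay By] E.
have : (A `&` B) (f y) by split => //=; rewrite E.
by rewrite AB.
Qed.

Lemma continuous_comp_within (T : topologicalType) (A : set (G * G)) (f : G * G -> G)
    (h : T -> G * G) : {within A, continuous f} -> continuous h ->
  (forall x, A (h x)) -> continuous (f \o h).
Proof.
move=> /subspace_continuousP cf ch hA x U nU.
have nA : nbhs (h x) [set z | A z -> U (f z)] := cf _ (hA x) _ nU.
have nh : nbhs x (h @^-1` [set z | A z -> U (f z)]) := ch x _ nA.
by apply: (filterS _ nh) => y; exact.
Qed.

Hypothesis sigmac : sigma_compact G.
Hypothesis hG : hausdorff_space G.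

(** By sigma-compactness [A] is a countable union of compact sets, and the image of each is compact,
    hence closed in a Hausdorff space. *)
Lemma measurable_image_prod (A : set (G * G)) (f : G * G -> G) :
  closed A -> {within A, continuous f} -> measurable (f @` A : set (borel G)).
Proof.
move=> cA cf; have [K [cK KT]] := sigmac.
have -> : f @` A = \bigcup_n \bigcup_m (f @` (A `&` (K n `*` K m))).
  apply/seteqP; split => [_ [[x y] Axy <-]|z [n _ [m _ [u [Au _] <-]]]]; last by exists u.
  have [n _ Kx] : (\bigcup_n K n) x by rewrite KT.
  have [m _ Ky] : (\bigcup_n K n) y by rewrite KT.
  by exists n => //; exists m => //; exists (x, y).
apply: bigcupT_measurable => n; apply: bigcupT_measurable => m.
apply: measurable_closed; apply: compact_closed => //.
apply: continuous_compact.
  apply: continuous_subspaceW cf; exact: subIsetl.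
by rewrite setIC; apply: compact_closedI => //; exact: compact_setX.
Qed.

End topology.

(** * Borel measurability of the groupoid operations and of the factors *)

Section topological_groupoids.
Context {G : ptopologicalType} (Q : groupoid G).
Local Notation mul := (gmul Q).
Local Notation inv := (ginv Q).
Local Notation r := (rng Q).
Local Notation s := (src Q).
Hypotheses (sc : @second_countable G) (hG : hausdorff_space G)
  (sigmac : sigma_compact G) (tQ : topological_groupoid Q).

Lemma continuous_inv : continuous inv. Proof. exact: (proj1 tQ). Qed.

Lemma continuous_src : continuous s.
Proof.
apply: (continuous_comp_within (h := fun g => (inv g, g)) (proj2 tQ)).
  by move=> g; apply: cvg_pair; [exact: continuous_inv|exact: cvg_id].
by move=> g; rewrite /composable/= src_inv.
Qed.

Lemma continuous_rng : continuous r.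
Proof.
have -> : (r : G -> G) = s \o inv by apply/funext => g /=; rewrite src_inv.
by move=> g; apply: continuous_comp; [exact: continuous_inv|exact: continuous_src].
Qed.

Lemma closed_composable : closed (composable Q).
Proof.
apply: (@closed_eq_hausdorff _ _ (fun z : G * G => s z.1) (fun z => r z.2)) => //.
  by move=> z; apply: continuous_comp; [exact: cvg_fst|exact: continuous_src].
by move=> z; apply: continuous_comp; [exact: cvg_snd|exact: continuous_rng].
Qed.

Lemma closed_units : closed (units Q).
Proof.
apply: (@closed_eq_hausdorff _ _ r id) => //; first exact: continuous_rng.
by move=> z; exact: cvg_id.
Qed.

Lemma measurable_inv : measurable_fun setT (inv : borel G -> borel G).
Proof. exact: (measurable_fun_continuous continuous_inv). Qed.
Lemma measurable_src : measurable_fun setT (s : borel G -> borel G).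
Proof. exact: (measurable_fun_continuous continuous_src). Qed.
Lemma measurable_rng : measurable_fun setT (r : borel G -> borel G).
Proof. exact: (measurable_fun_continuous continuous_rng). Qed.
Lemma measurable_units : measurable (units Q : set (borel G)).
Proof. exact: (measurable_closed closed_units). Qed.
Lemma measurable_composable : measurable (composable Q : set (borel G * borel G)).
Proof. exact: (measurable_closed_prod sc closed_composable). Qed.

(* The junk value [z.1] off the composable pairs makes this a Borel map. *)
Definition tmul (z : borel G * borel G) : borel G :=
  if pselect (s z.1 = r z.2) then mul z.1 z.2 else z.1.

Lemma tmulE g h : s g = r h -> tmul (g, h) = mul g h.
Proof. by rewrite /tmul; case: pselect. Qed.

Lemma measurable_tmul : measurable_fun setT tmul.
Proof.
have mC := measurable_composable.
have -> : [set: borel G * borel G] =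
    (composable Q : set (borel G * borel G)) `|` ~` composable Q by rewrite setUv.
apply/measurable_funU => //; first exact: measurableC.
split.
  apply: (@eq_measurable_fun _ _ _ _ _ (fun z : borel G * borel G => mul z.1 z.2 : borel G)).
    by move=> z /[!inE] hz; rewrite /tmul; case: pselect.
  exact: (measurable_fun_within_prod sc closed_composable (proj2 tQ)).
apply: (@eq_measurable_fun _ _ _ _ _ (fst : borel G * borel G -> borel G)).
  by move=> z /[!inE] hz; rewrite /tmul; case: pselect.
exact: measurable_funTS.
Qed.

Section factorization_measurable.
Variables (H1 H2 : set G).
Hypotheses (sub1 : subgroupoid Q H1) (sub2 : subgroupoid Q H2)
  (cap : H1 `&` H2 = units Q) (cl1 : closed H1) (cl2 : closed H2).

Let graph (F1 F2 : set G) : set (G * G) := composable Q `&` (F1 `*` F2).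

Let closed_graph F1 F2 : closed F1 -> closed F2 -> closed (graph F1 F2).
Proof.
move=> c1 c2; apply: closedI; first exact: closed_composable.
by apply: closedI; apply: closed_comp => // z _; [exact: cvg_fst|exact: cvg_snd].
Qed.

Let measurable_graph F1 F2 : closed F1 -> closed F2 ->
  measurable ((fun z => mul z.1 z.2) @` graph F1 F2 : set (borel G)).
Proof.
move=> c1 c2; apply: measurable_image_prod => //; first exact: closed_graph.
by apply: continuous_subspaceW (proj2 tQ); exact: subIsetl.
Qed.

Let prodsetE : prodset Q H1 H2 = (fun z => mul z.1 z.2) @` graph H1 H2.
Proof.
apply/seteqP; split => [g [g1 [g2 [h1 h2 e ->]]]|_ [[g1 g2] [/= e [h1 h2]] <-]].
  by exists (g1, g2).
by exists g1, g2.
Qed.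

Lemma measurable_prodset : measurable (prodset Q H1 H2 : set (borel G)).
Proof. by rewrite prodsetE; exact: measurable_graph. Qed.

Let notin_prodset g : ~ prodset Q H1 H2 g -> Defs.factor Q H1 H2 g = (r g, s g).
Proof.
move=> ng; rewrite /Defs.factor; case: xgetP => // z _ /= [? ? ? E].
by exfalso; apply: ng; exists z.1, z.2.
Qed.

Lemma measurable_p1 : measurable_fun setT (p1 Q H1 H2 : borel G -> borel G).
Proof.
have mP := measurable_prodset.
have -> : [set: borel G] =
    (prodset Q H1 H2 : set (borel G)) `|` ~` prodset Q H1 H2 by rewrite setUv.
apply/measurable_funU => //; first exact: measurableC.
split; last first.
  apply: (@eq_measurable_fun _ _ _ _ _ (r : borel G -> borel G)).
    by move=> g /[!inE] /notin_prodset E; rewrite /p1 E.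
  by apply: measurable_funTS; exact: measurable_rng.
apply: measurable_fun_closed => // F cF.
(* By uniqueness of the factorization, the elements of G_1 G_2 whose first factor lies in [F] are
   exactly the products of composable pairs from the closed sets [H1]&[F] and [H2]. *)
rewrite (_ : _ `&` _ = (fun z => mul z.1 z.2) @` graph (H1 `&` F) H2).
  by apply: measurable_graph => //; exact: closedI.
apply/seteqP; split => [g [[g1 [g2 [h1 h2 e ->]]]]|_ [[g1 g2] [/= e [[h1 Fg] h2]] <-]].
  by rewrite /= p1_mul// => Fg; exists (g1, g2).
by split; [exists g1, g2|rewrite /= p1_mul].
Qed.

Lemma measurable_p2 : measurable_fun setT (p2 Q H1 H2 : borel G -> borel G).
Proof.
have mP := measurable_prodset.
have -> : [set: borel G] =
    (prodset Q H1 H2 : set (borel G)) `|` ~` prodset Q H1 H2 by rewrite setUv.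
apply/measurable_funU => //; first exact: measurableC.
split; last first.
  apply: (@eq_measurable_fun _ _ _ _ _ (s : borel G -> borel G)).
    by move=> g /[!inE] /notin_prodset E; rewrite /p2 E.
  by apply: measurable_funTS; exact: measurable_src.
apply: measurable_fun_closed => // F cF.
rewrite (_ : _ `&` _ = (fun z => mul z.1 z.2) @` graph H1 (H2 `&` F)).
  by apply: measurable_graph => //; exact: closedI.
apply/seteqP; split => [g [[g1 [g2 [h1 h2 e ->]]]]|_ [[g1 g2] [/= e [h1 [h2 Fg]]] <-]].
  by rewrite /= p2_mul// => Fg; exists (g1, g2).
by split; [exists g1, g2|rewrite /= p2_mul].
Qed.

End factorization_measurable.
End topological_groupoids.

(** * Haar systems as Borel kernels *)

Section compactly_supported_approximation.
Context {R : realType} {G : ptopologicalType}.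
Hypotheses (sc : @second_countable G) (hG : hausdorff_space G)
  (lc : locally_compact [set: G]).

Definition open_approximation (U : set G) (f : nat -> G -> R) :=
  [/\ forall n, continuous (f n),
      forall n, exists2 K, compact K & forall y, ~ K y -> f n y = 0,
      forall n y, 0 <= f n y <= 1,
      forall y, {homo f ^~ y : n m / (n <= m)%N >-> n <= m}
    & forall y, f n y @[n --> \oo] --> (\1_U y : R)].

(** Complete regularity separates [x] from the complement of the part of [U] interior to a compact
    neighbourhood [N]; restricting to [N] gives the compact support. The separating function is 0 at
    [x] and 1 off that part, so the bump is 1 minus it. *)
Lemma exists_bump (x : G) (U : set G) : open U -> U x ->
  exists phi : G -> R, [/\ continuous phi, forall y, 0 <= phi y,
    exists2 K, compact K & forall y, ~ K y -> phi y = 0,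
    forall y, ~ U y -> phi y = 0 & 0 < phi x].
Proof.
move=> oU Ux; have [N] := lc (x := x) I; rewrite withinET => nN [cN clN].
pose W := U `&` interior N.
have oW : open W by apply: openI => //; exact: open_interior.
have Wx : W x by split.
have := @locally_compact_completely_regular G R lc hG x (~` W).
move=> /(_ (open_closedC oW)) /(_ (fun h => h Wx)).
move=> /uniform_separatorP => /(_ R)[f [cf f01 f0 f1]].
have W1 y : ~ W y -> f y = 1 by move=> nW; apply: f1; exists y.
exists (fun y => 1 - f y); split.
- by move=> y; apply: continuousB; [exact: cvg_cst|exact: cf].
- move=> y; have := f01 (f y) (ex_intro2 _ _ y I erefl).
  by rewrite /= in_itv/= subr_ge0 => /andP[].
- exists N => // y nNy; rewrite W1 ?subrr// => -[_ /interior_subset]; exact: nNy.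
- by move=> y nUy; rewrite W1 ?subrr// => -[].
- by rewrite (f0 (f x)) ?subr0//; exists x.
Qed.

Lemma exists_open_approximation (U : set G) : open U ->
  exists f, open_approximation U f.
Proof.
move=> oU; have [b [ob hb]] := second_countable_seq sc.
(* To each basic open set [b n] attach a bump in [U] that is positive on all of [b n] when one
   exists, and 0 otherwise. A point of [U] has a bump around it, whose positivity set contains some
   [b k] around the point, so the k-th chosen function is positive there. *)
pose good n (phi : G -> R) := [/\ continuous phi, forall y, 0 <= phi y,
    exists2 K, compact K & forall y, ~ K y -> phi y = 0,
    forall y, ~ U y -> phi y = 0 &
    (exists phi' : G -> R, [/\ continuous phi', forall y, 0 <= phi' y,
      exists2 K, compact K & forall y, ~ K y -> phi' y = 0,
      forall y, ~ U y -> phi' y = 0 & forall y, b n y -> 0 < phi' y]) ->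
      forall y, b n y -> 0 < phi y].
have /choice[phi phiP] : forall n, exists phi, good n phi.
  move=> n; have [[phi' [h1 h2 h3 h4 h5]]|nphi] := pselect (exists phi' : G -> R,
      [/\ continuous phi', forall y, 0 <= phi' y,
      exists2 K, compact K & forall y, ~ K y -> phi' y = 0,
      forall y, ~ U y -> phi' y = 0 & forall y, b n y -> 0 < phi' y]).
    by exists phi'; split.
  exists (fun=> 0); split => //; first by move=> y; exact: cvg_cst.
  by exists set0 => //; exact: compact0.
pose S n y := \sum_(i < n) phi i y.
have S0 n y : 0 <= S n y by apply: sumr_ge0 => i _; have [] := phiP i.
have cS n : continuous (S n).
  elim: n => [|n IH].
    rewrite (_ : S 0%N = fun=> 0); last by apply/funext => y; rewrite /S big_ord0.
    by move=> y; exact: cvg_cst.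
  rewrite (_ : S n.+1 = fun y => S n y + phi n y); last first.
    by apply/funext => y; rewrite /S big_ord_recr.
  by move=> y; apply: continuousD; [exact: IH|have [h _ _ _ _] := phiP n; exact: h].
have KS n : exists2 K, compact K & forall y, ~ K y -> S n y = 0.
  elim: n => [|n [K cK SK]].
    by exists set0; [exact: compact0|move=> y _; rewrite /S big_ord0].
  have [_ _ [K' cK' pK'] _ _] := phiP n.
  exists (K `|` K'); first exact: compactU.
  move=> y nK; rewrite /S big_ord_recr/= -/(S n y) SK ?pK' ?addr0//.
    by move=> h; apply: nK; right.
  by move=> h; apply: nK; left.
exists (fun n y => Num.min 1 (n%:R * S n y)); split.
- move=> n y; apply: (@continuous_min _ _ (fun=> 1) (fun y => n%:R * S n y)).
    exact: cvg_cst.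
  by apply: continuousM; [exact: cvg_cst|exact: cS].
- move=> n; have [K cK SK] := KS n; exists K => // y /SK ->.
  by rewrite mulr0; apply/min_idPr.
- by move=> n y; rewrite le_min ler01 mulr_ge0//= ge_min lexx.
- move=> y n m nm; rewrite le_min ge_min lexx/= ge_min; apply/orP; right.
  apply: ler_pM => //; first by rewrite ler_nat.
  rewrite /S -(subnKC nm) big_split_ord/= lerDl; apply: sumr_ge0 => i _.
  by have [] := phiP (n + i)%N.
move=> y; rewrite indicE; case: (boolP (y \in U)) => [/set_mem Uy|/negP nUy].
  have [phi' [c1 c2 c3 c4 c5]] := exists_bump oU Uy.
  have oV : open [set z | 0 < phi' z].
    have -> : [set z | 0 < phi' z] = phi' @^-1` [set t | 0 < t] by [].
    apply: open_comp; first by move=> z _; exact: c1.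
    exact: open_gt.
  have [k [bk bV]] := hb y _ oV c5.
  have pk : 0 < phi k y.
    have [_ _ _ _] := phiP k; apply=> //.
    by exists phi'; split => // z /bV.
  apply: cvg_near_cst.
  (* The first bound puts [phi k] among the summands of [S n], the second makes n times [phi k y] at
     least 1, so the minimum with 1 has reached 1. *)
  exists (maxn k.+1 (Num.truncn (phi k y)^-1).+1) => // n /= hn.
  apply/min_idPl.
  have kn : (k < n)%N by rewrite (leq_trans _ hn)// leq_max leqnn.
  apply: (@le_trans _ _ (n%:R * phi k y)).
    rewrite -ler_pdivrMr// div1r ltW//.
    apply: lt_le_trans (truncnS_gt _) _.
    by rewrite ler_nat (leq_trans _ hn)// leq_max leqnn orbT.
  rewrite ler_wpM2l// /S (bigD1 (Ordinal kn))//= lerDl.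
  by apply: sumr_ge0 => i _; have [] := phiP i.
apply: cvg_near_cst; exists 0%N => // n _ /=.
rewrite /S big1 ?mulr0; first by apply/min_idPr.
by move=> i _; have [_ _ _ h _] := phiP i; apply: h => Uy; apply: nUy; rewrite inE.
Qed.

(** A countable open cover by sets of finite Haar measure. It serves to cut a Haar system into
    finite pieces and to apply uniqueness of measures that agree on open sets. *)
Lemma relatively_compact_cover : exists c : nat -> set G,
  [/\ forall n, open (c n), forall n, exists2 K, compact K & c n `<=` K &
      \bigcup_n c n = setT].
Proof.
have [b [ob hb]] := second_countable_seq sc.
exists (fun n => if pselect (exists2 K, compact K & b n `<=` K) then b n else set0).
split.
- by move=> n; case: pselect => //= _; exact: open0.
- by move=> n; case: pselect => //= _; exists set0 => //; exact: compact0.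
apply/seteqP; split => // x _.
have [N] := lc (x := x) I; rewrite withinET => nN [cN clN].
have [n [bx bN]] := hb x (interior N) (@open_interior _ N) nN.
exists n => //; case: pselect => //= -[]; exists N => //.
exact: subset_trans bN (@interior_subset _ N).
Qed.

(** Monotone convergence. The map [g] is the identity or, on one side of left invariance, the
    translation by an arrow. *)
Lemma open_approximation_integral (U : set G) f
    (m : {measure set (borel G) -> \bar R}) (D : set (borel G))
    (g : borel G -> borel G) :
  open_approximation U f -> open U -> measurable D -> measurable_fun D g ->
  (\int[m]_(h in D) (f n (g h))%:E)%E @[n --> \oo] --> m (D `&` g @^-1` U).
Proof.
move=> [cf _ f01 fnd fU] oU mD mg.
have mf n : measurable_fun setT (f n : borel G -> R).
  apply: (@measurability _ _ _ _ _ _ _ (RGenOInfty.measurableE R)).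
  move=> _ [_ [x ->] <-]; rewrite setTI; apply: measurable_open.
  apply: open_comp; first by move=> z _; exact: cf.
  exact: rray_open.
have mU := measurable_open oU.
have -> : m (D `&` g @^-1` U) =
    (\int[m]_(h in D) limn (fun n => (f n (g h))%:E))%E.
  have mI : measurable (D `&` g @^-1` U) by exact: mg.
  transitivity (m ((D `&` g @^-1` U) `&` D)); first by rewrite setIAC setIid.
  rewrite -integral_indic//.
  apply: eq_integral => h /[!inE] Dh; apply/esym/cvg_lim => //.
  have -> : \1_(D `&` g @^-1` U) h = \1_U (g h) :> R.
    rewrite !indicE; have [Ugh|nUgh] := pselect (U (g h)); first by rewrite !mem_set.
    by rewrite !memNset// => -[].
  by apply: cvg_EFin; [exact: nearW|exact: fU].
apply: cvg_monotone_convergence => //.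
- move=> n; apply/measurable_EFinP.
  by apply: (measurableT_comp (mf n)).
- by move=> n x _; rewrite lee_fin; have /andP[] := f01 n (g x).
- by move=> x _ n k nk; rewrite lee_fin fnd.
Qed.

End compactly_supported_approximation.

Lemma measurable_fun_within_real {R : realType} {G : ptopologicalType}
    (A : set G) (f : G -> R) : closed A -> {within A, continuous f} ->
  measurable_fun (A : set (borel G)) (f : borel G -> R).
Proof.
move=> cA /subspace_continuousP cf.
apply: (@measurability _ _ _ _ _ _ _ (RGenOInfty.measurableE R)).
move=> _ [_ [x ->] <-].
have oI : open (`]x, +oo[%classic : set R) by exact: rray_open.
have -> : A `&` f @^-1` `]x, +oo[%classic =
    A `&` interior [set z | A z -> `]x, +oo[%classic (f z)].
  apply/seteqP; split=> z [Az].
    move=> Uz; split => //; exact: (cf z Az _ (open_nbhs_nbhs (conj oI Uz))).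
  by move=> /interior_subset /=; split => //; auto.
apply: measurableI; first exact: measurable_closed.
by apply: measurable_open; exact: open_interior.
Qed.

(** * Haar systems: fibres, Borel dependence on the unit, left invariance on Borel sets *)

Section haar_systems.
Context {R : realType} {G : ptopologicalType} (Q : groupoid G).
Local Notation mul := (gmul Q).
Local Notation inv := (ginv Q).
Local Notation r := (rng Q).
Local Notation s := (src Q).
Hypotheses (sc : @second_countable G) (hG : hausdorff_space G)
  (lc : locally_compact [set: G]) (tQ : topological_groupoid Q).
Variables (H : set G) (lam : G -> {measure set (borel G) -> \bar R}).
Hypotheses (clH : closed H) (unitsH : units Q `<=` H)
  (haarH : haar_system Q H lam).

Lemma haar_compact u (K : set G) : units Q u -> compact K -> (lam u K < +oo)%E.
Proof.
move=> uu; have [h _ _] := haar_radon haarH (conj (unitsH uu) uu).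
exact: h.
Qed.

Lemma measurable_rfib u : measurable (rfib Q H u : set (borel G)).
Proof.
apply: measurable_closed; apply: closedI => //.
apply: (@closed_eq_hausdorff _ _ r (fun=> u)) => //.
  exact: continuous_rng.
by move=> x; exact: cvg_cst.
Qed.

(** Off the support every point has a null open neighbourhood, which may be taken in the countable
    base; the complement of the support is thus covered by countably many null sets. *)
Lemma haar_fibre u : units Q u -> lam u (~` rfib Q H u) = 0%E.
Proof.
move=> uu; have [b [ob hb]] := second_countable_seq sc.
have mb n : measurable (b n : set (borel G)) by exact: measurable_open.
apply: (@subset_measure0 _ _ _ (lam u) _
   (\bigcup_(n in [set n | lam u (b n) = 0%E]) b n)) => //.
- by apply: measurableC; exact: measurable_rfib.
- exact: bigcup_measurable.
- move=> x; rewrite -(haar_support haarH (conj (unitsH uu) uu)) => /existsNP[U].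
  move=> /not_implyP[oU /not_implyP[Ux /negP]]; rewrite -leNgt => U0.
  have [n [bx bU]] := hb x U oU Ux; exists n => //=.
  apply/eqP; rewrite -measure_le0 (le_trans _ U0)//.
  by apply: le_measure; rewrite ?inE//; exact: measurable_open.
- apply/(negligibleP (lam u)); first exact: bigcup_measurable.
  pose c n : set (borel G) := if pselect (lam u (b n) = 0%E) then b n else set0.
  apply: (@negligibleS _ _ _ _ (\bigcup_n c n)).
    by move=> x [n n0 bx]; exists n => //; rewrite /c; case: pselect.
  apply: negligible_bigcup => n; rewrite /c; case: pselect => /= [n0|_].
    by exists (b n); split => //; exact: mb.
  exact: negligible_set0.
Qed.

(** The unit [u] itself belongs to the support of the measure at [u]. Positivity is what allows an
    idle variable to be integrated out without affecting whether an integral vanishes. *)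
Lemma haar_pos u : units Q u -> (0 < lam u setT)%E.
Proof.
move=> uu; have : rfib Q H u u by split; [exact: unitsH|exact: uu].
rewrite -(haar_support haarH (conj (unitsH uu) uu)); apply => //.
exact: openT.
Qed.

Lemma haar_conull (D A : set (borel G)) u : units Q u -> measurable D -> measurable A ->
  rfib Q H u `<=` D -> lam u (D `&` A) = lam u A.
Proof.
move=> uu mD mA RD; apply/eqP; rewrite eq_le; apply/andP; split.
  by apply: le_measure; rewrite ?inE//; exact: measurableI.
have mC : measurable (~` rfib Q H u : set (borel G)).
  by apply: measurableC; exact: measurable_rfib.
apply: (@le_trans _ _ (lam u ((D `&` A) `|` ~` rfib Q H u))).
  apply: le_measure; rewrite ?inE//; first by apply: measurableU => //; exact: measurableI.
  move=> x Ax; have [Rx|] := pselect (rfib Q H u x); last by right.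
  by left; split => //; exact: RD.
apply: (le_trans (measureU2 _ _ _)) => //; first exact: measurableI.
by rewrite [X in (_ + X)%E](_ : _ = 0%E) ?adde0//; exact: haar_fibre.
Qed.

Lemma Cc_approximation (U : set G) f n : open_approximation U f ->
  @Cc R G H (f n).
Proof.
move=> [cf cK _ _ _]; split; first by apply: continuous_subspaceT; exact: cf.
have [K compK fK] := cK n; exists (K `&` H); split.
- exact: compact_closedI.
- by move=> x [].
- by move=> x Hx nK; apply: fK => Kx; apply: nK.
Qed.

(** The axioms of a Haar system speak of real integrals, that is, of finite parts of extended ones;
    finiteness is needed to return to extended integrals. The condition on [g] keeps the support of
    the composite inside a compact set. *)
Lemma haar_approximation_fin (U : set G) f n u (D : set (borel G)) (g : borel G -> borel G) :
  open_approximation U f -> units Q u -> measurable D -> measurable_fun D g ->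
  (forall K : set G, compact K -> exists2 K', compact K' & D `&` g @^-1` K `<=` K') ->
  (\int[lam u]_(h in D) (f n (g h))%:E)%E \is a fin_num.
Proof.
move=> [cf cK f01 _ _] uu mD mg gK.
have [K compK fK] := cK n; have [K' compK' KK'] := gK K compK.
have mK : measurable (K' : set (borel G)) by apply: measurable_closed; exact: compact_closed.
have mf : measurable_fun setT (f n : borel G -> R).
  by apply: measurable_fun_within_real; [exact: closedT|apply: continuous_subspaceT; exact: cf].
have f0 x : (0 <= (f n (g x))%:E)%E by rewrite lee_fin; have /andP[] := f01 n (g x).
rewrite ge0_fin_numE; last by apply: integral_ge0.
apply: (@le_lt_trans _ _ (\int[lam u]_(h in D) (\1_K' h)%:E)%E).
  apply: ge0_le_integral => //.
  - apply/measurable_EFinP.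
    by apply: (measurableT_comp mf).
  - by apply/measurable_EFinP.
  - move=> x Dx; rewrite lee_fin indicE.
    case: (boolP (x \in K')) => [_|/negP nK]; first by have /andP[] := f01 n (g x).
    by rewrite fK// => Kx; apply: nK; rewrite inE; apply: KK'.
rewrite integral_indic//; apply: (le_lt_trans _ (haar_compact uu compK')).
by apply: le_measure; rewrite ?inE//; exact: measurableI.
Qed.

Lemma haar_measurable_open (U : set G) : open U ->
  measurable_fun setT (fun u : borel G => lam (r u) U).
Proof.
move=> oU; have [f fU] := exists_open_approximation sc hG lc oU (R := R).
have mH := measurable_closed clH; have mU := measurable_open oU.
have mr : measurable_fun setT (r : borel G -> borel G) by exact: measurable_rng.
apply: (@emeasurable_fun_cvg _ _ _ _
  (fun n (u : borel G) => (\int[lam (r u)]_(h in H) (f n h)%:E)%E)); last first.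
  move=> u _; have uu := @units_rng _ Q u.
  rewrite -(haar_conull uu mH mU); last by move=> x [].
  exact: (open_approximation_integral (m := lam (r u)) fU oU mH (@measurable_id _ (borel G) H)).
move=> n.
pose phi (u : borel G) : R := (\int[lam u]_(h in H) f n h)%R.
have mphi : measurable_fun (units Q : set (borel G)) phi.
  apply: measurable_fun_within_real; first exact: closed_units.
  have := haar_continuous haarH (Cc_approximation n fU).
  by rewrite setIidr.
rewrite (_ : (fun u => _) = EFin \o (phi \o r)); last first.
  apply/funext => u /=; rewrite /phi /Rintegral fineK//.
  apply: (@haar_approximation_fin U f n (r u) H id) => //; first exact: units_rng.
  by move=> K cK; exists K => // x [].
apply/measurable_EFinP.
apply: (@measurable_comp _ _ _ _ _ _ (units Q : set (borel G)) phi) => //.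
  exact: measurable_units.
by move=> _ [u _ <-]; exact: units_rng.
Qed.

(** A Dynkin class argument starting from open sets. The intersection with the relatively compact
    [V] makes all measures finite, so that the measure of a proper difference is a difference of
    measures. *)
Lemma haar_measurable_relatively_compact (V K : set G) (A : set (borel G)) :
  open V -> compact K -> V `<=` K -> measurable A ->
  measurable_fun setT (fun u : borel G => lam (r u) (A `&` V)).
Proof.
move=> oV cK VK mA; have mV := measurable_open oV.
pose D : set (set (borel G)) := [set B | measurable B /\
  measurable_fun setT (fun u : borel G => lam (r u) (B `&` (V : set (borel G))))].
suff : measurable `<=` D by move=> h; have [] := h A mA.
have Vfin u B : measurable B -> lam (r u) (B `&` (V : set (borel G))) \is a fin_num.
  move=> mB; rewrite ge0_fin_numE//.
  apply: (@le_lt_trans _ _ (lam (r u) K)); last by apply: haar_compact => //; exact: units_rng.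
  apply: le_measure; rewrite ?inE//; first exact: measurableI.
    by apply: measurable_closed; exact: compact_closed.
  by move=> x [_ /VK].
have := @lambda_system_subset (borel G) (@open G) (fun _ _ => @openI _ _ _) setT D.
apply => //; last first.
  by move=> B oB; split; [exact: measurable_open|apply: haar_measurable_open; exact: openI].
split => //.
- by split => //; apply: haar_measurable_open; exact: openI openT oV.
- move=> B B' B'B [mB hB] [mB' hB']; split; first exact: measurableD.
  rewrite (_ : (fun u => _) = (fun u => lam (r u) (B `&` (V : set (borel G))) - lam (r u) (B' `&` (V : set (borel G))))%E).
    exact: emeasurable_funB.
  apply/funext => u; pose V' : set (borel G) := V.
  transitivity (lam (r u) ((B `&` V') `\` (B' `&` V'))).
    congr (lam _ _); apply/seteqP; split => [x [[Bx B'x] Vx]|x [[Bx Vx] nB']].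
      by split=> // -[].
    by split=> //; split=> // B'x; apply: nB'.
  have mBV : measurable (B `&` V') by exact: measurableI.
  have mBV' : measurable (B' `&` V') by exact: measurableI.
  apply: (etrans (measureD mBV mBV' _)).
    by rewrite ltey_eq Vfin.
  congr (_ - lam _ _)%E; apply/seteqP; split => [x [[Bx Vx] [B'x _]]|x [B'x Vx]] //.
  by split => //; split => //; exact: B'B.
- move=> F ndF hF.
  have mF n : measurable (F n) by have [] := hF n.
  split; first exact: bigcupT_measurable.
  apply: (@emeasurable_fun_cvg _ _ _ _ (fun n (u : borel G) => lam (r u) (F n `&` (V : set (borel G))))).
    by move=> n; have [] := hF n.
  move=> u _; rewrite setI_bigcupl; apply: nondecreasing_cvg_mu.
  + by move=> n; exact: measurableI.
  + by apply: bigcupT_measurable => n; exact: measurableI.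
  + by move=> n m nm; apply/subsetPset; apply: setSI; apply/subsetPset; exact: ndF.
Qed.

Lemma haar_kernel :
  exists K : R.-sfker (borel G) ~> (borel G), forall u, K u = lam (r u).
Proof.
have [c [oc cK cT]] := relatively_compact_cover sc lc.
have mc n : measurable (c n : set (borel G)) by exact: measurable_open.
pose D n : set (borel G) := seqDU c n.
have mD n : measurable (D n) by apply: seqDU_measurable.
have Dc n : D n `<=` c n by exact: subset_seqDU.
pose k n u : {measure set (borel G) -> \bar R} := mrestr (lam (r u)) (mD n).
have mk n U : measurable U -> measurable_fun setT (fun u : borel G => k n u U).
  move=> mU; have [K cptK cnK] := cK n.
  rewrite (_ : (fun u => _) = fun u : borel G => lam (r u) ((U `&` D n) `&` c n)).
    by apply: haar_measurable_relatively_compact cnK _ => //; exact: measurableI.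
  apply/funext => u; rewrite /k/= /mrestr; congr (lam _ _).
  by apply/seteqP; split => [x [? h]|x [] //]; split => //; exact: Dc.
have kfin n u : k n u setT \is a fin_num.
  have [K cptK cnK] := cK n.
  rewrite ge0_fin_numE// /k/= /mrestr setTI.
  apply: (@le_lt_trans _ _ (lam (r u) K)); last by apply: haar_compact => //; exact: units_rng.
  apply: le_measure; rewrite ?inE//.
    by apply: measurable_closed; exact: compact_closed.
  by apply: subset_trans cnK; exact: Dc.
(* The mass of the piece [k n u] is finite for each [u], while an s-finite kernel asks for pieces
   bounded uniformly in [u]. Sorting [u] by the integer part [m] of this mass gives pieces bounded
   by m+1, exactly one of which is active at each [u]. *)
pose lev n (m : nat) (u : borel G) : bool := (m%:R%:E <= k n u setT < m.+1%:R%:E)%E.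
pose kk n m u : {measure set (borel G) -> \bar R} :=
  if lev n m u then k n u else mzero.
have mlev n m : measurable_fun setT (lev n m).
  apply: measurable_and; [apply: measurable_fun_lee|apply: measurable_fun_lte] => //.
    exact: mk.
  exact: mk.
have mkk n m U : measurable U -> measurable_fun setT (fun u : borel G => kk n m u U).
  move=> mU; rewrite (_ : (fun u => _) = fun u => if lev n m u then k n u U else 0%E).
    by apply: measurable_fun_ifT => //; exact: mk.
  by apply/funext => u; rewrite /kk; case: ifPn.
have ukk n m : measure_fam_uub (kk n m).
  exists m.+1%:R => u; rewrite /kk; case: ifPn => [/andP[]//|_].
  by rewrite /mzero/= lte_fin.
have skk n u U : measurable U -> k n u U = (\sum_(m <oo) kk n m u U)%E.
  move=> mU; pose m0 := Num.truncn (fine (k n u setT)).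
  have f0 : 0 <= fine (k n u setT) by rewrite fine_ge0.
  have levE m : lev n m u = (m == m0).
    by rewrite /lev -(fineK (kfin n u)) lee_fin lte_fin eq_sym truncn_eq.
  rewrite (@nneseriesD1 _ _ m0 xpredT)// eseries0 ?adde0.
    by rewrite /kk levE eqxx.
  by move=> i _ /= /negbTE im; rewrite /kk levE im.
have /choice[K KE] : forall n, exists K : R.-sfker (borel G) ~> (borel G), forall u, K u = k n u.
  by move=> n; apply: (sfinite_kernel_of_series (mkk n) (ukk n)) => x U; exact: skk.
apply: (@eq_sfinite_kernel _ _ _ _ _ _ (kseries K)) => u U mU.
have UE : U = \bigcup_n (U `&` D n).
  by rewrite -setI_bigcupr seqDU_bigcup_eq in cT *; rewrite cT setIT.
rewrite {1}UE measure_semi_bigcup.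
- by rewrite /kseries /mseries/=; apply: eq_eseriesr => n _; rewrite KE.
- by move=> n; exact: measurableI.
- by apply: trivIset_setIl; exact: trivIset_seqDU.
- by rewrite -UE.
Qed.

Lemma haar_invariant_borel g (B : set (borel G)) : H g -> measurable B ->
  lam (s g) [set h | B (tmul Q (g, h))] = lam (r g) B.
Proof.
move=> Hg mB.
have us := @units_src _ Q g; have ur := @units_rng _ Q g.
have mg : measurable_fun setT (fun h : borel G => tmul Q (g, h)).
  by apply: (measurableT_comp (measurable_tmul sc hG tQ)).
pose m1 := pushforward_measure (lam (s g)) mg.
have mRs := measurable_rfib (s g); have mRr := measurable_rfib (r g).
have open_eq (U : set G) : open U -> m1 U = lam (r g) U.
  move=> oU; have [f fU] := exists_open_approximation sc hG lc oU (R := R).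
  have mU := measurable_open oU.
  have mgR : measurable_fun (rfib Q H (s g) : set (borel G)) (fun h : borel G => tmul Q (g, h)).
    exact: measurable_funTS.
  have L1 := open_approximation_integral (m := lam (s g)) fU oU mRs mgR.
  have L2 := open_approximation_integral (m := lam (r g)) fU oU mRr
    (@measurable_id _ (borel G) (rfib Q H (r g))).
  have E1 : m1 U = lam (s g) (rfib Q H (s g) `&` (fun h : borel G => tmul Q (g, h)) @^-1` U).
    apply/esym; apply: haar_conull => //.
    by rewrite -[X in measurable X]setTI; exact: (mg measurableT _ mU).
  have E2 : lam (r g) U = lam (r g) (rfib Q H (r g) `&` id @^-1` U).
    by apply/esym; apply: haar_conull.
  rewrite E1 E2 -(cvg_lim (@ereal_hausdorff R) L1) -(cvg_lim (@ereal_hausdorff R) L2).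
  (* If gh lies in [K], then h = g^-1 (gh) lies in the image of a compact set under left
     multiplication by g^-1, which is continuous on the arrows with range r(g). *)
  have gK (K : set G) : compact K -> exists2 K', compact K' &
      rfib Q H (s g) `&` (fun h : borel G => tmul Q (g, h)) @^-1` K `<=` K'.
    move=> cK; pose A := [set inv g] `*` (K `&` [set k | r k = r g]).
    exists ((fun z => mul z.1 z.2) @` A).
      apply: continuous_compact.
        apply: continuous_subspaceW (proj2 tQ) => -[x y] [/= -> [_ /= e]].
        by rewrite /composable /= src_inv.
      apply: compact_setX; first exact: compact_set1.
      apply: compact_closedI => //.
      apply: (@closed_eq_hausdorff _ _ r (fun=> r g)) => //.
        exact: continuous_rng.
      by move=> x; exact: cvg_cst.
    move=> h [[Hh /= rh] Kh]; exists (inv g, mul g h); last by rewrite /= gmulKl.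
    by rewrite /= tmulE// in Kh; split => //=; split => //=; rewrite rng_mul.
  have F1 n := @haar_approximation_fin U f n (s g) (rfib Q H (s g)) _ fU us mRs mgR gK.
  have F2 n := @haar_approximation_fin U f n (r g) (rfib Q H (r g)) id fU ur mRr
    (@measurable_id _ (borel G) (rfib Q H (r g)))
    (fun K cK => ex_intro2 _ _ K cK (@subIsetr _ _ _)).
  congr (limn _); apply/funext => n; rewrite -(fineK (F1 n)) -(fineK (F2 n)); congr EFin.
  have := haar_invariant haarH (Cc_approximation n fU) Hg; rewrite /Rintegral => /= <-.
  congr fine; apply: eq_integral => h /[!inE] -[Hh /= rh].
  by rewrite tmulE.
have [c [oc cK cT]] := relatively_compact_cover sc lc.
(* Open sets form a generating pi-system, and the cover [c] consists of open sets of finite measure,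
   so agreement on open sets extends to all Borel sets. *)
have := @measure_unique _ R (borel G) (@open G) c erefl
  (fun U V oU oV => openI oU oV) oc cT m1 (lam (r g)) open_eq.
apply => // k; rewrite open_eq//; have [K cptK cnK] := cK k.
apply: (@le_lt_trans _ _ (lam (r g) K)); last exact: haar_compact.
apply: le_measure; rewrite ?inE//; first exact: measurable_open.
by apply: measurable_closed; exact: compact_closed.
Qed.

End haar_systems.

Section integral_lemmas.
Context (R : realType).
Local Open Scope ereal_scope.

(** For a bare set function, a null set is one whose measurable subsets all have value 0;
    nonnegativity and monotonicity reduce this to the value on the set itself. *)
Lemma measure_equiv_null d (T : measurableType d) (m1 m2 : set T -> \bar R) :
  (forall A, 0 <= m1 A) -> (forall A, 0 <= m2 A) ->
  (forall A B, measurable A -> measurable B -> A `<=` B -> m1 A <= m1 B) ->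
  (forall A B, measurable A -> measurable B -> A `<=` B -> m2 A <= m2 B) ->
  measure_equiv m1 m2 -> forall A, measurable A -> m1 A = 0 <-> m2 A = 0.
Proof.
move=> p1 p2 h1 h2 [m12 m21] A mA; split => A0.
  apply: (m21 A) => // B mB BA; apply/eqP; rewrite eq_le p1 andbT -A0; exact: h1.
apply: (m12 A) => // B mB BA; apply/eqP; rewrite eq_le p2 andbT -A0; exact: h2.
Qed.

Lemma integral_null_equiv d (T : measurableType d) (m1 m2 : {measure set T -> \bar R})
    (F : T -> \bar R) : (forall x, 0 <= F x) -> measurable_fun setT F ->
  (forall A, measurable A -> m1 A = 0 <-> m2 A = 0) ->
  \int[m1]_x F x = 0 <-> \int[m2]_x F x = 0.
Proof.
move=> F0 mF h; rewrite !ge0_integral_eq0P//.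
by split; apply: eq_ae_null => A mA /h; exact.
Qed.

Lemma measurable_integral_kernel_comp d d' d'' (T : measurableType d)
    (X : measurableType d') (Z : measurableType d'') (k : R.-sfker X ~> Z) (p : T -> X)
    (f : T -> Z -> \bar R) : (forall t z, 0 <= f t z) -> measurable_fun setT p ->
  measurable_fun setT (fun w : T * Z => f w.1 w.2) ->
  measurable_fun setT (fun t => \int[k (p t)]_z f t z).
Proof.
move=> f0 mp mf; have [k' k'E] := kernel_precomp k mp.
rewrite (_ : (fun t => _) = fun t => \int[k' t]_z f t z).
  exact: (@measurable_fun_integral_sfinite_kernel _ _ _ _ _ (fun w => f w.1 w.2)).
by apply/funext => t; rewrite k'E.
Qed.

Lemma ge0_integral_eq_conull d (T : measurableType d) (m : {measure set T -> \bar R})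
    (D : set T) (F F' : T -> \bar R) :
  measurable D -> m (~` D) = 0 -> (forall x, 0 <= F x) -> (forall x, 0 <= F' x) ->
  measurable_fun setT F -> measurable_fun setT F' -> (forall x, D x -> F x = F' x) ->
  \int[m]_x F x = \int[m]_x F' x.
Proof.
move=> mD D0 F0 F'0 mF mF' FF'.
rewrite -(integral_conull mD)// -[RHS](integral_conull mD)//.
by apply: eq_integral => x /[!inE]; exact: FF'.
Qed.

Lemma integral_indic_setT d (T : measurableType d) (m : {measure set T -> \bar R}) A :
  measurable A -> \int[m]_x (\1_A x)%:E = m A.
Proof. by move=> mA; rewrite integral_indic// setIT. Qed.

Lemma kernel_Fubini d d' d1 d2 (X : measurableType d) (Y : measurableType d')
    (U1 : measurableType d1) (U2 : measurableType d2)
    (k : R.-sfker U1 ~> X) (l : R.-sfker U2 ~> Y) u v (f : X * Y -> \bar R) :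
  (forall z, 0 <= f z) -> measurable_fun setT f ->
  \int[k u]_x \int[l v]_y f (x, y) = \int[l v]_y \int[k u]_x f (x, y).
Proof.
move=> f0 mf; have [M1 <-] := kernel_measure k u; have [M2 <-] := kernel_measure l v.
exact: sfinite_Fubini.
Qed.

End integral_lemmas.

(** * Integral calculus of a Haar system over a quasi-invariant measure *)

Section haar_data.
Context {R : realType} {G : ptopologicalType} (Q : groupoid G)
  (nu : {measure set (borel G) -> \bar R}).
Local Notation mul := (gmul Q).
Local Notation inv := (ginv Q).
Local Notation r := (rng Q).
Local Notation s := (src Q).
Local Notation bG := (borel G).

(* [K u] stands for lam^{r(u)}, defined for every arrow [u], and [M] for
   \int lam^u dnu(u), as an s-finite kernel and an s-finite measure. *)
Record haar_data (H : set bG) (lam : G -> {measure set bG -> \bar R})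
    (K : R.-sfker bG ~> bG) (M : {sfinite_measure set bG -> \bar R}) : Prop :=
  HaarData {
  hd_kernel : forall u, K u = lam (r u);
  hd_measure : forall A, measurable A -> haar_integral Q lam nu A = M A;
  hd_closed : measurable H;
  hd_fibre : forall u, K u (~` rfib Q H (r u)) = 0%E;
  hd_rfib : forall u, measurable (rfib Q H u : set bG);
  hd_pos : forall u, (0 < K u setT)%E;
  hd_integral : forall F, (forall x, 0 <= F x)%E -> measurable_fun setT F ->
    (\int[M]_x F x = \int[nu]_u \int[K u]_x F x)%E;
  hd_invariant : forall g B, H g -> measurable B ->
    K (s g) [set h | B (tmul Q (g, h))] = K g B;
  hd_quasi : forall A, measurable A -> M A = 0%E <-> M (inv @^-1` A) = 0%E
}.

Lemma radon_sfinite : @hausdorff_space G -> sigma_compact G -> radon nu ->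
  exists N : {sfinite_measure set bG -> \bar R}, (N : {measure set bG -> \bar R}) = nu.
Proof.
move=> hG [K [cK KT]] [cfin _ _].
have sf : sigma_finite setT nu.
  exists K; first by rewrite KT.
  move=> n; split; last exact: cfin.
  by apply: measurable_closed; exact: compact_closed.
pose H := isSFinite.Build _ _ _ nu (sfinite_measure_sigma_finite sf).
pose N : {sfinite_measure set bG -> \bar R} := HB.pack (Measure.sort nu) H.
by exists N; apply: eq_measure.
Qed.

Lemma exists_haar_data (H : set G) lam (lam0 : G -> {measure set bG -> \bar R}) :
  measured_groupoid Q lam0 nu -> closed H -> units Q `<=` H ->
  haar_system Q H lam -> quasi_invariant Q lam nu ->
  exists K M, haar_data H lam K M.
Proof.
move=> [hG sigmac sc lc tQ _ rnu nu_units _] clH uH haarH qi.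
have [K KE] := haar_kernel sc hG lc tQ clH uH haarH.
have [N NE] := radon_sfinite hG sigmac rnu.
have [M [ME MI]] := measure_comp N K.
have munits := measurable_units hG tQ.
have mi : measurable_fun setT (inv : bG -> bG) := measurable_inv tQ.
have MI' F : (forall x, 0 <= F x)%E -> measurable_fun setT F ->
    (\int[M]_x F x = \int[nu]_u \int[K u]_x F x)%E.
  by move=> F0 mF; rewrite MI// -NE.
have hM A : measurable A -> haar_integral Q lam nu A = M A.
  move=> mA; rewrite ME; transitivity (\int[nu]_u K u A)%E; last by rewrite -NE.
  rewrite /haar_integral.
  transitivity (\int[nu]_(u in units Q) K u A)%E.
    by apply: eq_integral => u /[!inE] uu; rewrite KE uu.
  rewrite integral_conull// ?NE//.
  exact: measurable_kernel.
exists K, M; split => //.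
- exact: measurable_closed.
- by move=> u; rewrite KE; apply: haar_fibre => //; exact: units_rng.
- by move=> u; exact: measurable_rfib.
- by move=> u; rewrite KE; apply: (haar_pos uH haarH); exact: units_rng.
- move=> g B Hg mB; rewrite !KE rng_src.
  exact: (haar_invariant_borel sc hG lc tQ clH uH haarH).
- have pE A : measurable A -> pushforward (haar_integral Q lam nu) (inv : bG -> bG) A =
      pushforward_measure M mi A.
    move=> mA; rewrite /pushforward hM//.
    by rewrite -[X in measurable X]setTI; exact: mi.
  have := measure_equiv_null _ _ _ _ qi.
  have h0 A : (0 <= haar_integral Q lam nu A)%E by apply: integral_ge0.
  move=> /(_ h0 (fun A => h0 _)) h A mA; rewrite -hM// -[M (inv @^-1` A)]hM; last first.
    by rewrite -[X in measurable X]setTI; exact: (mi measurableT _ mA).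
  apply: h => //.
  + by move=> B C mB mC BC; rewrite !hM//; apply: le_measure; rewrite ?inE.
  + by move=> B C mB mC BC; rewrite !pE//; apply: le_measure; rewrite ?inE.
Qed.

Section data.
Variables (H : set bG) (lam : G -> {measure set bG -> \bar R})
    (K : R.-sfker bG ~> bG) (M : {sfinite_measure set bG -> \bar R}).
Hypothesis hd : haar_data H lam K M.
Hypothesis mi : measurable_fun setT (inv : bG -> bG).
Hypothesis mr : measurable_fun setT (r : bG -> bG).
Hypothesis ms : measurable_fun setT (s : bG -> bG).
Hypothesis mt : measurable_fun setT (tmul Q).

Local Open Scope ereal_scope.

Lemma hd_kernel_rng u : K (r u) = K u.
Proof. by rewrite !(hd_kernel hd) rng_rng. Qed.

Lemma hd_integral_fibre u (F F' : bG -> \bar R) :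
  (forall x, 0 <= F x) -> (forall x, 0 <= F' x) ->
  measurable_fun setT F -> measurable_fun setT F' ->
  (forall x, H x -> r x = r u -> F x = F' x) ->
  \int[K u]_x F x = \int[K u]_x F' x.
Proof.
move=> F0 F'0 mF mF' FF'; apply: (ge0_integral_eq_conull (hd_rfib hd (r u))) => //.
  exact: (hd_fibre hd).
by move=> x [Hx rx]; exact: FF'.
Qed.

Lemma hd_null_compl : M (~` H) = 0.
Proof.
have mC : measurable (~` H) by apply: measurableC; exact: hd_closed hd.
rewrite -(integral_indic_setT M mC) (hd_integral hd)//; last first.
  by apply/measurable_EFinP.
apply: integral0_eq => u _; rewrite integral_indic_setT//.
apply: (@subset_measure0 _ _ _ (K u) _ _ mC _ _ (hd_fibre hd u)).
  by apply: measurableC; exact: hd_rfib hd _.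
by apply: subsetC => x [].
Qed.

Lemma hd_integral_H (F F' : bG -> \bar R) :
  (forall x, 0 <= F x) -> (forall x, 0 <= F' x) ->
  measurable_fun setT F -> measurable_fun setT F' ->
  (forall x, H x -> F x = F' x) ->
  \int[M]_x F x = \int[M]_x F' x.
Proof.
move=> *; apply: (ge0_integral_eq_conull (hd_closed hd)) => //; exact: hd_null_compl.
Qed.

Lemma hd_inv_null (F : bG -> \bar R) : (forall x, 0 <= F x) -> measurable_fun setT F ->
  \int[M]_x F x = 0 <-> \int[M]_x F (inv x) = 0.
Proof.
move=> F0 mF.
rewrite -[\int[M]_x F (inv x)]/(\int[M]_x (F \o inv) x).
rewrite -(ge0_integral_pushforward mi M measurableT)//.
by apply: integral_null_equiv => // A mA; exact: (hd_quasi hd).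
Qed.

Lemma hd_translation g (F : bG -> \bar R) : H g -> (forall x, 0 <= F x) ->
  measurable_fun setT F -> \int[K (s g)]_h F (tmul Q (g, h)) = \int[K g]_h F h.
Proof.
move=> Hg F0 mF.
have mg : measurable_fun setT (fun h : bG => tmul Q (g, h)).
  by apply: (measurableT_comp mt).
rewrite -[LHS]/(\int[K (s g)]_h (F \o (fun h : bG => tmul Q (g, h))) h).
rewrite -(ge0_integral_pushforward mg (K (s g)) measurableT)//.
by apply: integral_eq_setfun => A mA; rewrite -(hd_invariant hd Hg mA).
Qed.

(** Integrating over a fibre a function that does not depend on the fibre variable multiplies it by
    the mass of the fibre, which is positive though possibly infinite. *)
Lemma integral_mul_kernel_null d (T : measurableType d)
    (m : {measure set T -> \bar R}) (F : T -> \bar R) (p : T -> bG) :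
  (forall x, 0 <= F x) -> measurable_fun setT F -> measurable_fun setT p ->
  \int[m]_x (F x * K (p x) setT) = 0 <-> \int[m]_x F x = 0.
Proof.
move=> F0 mF mp.
have mK : measurable_fun setT (fun x => K (p x) setT).
  by apply: (measurableT_comp (measurable_kernel K _ measurableT)).
rewrite !ge0_integral_eq0P//; last 2 first.
- exact: emeasurable_funM.
- by move=> x; rewrite mule_ge0.
split; apply: filterS => x + _ => /(_ I).
  by move/eqP; rewrite mule_eq0 (gt_eqF (hd_pos hd _)) orbF => /eqP.
by move=> ->; rewrite mul0e.
Qed.

Lemma hd_rng_null (F : bG -> \bar R) : (forall x, 0 <= F x) -> measurable_fun setT F ->
  \int[M]_x F (r x) = 0 <-> \int[nu]_u F (r u) = 0.
Proof.
move=> F0 mF; have mFr : measurable_fun setT (fun u : bG => F (r u)) by exact: (measurableT_comp mF).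
rewrite (hd_integral hd)// -(@integral_mul_kernel_null _ _ nu (fun u => F (r u)) id)//.
suff -> : \int[nu]_u \int[K u]_x F (r x) = \int[nu]_u (F (r u) * K u setT) by [].
apply: eq_integral => u _; rewrite (@hd_integral_fibre u _ (fun=> F (r u)))//.
  by rewrite integral_cst.
by move=> x _ ->.
Qed.

(** Quasi-invariance lets one substitute the inverse arrow, which turns sources into ranges. *)
Lemma hd_src_null (F : bG -> \bar R) : (forall x, 0 <= F x) -> measurable_fun setT F ->
  \int[M]_x F (s x) = 0 <-> \int[nu]_u F (r u) = 0.
Proof.
move=> F0 mF; rewrite -hd_rng_null//.
have mFs : measurable_fun setT (fun x : bG => F (s x)) by exact: (measurableT_comp mF).
apply: (iff_trans (hd_inv_null (F := fun x => F (s x)) _ _)) => //.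
by under eq_integral do rewrite src_inv.
Qed.

End data.

(** Both sides integrate [f] over pairs of arrows with a common range u, then over u: [Kb x] depends
    only on r(x), which equals u for almost every x in the fibre, and Fubini's theorem applies over
    each u. *)
Lemma hd_exchange Ha lama Ka Ma Hb lamb Kb Mb (f : bG * bG -> \bar R) :
  haar_data Ha lama Ka Ma -> haar_data Hb lamb Kb Mb ->
  (forall z, 0 <= f z)%E -> measurable_fun setT f ->
  (\int[Ma]_x \int[Kb x]_y f (x, y) = \int[Mb]_y \int[Ka y]_x f (x, y))%E.
Proof.
move=> da db f0 mf.
have mf' : measurable_fun setT (fun z => f (z.2, z.1)).
  by apply: (measurableT_comp mf); apply: measurable_fun_pair.
have mfe : measurable_fun setT (fun z => f (z.1, z.2)).
  by apply: (measurableT_comp mf); apply: measurable_fun_pair.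
rewrite (hd_integral da); last 2 first.
- by move=> x; exact: integral_ge0.
- exact: (measurable_fun_integral_sfinite_kernel f).
rewrite (hd_integral db); last 2 first.
- by move=> x; exact: integral_ge0.
- exact: (measurable_fun_integral_sfinite_kernel (fun z => f (z.2, z.1))).
apply: eq_integral => u _.
transitivity (\int[Ka u]_x \int[Kb u]_y f (x, y))%E.
  apply: (hd_integral_fibre da).
  - by move=> x; exact: integral_ge0.
  - by move=> x; exact: integral_ge0.
  - exact: (measurable_fun_integral_sfinite_kernel f).
  - by apply: (@measurable_integral_kernel_comp _ _ _ _ _ _ _ Kb (fun=> u)
      (fun x y => f (x, y))).
  - by move=> x _ rx; rewrite -(hd_kernel_rng db x) rx (hd_kernel_rng db).
rewrite (kernel_Fubini _ _ _ _ f0 mf).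
apply: (hd_integral_fibre db).
- by move=> x; exact: integral_ge0.
- by move=> x; exact: integral_ge0.
- by apply: (@measurable_integral_kernel_comp _ _ _ _ _ _ _ Ka (fun=> u)
      (fun y x => f (x, y))).
- exact: (measurable_fun_integral_sfinite_kernel (fun z => f (z.2, z.1))).
- by move=> x _ rx; rewrite -(hd_kernel_rng da x) rx (hd_kernel_rng da).
Qed.

End haar_data.

(** * Null sets of a matched pair *)

Section matched_null_sets.
Context {R : realType} {G : ptopologicalType} (Q : groupoid G)
  (nu : {measure set (borel G) -> \bar R}).
Local Notation mul := (gmul Q).
Local Notation inv := (ginv Q).
Local Notation r := (rng Q).
Local Notation s := (src Q).
Local Notation bG := (borel G).
Variables (H1 H2 : set G) (lam lam1 lam2 : G -> {measure set bG -> \bar R})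
  (K K1 K2 : R.-sfker bG ~> bG) (M M1 M2 : {sfinite_measure set bG -> \bar R}).
Hypotheses (sub1 : subgroupoid Q H1) (sub2 : subgroupoid Q H2)
  (cap : H1 `&` H2 = units Q).
Hypotheses (d0 : haar_data Q nu setT lam K M) (d1 : haar_data Q nu H1 lam1 K1 M1)
  (d2 : haar_data Q nu H2 lam2 K2 M2).
Hypotheses (mi : measurable_fun setT (inv : bG -> bG))
  (mr : measurable_fun setT (r : bG -> bG)) (ms : measurable_fun setT (s : bG -> bG))
  (mt : measurable_fun setT (tmul Q))
  (mp1 : measurable_fun setT (p1 Q H1 H2 : bG -> bG))
  (mp2 : measurable_fun setT (p2 Q H1 H2 : bG -> bG)).
Local Open Scope ereal_scope.
Hypothesis ident : forall F : bG -> \bar R, (forall x, 0 <= F x) ->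
  measurable_fun setT F ->
  \int[M]_x F x = 0 <-> \int[M2]_x \int[K1 (s x)]_y F (tmul Q (x, y)) = 0.

Section measurability.
Context d (T : measurableType d).
Implicit Types g h : T -> bG.

Lemma mcomp (F : bG -> \bar R) g : measurable_fun setT F ->
  measurable_fun setT g -> measurable_fun setT (fun t => F (g t)).
Proof. by move=> mF mg; exact: (measurableT_comp mF). Qed.

Lemma mcomp2 (F : bG * bG -> \bar R) g h : measurable_fun setT F ->
  measurable_fun setT g -> measurable_fun setT h ->
  measurable_fun setT (fun t => F (g t, h t)).
Proof.
by move=> mF mg mh; apply: (measurableT_comp mF); exact: measurable_fun_pair.
Qed.

Lemma mtmul g h : measurable_fun setT g -> measurable_fun setT h ->
  measurable_fun setT (fun t => tmul Q (g t, h t) : bG).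
Proof. by move=> mg mh; apply: (measurableT_comp mt); exact: measurable_fun_pair. Qed.

Lemma minv g : measurable_fun setT g -> measurable_fun setT (fun t => inv (g t) : bG).
Proof. by move=> mg; exact: (measurableT_comp mi). Qed.
Lemma msrc g : measurable_fun setT g -> measurable_fun setT (fun t => s (g t) : bG).
Proof. by move=> mg; exact: (measurableT_comp ms). Qed.
Lemma mp1c g : measurable_fun setT g -> measurable_fun setT (fun t => p1 Q H1 H2 (g t) : bG).
Proof. by move=> mg; exact: (measurableT_comp mp1). Qed.
Lemma mp2c g : measurable_fun setT g -> measurable_fun setT (fun t => p2 Q H1 H2 (g t) : bG).
Proof. by move=> mg; exact: (measurableT_comp mp2). Qed.

End measurability.

Lemma mfstc d1' d2' d3 (T : measurableType d1') (X : measurableType d2')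
    (Y : measurableType d3) (g : T -> X * Y) :
  measurable_fun setT g -> measurable_fun setT (fun t => (g t).1).
Proof. by move=> mg; exact: (measurableT_comp measurable_fst). Qed.
Lemma msndc d1' d2' d3 (T : measurableType d1') (X : measurableType d2')
    (Y : measurableType d3) (g : T -> X * Y) :
  measurable_fun setT g -> measurable_fun setT (fun t => (g t).2).
Proof. by move=> mg; exact: (measurableT_comp measurable_snd). Qed.

Ltac nonneg := intros; repeat (apply: integral_ge0 => ? _); by auto.
Ltac meas := repeat first
  [ exact: measurable_id | exact: measurable_fst | exact: measurable_snd
  | exact: measurable_cst
  | match goal with mF : measurable_fun setT ?F |- measurable_fun setT (fun t => ?F (_, _)) =>
      apply: (mcomp2 mF) end
  | match goal with mF : measurable_fun setT ?F |- measurable_fun setT (fun t => ?F _) =>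
      apply: (mcomp mF) end
  | apply: mtmul | apply: minv | apply: msrc | apply: mp1c | apply: mp2c
  | apply: measurable_integral_kernel_comp; [nonneg| |]
  | apply: mfstc | apply: msndc ].

Lemma p2_inv x y : H2 x -> H1 y -> r y = s x ->
  p2 Q H1 H2 (inv (tmul Q (x, y))) = inv x.
Proof.
move=> hx hy e; rewrite tmulE// inv_mul// p2_mul ?src_inv ?rng_inv//.
  by apply: (proj1 sub1).
by apply: (proj1 sub2).
Qed.

Lemma p1_inv x y : H2 x -> H1 y -> r y = s x ->
  p1 Q H1 H2 (inv (tmul Q (x, y))) = inv y.
Proof.
move=> hx hy e; rewrite tmulE// inv_mul// p1_mul ?src_inv ?rng_inv//.
  by apply: (proj1 sub1).
by apply: (proj1 sub2).
Qed.

Lemma ident_inv (F : bG -> \bar R) : (forall x, 0 <= F x) -> measurable_fun setT F ->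
  \int[M]_x F x = 0 <-> \int[M2]_x \int[K1 (s x)]_y F (inv (tmul Q (x, y))) = 0.
Proof.
move=> F0 mF; rewrite (hd_inv_null d0 mi F0 mF).
by apply: (ident (F := fun x => F (inv x))) => //; meas.
Qed.

Lemma p2_null (F : bG -> \bar R) : (forall x, 0 <= F x) -> measurable_fun setT F ->
  \int[M]_g F (p2 Q H1 H2 g) = 0 <-> \int[M2]_x F x = 0.
Proof.
move=> F0 mF.
rewrite (ident_inv (F := fun g => F (p2 Q H1 H2 g)))//; last by meas.
rewrite (hd_inv_null d2 mi F0 mF).
rewrite -(@integral_mul_kernel_null _ _ _ _ _ _ _ _ d1 _ _ M2 (fun x => F (inv x)) s)//; last by meas.
suff -> : \int[M2]_x \int[K1 (s x)]_y F (p2 Q H1 H2 (inv (tmul Q (x, y)))) =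
    \int[M2]_x (F (inv x) * K1 (s x) setT) by [].
apply: (hd_integral_H d2).
- nonneg.
- by move=> x; rewrite mule_ge0.
- by meas.
- apply: emeasurable_funM; first by meas.
  by apply: (measurableT_comp (measurable_kernel K1 _ measurableT)).
- move=> x hx; rewrite (hd_integral_fibre d1 (F' := fun=> F (inv x)))//.
  + by rewrite integral_cst.
  + by meas.
  + by move=> y hy; rewrite rng_src => e; rewrite p2_inv.
Qed.

Lemma p1_null (F : bG -> \bar R) : (forall x, 0 <= F x) -> measurable_fun setT F ->
  \int[M]_g F (p1 Q H1 H2 g) = 0 <-> \int[M1]_x F x = 0.
Proof.
move=> F0 mF.
rewrite (ident_inv (F := fun g => F (p1 Q H1 H2 g)))//; last by meas.
rewrite (hd_inv_null d1 mi F0 mF).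
(* Since p_1 of the inverse of xy is y^-1, the inner integral depends on x only through s(x). Its
   vanishing for almost every x in G_2 is a statement about [nu], and so is the vanishing of the
   integral over G_1. *)
pose Phi u := \int[K1 u]_y F (inv y).
have mPhi : measurable_fun setT Phi by rewrite /Phi; meas.
have Phi0 u : 0 <= Phi u by rewrite /Phi; nonneg.
rewrite (hd_integral d1)//; last by meas.
have := hd_src_null d2 mi mr ms Phi0 mPhi.
have -> : \int[nu]_u Phi (r u) = \int[nu]_u \int[K1 u]_x F (inv x).
  by apply: eq_integral => u _; rewrite /Phi (hd_kernel_rng d1).
move=> <-.
suff -> : \int[M2]_x \int[K1 (s x)]_y F (p1 Q H1 H2 (inv (tmul Q (x, y)))) =
    \int[M2]_x Phi (s x) by [].
apply: (hd_integral_H d2); [nonneg|by []|by meas|by meas|].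
move=> x hx; apply: (hd_integral_fibre d1) => //; [by meas|by meas|].
by move=> y hy; rewrite rng_src => e; rewrite p1_inv.
Qed.

(** Null sets pull back along (x, y, z) -> (p_2(xy), z). As p_2(xy) has the source of y, the
    integral over z is a function [Psi] of p_2(xy), to which [p2_null] and the identification
    apply. *)
Lemma right_aid_null (f : bG * bG -> \bar R) : (forall z, 0 <= f z) -> measurable_fun setT f ->
  \int[M2]_x \int[K1 (s x)]_y f (x, y) = 0 ->
  \int[M2]_x \int[K1 (s x)]_y \int[K1 (s y)]_z f (p2 Q H1 H2 (tmul Q (x, y)), z) = 0.
Proof.
move=> f0 mf; pose Psi (x : bG) := \int[K1 (s x)]_z f (x, z).
have Psi0 x : 0 <= Psi x by rewrite /Psi; nonneg.
have mPsi : measurable_fun setT Psi by rewrite /Psi; meas.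
move=> /(p2_null Psi0 mPsi).
move=> /(ident (F := fun g => Psi (p2 Q H1 H2 g))) => /(_ (fun _ => Psi0 _)) h.
rewrite -[RHS]h; last by meas.
apply: eq_integral => x _; apply: (hd_integral_fibre d1); [nonneg|by []|by meas|by meas|].
move=> y hy; rewrite rng_src => e.
by rewrite /Psi src_p2// tmulE// src_mul.
Qed.

(** Null sets pull back along (x, y, z) -> (x, yz). Left translation by y in G_1 removes y from the
    inner integral, after which y is an idle variable. *)
Lemma right_idD_null (f : bG * bG -> \bar R) : (forall z, 0 <= f z) -> measurable_fun setT f ->
  \int[M2]_x \int[K1 (s x)]_y f (x, y) = 0 ->
  \int[M2]_x \int[K1 (s x)]_y \int[K1 (s y)]_z f (x, tmul Q (y, z)) = 0.
Proof.
move=> f0 mf; pose Psi (x : bG) := \int[K1 (s x)]_z f (x, z).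
have Psi0 x : 0 <= Psi x by rewrite /Psi; nonneg.
have mPsi : measurable_fun setT Psi by rewrite /Psi; meas.
move=> /(integral_mul_kernel_null d1 M2 Psi0 mPsi ms) <-.
apply: eq_integral => x _; rewrite -integral_cst//.
apply: (hd_integral_fibre d1); [nonneg|by move=> y; exact: Psi0|by meas|by meas|].
move=> y hy; rewrite rng_src => e.
rewrite (hd_translation d1 mt (F := fun z => f (x, z)))//; last by meas.
by rewrite -(hd_kernel_rng d1) e.
Qed.

(** Null sets pull back along (b, x, a) -> (bx, a). Left translation by b replaces bx by a variable
    y with the range of b; exchanging the two integrals over G_2 leaves b idle. *)
Lemma left_idD_null (f : bG * bG -> \bar R) : (forall z, 0 <= f z) -> measurable_fun setT f ->
  \int[M2]_b \int[K1 (s b)]_a f (b, a) = 0 ->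
  \int[M2]_b \int[K2 (s b)]_x \int[K1 (s x)]_a f (tmul Q (b, x), a) = 0.
Proof.
move=> f0 mf; pose Psi (x : bG) := \int[K1 (s x)]_z f (x, z).
have Psi0 x : 0 <= Psi x by rewrite /Psi; nonneg.
have mPsi : measurable_fun setT Psi by rewrite /Psi; meas.
move=> /(integral_mul_kernel_null d2 M2 Psi0 mPsi (@measurable_id _ _ _)) <-.
transitivity (\int[M2]_b \int[K2 b]_y Psi y).
  apply: (hd_integral_H d2); [nonneg|nonneg|by meas|by meas|].
  move=> b hb; rewrite -(hd_translation d2 mt hb Psi0 mPsi).
  apply: (hd_integral_fibre d2); [nonneg|by []|by meas|by meas|].
  move=> x hx; rewrite rng_src => e.
  by rewrite /Psi tmulE// src_mul.
rewrite (hd_exchange (f := fun z => Psi z.2) d2 d2)//; last by meas.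
by apply: eq_integral => y _; rewrite -integral_cst.
Qed.

(** Null sets pull back along the projection that forgets b. The inner integrals depend on b only
    through s(b), so [hd_src_null] reduces the claim to one over [nu]. *)
Lemma left_proj_null (f : bG * bG -> \bar R) : (forall z, 0 <= f z) -> measurable_fun setT f ->
  \int[M2]_x \int[K1 (s x)]_a f (x, a) = 0 ->
  \int[M2]_b \int[K2 (s b)]_x \int[K1 (s x)]_a f (x, a) = 0.
Proof.
move=> f0 mf h; pose Phi (u : bG) := \int[K2 u]_x \int[K1 (s x)]_a f (x, a).
have Phi0 u : 0 <= Phi u by rewrite /Phi; nonneg.
have mPhi : measurable_fun setT Phi by rewrite /Phi; meas.
apply/(hd_src_null d2 mi mr ms Phi0 mPhi).
rewrite -[RHS]h (hd_integral d2); [|nonneg|by meas].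
by apply: eq_integral => u _; rewrite /Phi (hd_kernel_rng d2).
Qed.

(* For fixed b in H_2, left invariance under b turns x into b^{-1} y, and by
   the identification of y a with g in G a null set of triples (b, x, a) becomes
   a null set of pairs (b, b^{-1} g).  A second translation reduces the claim to
   [star], which is [p1_null] after exchanging integrals. *)
Lemma left_aid_null (f : bG * bG -> \bar R) : (forall z, 0 <= f z) -> measurable_fun setT f ->
  \int[M2]_b \int[K1 (s b)]_a f (b, a) = 0 ->
  \int[M2]_b \int[K2 (s b)]_x \int[K1 (s x)]_a f (b, p1 Q H1 H2 (tmul Q (x, a))) = 0.
Proof.
move=> f0 mf hf.
have star : \int[M2]_b \int[K (s b)]_g f (b, p1 Q H1 H2 g) = 0.
  (* Inverting b turns the condition r(g) = s(b) into r(g) = r(b), the form in which integrals can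
     be exchanged; [Phi] then sees g only through p_1(g), which has the same range. *)
  pose Phi a := \int[K2 a]_b f (inv b, a).
  have Phi0 a : 0 <= Phi a by rewrite /Phi; nonneg.
  have mPhi : measurable_fun setT Phi by rewrite /Phi; meas.
  apply/(hd_inv_null d2 mi (F := fun b => \int[K (s b)]_g f (b, p1 Q H1 H2 g))).
  - nonneg.
  - by meas.
  transitivity (\int[M]_g Phi (p1 Q H1 H2 g)).
    transitivity (\int[M2]_b \int[K b]_g f (inv b, p1 Q H1 H2 g)).
      by apply: eq_integral => b _; rewrite src_inv (hd_kernel_rng d0).
    rewrite -(hd_exchange (f := fun z => f (inv z.2, p1 Q H1 H2 z.1)) d0 d2)//; last by meas.
    apply: eq_integral => g _; rewrite /Phi -(hd_kernel_rng d2 (p1 _ _ _ _)).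
    by rewrite rng_p1// (hd_kernel_rng d2).
  apply/(p1_null Phi0 mPhi); rewrite /Phi.
  rewrite (hd_exchange (f := fun z => f (inv z.2, z.1)) d1 d2)//; last by meas.
  move: hf => /(hd_inv_null d2 mi (F := fun b => \int[K1 (s b)]_a f (b, a))) hf.
  rewrite -[RHS]hf; [|nonneg|by meas].
  by apply: eq_integral => b _; rewrite src_inv (hd_kernel_rng d1).
(* With b integrated first, this is a function on G alone. Exchange and translation by b^-1 in G
   identify its integral with [star], and [ident] rewrites its vanishing in terms of products g =
   ya. *)
pose E g := \int[K2 g]_b f (b, p1 Q H1 H2 (tmul Q (inv b, g))).
have E0 g : 0 <= E g by rewrite /E; nonneg.
have mE : measurable_fun setT E by rewrite /E; meas.
have : \int[M]_g E g = 0.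
  rewrite /E (hd_exchange (f := fun z => f (z.2, p1 Q H1 H2 (tmul Q (inv z.2, z.1)))) d0 d2)//; last by meas.
  rewrite -[RHS]star; apply: eq_integral => b _.
  have := hd_translation d0 mt (g := inv b) (F := fun g => f (b, p1 Q H1 H2 g)) I.
  rewrite src_inv (hd_kernel_rng d0) => ->//; last by meas.
  by rewrite -(hd_kernel_rng d0) rng_inv.
move=> /(ident E0 mE) hE.
rewrite -[RHS]hE.
transitivity (\int[M2]_b \int[K2 b]_y \int[K1 (s y)]_a
    f (b, p1 Q H1 H2 (tmul Q (inv b, tmul Q (y, a))))).
  apply: (hd_integral_H d2); [nonneg|nonneg|by meas|by meas|].
  move=> b hb.
  rewrite -(hd_translation d2 mt hb (F := fun y => \int[K1 (s y)]_a
    f (b, p1 Q H1 H2 (tmul Q (inv b, tmul Q (y, a)))))); [|nonneg|by meas].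
  apply: (hd_integral_fibre d2); [nonneg|nonneg|by meas|by meas|].
  move=> x hx; rewrite rng_src => e; rewrite [in RHS]tmulE// src_mul//.
  apply: (hd_integral_fibre d1); [nonneg|nonneg|by meas|by meas|].
  move=> a ha; rewrite rng_src => e'.
  have sx : s (mul b x) = r a by rewrite src_mul.
  rewrite (tmulE sx) tmulE// tmulE; last first.
    by rewrite src_inv rng_mul// rng_mul.
  by rewrite gmul_assoc// gmulKl// rng_mul.
rewrite (hd_exchange (f := fun z => \int[K1 (s z.2)]_a
    f (z.1, p1 Q H1 H2 (tmul Q (inv z.1, tmul Q (z.2, a))))) d2 d2); [|nonneg|by meas].
apply: eq_integral => y _ /=.
rewrite (kernel_Fubini _ _ _ _
  (f := fun z : bG * bG => f (z.1, p1 Q H1 H2 (tmul Q (inv z.1, tmul Q (y, z.2))))))//; last by meas.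
apply: (hd_integral_fibre d1); [nonneg|by []|by meas|by meas|].
move=> a ha; rewrite rng_src => e; rewrite /E /=.
by rewrite -(hd_kernel_rng d2 (tmul _ _)) tmulE// rng_mul// (hd_kernel_rng d2).
Qed.

End matched_null_sets.

(** * The two actions *)

Section matched_pairs.
Context {R : realType} {G : ptopologicalType} (Q : groupoid G)
  (lam : G -> {measure set (borel G) -> \bar R})
  (nu : {measure set (borel G) -> \bar R})
  (H1 H2 : set (borel G)) (lam1 lam2 : G -> {measure set (borel G) -> \bar R})
  (hG : measured_groupoid Q lam nu) (hm : matched_pair Q lam nu H1 lam1 H2 lam2)
  (hident : product_identification Q nu H1 H2 lam1 lam2 lam).
Local Notation mul := (gmul Q).
Local Notation inv := (ginv Q).
Local Notation r := (rng Q).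
Local Notation s := (src Q).
Local Notation bG := (borel G).
Local Notation C := R[i].
Variables (K K1 K2 : R.-sfker bG ~> bG) (M M1 M2 : {sfinite_measure set bG -> \bar R}).
Hypotheses (d0 : haar_data Q nu setT lam K M) (d1 : haar_data Q nu H1 lam1 K1 M1)
  (d2 : haar_data Q nu H2 lam2 K2 M2).

Let hausG := mg_hausdorff hG.
Let sc := mg_second_countable hG.
Let sigmac := mg_sigma_compact hG.
Let tQ := mg_topological hG.
Let sub1 := mp_sub1 hm.
Let sub2 := mp_sub2 hm.
Let cap := mp_cap hm.
Let mi : measurable_fun setT (inv : bG -> bG) := measurable_inv tQ.
Let mr : measurable_fun setT (r : bG -> bG) := measurable_rng tQ.
Let ms : measurable_fun setT (s : bG -> bG) := measurable_src tQ.
Let mt : measurable_fun setT (tmul Q) := measurable_tmul sc hausG tQ.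
Let mp1' : measurable_fun setT (p1 Q H1 H2 : bG -> bG) :=
  measurable_p1 hausG sigmac tQ sub1 sub2 cap (mp_closed1 hm) (mp_closed2 hm).
Let mp2' : measurable_fun setT (p2 Q H1 H2 : bG -> bG) :=
  measurable_p2 hausG sigmac tQ sub1 sub2 cap (mp_closed1 hm) (mp_closed2 hm).
Let mprod : measurable (prodset Q H1 H2 : set bG) :=
  measurable_prodset hausG sigmac tQ (mp_closed1 hm) (mp_closed2 hm).
Let munits : measurable (units Q : set bG) := measurable_units hausG tQ.
Let mH1 : measurable H1 := hd_closed d1.
Let mH2 : measurable H2 := hd_closed d2.

Lemma measurable_fibprod_dom d d' (T : measurableType d) (T' : measurableType d')
    (X : mspace R T) (p : T -> bG) (D : set T') (q : T' -> bG) k :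
  measurable (mdom X) -> measurable D -> measurable_fun setT p ->
  measurable_fun setT q -> measurable (mdom (fibprod X p D q k)).
Proof.
move=> mX mD mp mq.
have mdiag : measurable ([set z | z.1 = z.2] : set (bG * bG)).
  apply: (measurable_closed_prod sc).
  by apply: (@closed_eq_hausdorff _ _ (fun z : G * G => z.1) (fun z => z.2)) => // z;
    [exact: cvg_fst|exact: cvg_snd].
have mpq : measurable_fun setT (fun z : T * T' => (p z.1, q z.2)).
  by apply: measurable_fun_pair; apply: measurableT_comp.
have -> : mdom (fibprod X p D q k) = (fst @^-1` mdom X `&` snd @^-1` D) `&`
    (fun z : T * T' => (p z.1, q z.2)) @^-1` [set z | z.1 = z.2].
  by apply/seteqP; split => z /= => [[]//|[[]]].
apply: measurableI; first apply: measurableI.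
- by rewrite -[X in measurable X]setTI; exact: measurable_fst.
- by rewrite -[X in measurable X]setTI; exact: measurable_snd.
- by rewrite -[X in measurable X]setTI; exact: mpq.
Qed.

Lemma base_sfinite : sfinite_mspace (base Q nu).
Proof.
split => //; last exact: mg_units hG.
have [N NE] := radon_sfinite hausG sigmac (mg_radon hG).
by exists N => A _ /=; rewrite -NE.
Qed.

Lemma galg_sfinite (H : set bG) l k (m : {sfinite_measure set bG -> \bar R}) :
  haar_data Q nu H l k m -> sfinite_mspace (galg Q nu H l).
Proof.
move=> d; split => /=; first exact: hd_closed d.
  by exists m => A mA; exact: hd_measure d _ mA.
have mC := measurableC (hd_closed d).
by apply: (etrans (hd_measure d mC)); exact: hd_null_compl d.
Qed.

Local Notation F21 := (fib21 Q nu H1 H2 lam1 lam2).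
Local Notation F12 := (fib12 Q nu H1 H2 lam1 lam2).
Local Notation XMMr := (right_fib Q H1 lam1 F21 (fun z => s z.2)).
Local Notation XMMl := (left_fib Q nu H2 lam2 (mdom F12) (fun z => r z.2)
  (left_ker Q H2 lam2 H1 r (fun u => lam1 u))).

Lemma K1_src x : K1 (s x) = lam1 (s x).
Proof. by rewrite (hd_kernel d1) rng_src. Qed.

Lemma K2_src x : K2 (s x) = lam2 (s x).
Proof. by rewrite (hd_kernel d2) rng_src. Qed.

Lemma K1_fibre x : K1 (s x) (~` [set y | H1 y /\ s x = r y]) = 0%E.
Proof.
rewrite -[RHS](hd_fibre d1 (s x)); congr (K1 _ (~` _)).
by apply/seteqP; split => y [h1 h2]; split => //=; rewrite ?rng_src// -?h2// rng_src in h2 *.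
Qed.

Lemma measurable_snd_src d (T : measurableType d) :
  measurable_fun setT (fun z : T * bG => s z.2 : bG).
Proof. exact: (measurableT_comp ms). Qed.

Lemma measurable_snd_rng d (T : measurableType d) :
  measurable_fun setT (fun z : T * bG => r z.2 : bG).
Proof. exact: (measurableT_comp mr). Qed.

Section right_fibre.
Context d (T : measurableType d) (X : mspace R T) (p : T -> bG).
Hypotheses (hX : sfinite_mspace X) (mp : measurable_fun setT p)
  (pu : forall x, mdom X x -> units Q (p x)).

Lemma right_fib_sfinite : sfinite_mspace (right_fib Q H1 lam1 X p).
Proof.
have [Kp KpE] := kernel_precomp K1 mp.
apply: (@fibprod_sfinite _ _ _ _ _ _ X p H1 r _ Kp) => //.
- by move=> x Dx A mA; rewrite KpE (hd_kernel d1) (pu Dx).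
- by apply: measurable_fibprod_dom => //; exact: sfinite_mdom hX.
- move=> x Dx; rewrite KpE -[RHS](hd_fibre d1 (p x)) (pu Dx); congr (K1 _ (~` _)).
  by apply/seteqP; split => y [].
Qed.

Lemma right_fibE (m : {sfinite_measure set T -> \bar R}) A :
  (forall A, measurable A -> mmeas X A = m A) -> measurable A ->
  mmeas (right_fib Q H1 lam1 X p) A =
    (\int[m]_x \int[K1 (p x)]_y (\1_A (x, y))%:E)%E.
Proof.
move=> hM mA; have [Kp KpE] := kernel_precomp K1 mp.
rewrite (@fibprodE _ _ _ _ _ _ X p H1 r _ Kp _ m)//; last first.
  by move=> x Dx B mB; rewrite KpE (hd_kernel d1) (pu Dx).
have mD := sfinite_mdom hX.
rewrite integral_conull//; last 2 first.
- by rewrite -[RHS](sfinite_null hX); apply/esym/hM; exact: measurableC.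
- exact: measurable_kernel_xsection.
apply: eq_integral => x _; rewrite KpE -integral_indic_setT; last exact: measurable_xsection.
by apply: eq_integral => y _; rewrite !indicE mem_xsection.
Qed.

Lemma right_fst_null N : measurable N -> mmeas X N = 0%E ->
  mmeas (right_fib Q H1 lam1 X p) (fst @^-1` N) = 0%E.
Proof.
move=> mN N0; have [m hM] := sfinite_mmeas hX.
have mF : measurable ((fst : T * bG -> T) @^-1` N).
  by rewrite -[X in measurable X]setTI; exact: measurable_fst.
rewrite (right_fibE hM mF).
rewrite (_ : (fun x => _) = fun x => ((\1_N x)%:E * K1 (p x) setT)%E); last first.
  by apply/funext => x; rewrite -integral_cst//; apply: eq_integral => y _.
apply/(integral_mul_kernel_null d1) => //; first by apply/measurable_EFinP.
by rewrite integral_indic_setT//; apply: etrans N0; apply/esym/hM.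
Qed.

End right_fibre.

Lemma fib21_sfinite : sfinite_mspace F21.
Proof.
apply: right_fib_sfinite => //; first exact: (galg_sfinite d2).
by move=> x _; exact: units_src.
Qed.

Lemma fib21_ge0 A : (0 <= mmeas F21 A)%E.
Proof.
rewrite [X in (_ <= X)%E](_ : _ = \int[M2]_(x in H2) lam1 (s x) (xsection A x))%E.
  by apply: integral_ge0 => x _; exact: measure_ge0.
exact: (integral_eq_setfun (hd_measure d2)).
Qed.

Lemma fib21E A : measurable A ->
  mmeas F21 A = (\int[M2]_x \int[K1 (s x)]_y (\1_A (x, y))%:E)%E.
Proof.
move=> mA; apply: right_fibE => //; first exact: (galg_sfinite d2).
  by move=> x _; exact: units_src.
exact: hd_measure d2.
Qed.

Lemma right_fib21_sfinite : sfinite_mspace XMMr.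
Proof.
apply: right_fib_sfinite => //; first exact: fib21_sfinite.
  exact: measurable_snd_src.
by move=> x _; exact: units_src.
Qed.

Lemma measurable_indicE d (T : measurableType d) (A : set T) : measurable A ->
  measurable_fun setT (fun x => (\1_A x)%:E : \bar R).
Proof. by move=> mA; apply/measurable_EFinP. Qed.

Lemma fib21_integral : exists M21 : {sfinite_measure set (bG * bG)%type -> \bar R},
  (forall A, measurable A -> mmeas F21 A = M21 A) /\
  (forall f, (forall z, 0 <= f z)%E -> measurable_fun setT f ->
      \int[M21]_z f z = \int[M2]_x \int[K1 (s x)]_y f (x, y))%E.
Proof.
have [Ks KsE] := kernel_precomp K1 ms.
have [M21 [ME MI]] := measure_prod_kernel M2 Ks.
exists M21; split => [A mA|f f0 mf]; last first.
  by rewrite MI//; apply: eq_integral => x _; rewrite KsE.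
rewrite fib21E// ME; apply: eq_integral => x _.
rewrite KsE -integral_indic_setT; last exact: measurable_xsection.
by apply: eq_integral => y _; rewrite !indicE mem_xsection.
Qed.

Lemma right_fib21E A : measurable A -> mmeas XMMr A =
  (\int[M2]_x \int[K1 (s x)]_y \int[K1 (s y)]_z (\1_A ((x, y), z))%:E)%E.
Proof.
move=> mA; have [M21 [ME MI]] := fib21_integral.
rewrite (right_fibE fib21_sfinite _ _ ME mA)//; last 2 first.
- exact: measurable_snd_src.
- by move=> x _; exact: units_src.
rewrite MI//; first by move=> z; apply: integral_ge0 => y _; rewrite lee_fin.
apply: (@measurable_integral_kernel_comp _ _ _ _ _ _ _ K1 (fun z : bG * bG => s z.2)
  (fun z y => (\1_A (z, y))%:E)).
- by move=> z y; rewrite lee_fin.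
- exact: measurable_snd_src.
- rewrite (_ : (fun w => _) = fun w => (\1_A w)%:E); first exact: measurable_indicE.
  by apply/funext => -[].
Qed.

(** The identification hypothesis in the form used for null set transfers: from sets to nonnegative
    functions, and from [gmul] on the domain to its Borel extension [tmul]. *)
Lemma product_null (F : bG -> \bar R) : (forall x, 0 <= F x)%E -> measurable_fun setT F ->
  (\int[M]_x F x = 0 <-> \int[M2]_x \int[K1 (s x)]_y F (tmul Q (x, y)) = 0)%E.
Proof.
move=> F0 mF; have [M21 [ME MI]] := fib21_integral.
have mFt : measurable_fun setT (F \o tmul Q) by exact: measurableT_comp.
have -> : (\int[M2]_x \int[K1 (s x)]_y F (tmul Q (x, y)) =
    \int[pushforward M21 (tmul Q)]_x F x)%E.
  by rewrite (ge0_integral_pushforward mt M21 measurableT)// preimage_setT MI//= => z; exact: F0.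
have mtB B : measurable B -> measurable (tmul Q @^-1` B).
  by move=> mB; rewrite -[X in measurable X]setTI; exact: mt.
have mD := sfinite_mdom fib21_sfinite.
have E B : mdom F21 `&` mult21 Q @^-1` B = mdom F21 `&` tmul Q @^-1` B.
  by apply/seteqP; split => -[x y] [[h1 h2 h3] hB]; split => //; move: hB; rewrite /= tmulE.
apply: integral_null_equiv => // B mB.
suff : haar_integral Q lam nu B = 0%E <-> mmeas F21 (tmul Q @^-1` B) = 0%E.
  by rewrite (hd_measure d0 mB) ME; last exact: mtB.
have SE : mmeas F21 (mdom F21 `&` mult21 Q @^-1` B) = 0%E <-> mmeas F21 (tmul Q @^-1` B) = 0%E.
  rewrite E; apply: sfinite_conull; [exact: fib21_sfinite|exact: mtB].
apply: iff_trans SE.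
have PM A : measurable A -> mmeas F21 (mdom F21 `&` mult21 Q @^-1` A) =
   M21 (mdom F21 `&` tmul Q @^-1` A).
  by move=> mA; rewrite E ME//; apply: measurableI => //; exact: mtB.
apply: (measure_equiv_null _ _ _ _ hident) => //.
- by move=> A; rewrite /haar_integral; apply: integral_ge0 => u _; exact: measure_ge0.
- by move=> A; exact: fib21_ge0.
- by move=> A A' mA mA' AA'; rewrite !(hd_measure d0)//; apply: le_measure; rewrite ?inE.
- move=> A A' mA mA' AA'; rewrite !PM//; apply: le_measure; rewrite ?inE.
  + by apply: measurableI => //; exact: mtB.
  + by apply: measurableI => //; exact: mtB.
  + by apply: setIS => z; exact: AA'.
Qed.

(** The complement of G_1 G_2 is null in G, and the identification pulls it back to a null set of
    pairs (g_2, g_1). This makes g_2 g_1 factor in the opposite order almost everywhere. *)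
Lemma fib21_prodset :
  \forall z \ae mmeas F21, mdom F21 z -> prodset Q H1 H2 (mul z.1 z.2).
Proof.
have mC := measurableC mprod.
have mtC : measurable (tmul Q @^-1` (~` prodset Q H1 H2)).
  by rewrite -[X in measurable X]setTI; exact: mt.
exists (tmul Q @^-1` (~` prodset Q H1 H2)); split => //; last first.
  by move=> [x y] /= /not_implyP[[h1 h2 h3]]; rewrite tmulE.
rewrite fib21E//.
apply/(product_null (F := fun g => (\1_(~` prodset Q H1 H2) g)%:E)) => //.
  exact: measurable_indicE.
rewrite integral_indic_setT//.
have [A [mA A0 CA]] := mp_conegligible hm.
apply: (@subset_measure0 _ _ _ M _ A) => //.
by rewrite -[RHS]A0; apply/esym/(hd_measure d0).
Qed.

Lemma nu_rng N : measurable N -> nu N = (\int[nu]_u (\1_N (r u))%:E)%E.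
Proof.
move=> mN; rewrite -integral_indic_setT//.
apply: (ge0_integral_eq_conull munits (mg_units hG)) => //.
- exact: measurable_indicE.
- by apply: (measurableT_comp (measurable_indicE mN)).
- by move=> u ->.
Qed.

(** * The right action on G_2 *)

Section right.
Let X := galg Q nu H2 lam2.
Let hX : sfinite_mspace X := galg_sfinite d2.

Lemma right_base_nonsingular : nonsingular (base Q nu) X s.
Proof.
apply: (@nonsingular_total _ _ _ _ _ (base Q nu) X s hX s ms) => //; first by move=> y _; exact: units_src.
move=> N mN; rewrite /= nu_rng// => h; rewrite (hd_measure d2); last first.
  by rewrite -[X in measurable X]setTI; exact: ms.
rewrite -integral_indic_setT; last by rewrite -[X in measurable X]setTI; exact: ms.
by apply/(hd_src_null d2 mi mr ms (F := fun u => (\1_N u)%:E)) => //; exact: measurable_indicE.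
Qed.

Lemma right_base_injective : vn_injective (base Q nu) X (fun (n : bG -> C) x => n (s x)).
Proof.
apply: (pullback_vn_injective base_sfinite hX right_base_nonsingular) => N mN _.
have msN : measurable (s @^-1` N : set bG).
  by rewrite -[X in measurable X]setTI; exact: ms.
move=> /(sfinite_conull hX msN); rewrite /= nu_rng// (hd_measure d2)//.
rewrite -integral_indic_setT// => h.
by apply/(hd_src_null d2 mi mr ms (F := fun u => (\1_N u)%:E)) => //; exact: measurable_indicE.
Qed.

Let phi (z : bG * bG) : bG := p2 Q H1 H2 (mul z.1 z.2).
Let phi' (z : bG * bG) : bG := p2 Q H1 H2 (tmul Q z).

Let mphi' : measurable_fun setT phi'.
Proof. exact: (measurableT_comp mp2'). Qed.

Let phi_tmul z : mdom F21 z -> phi z = phi' z.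
Proof. by case: z => x y [h1 h2 h3]; rewrite /phi /phi' tmulE. Qed.

Lemma right_act_null N : measurable N ->
  mmeas F21 (phi' @^-1` N) = 0%E <-> mmeas X N = 0%E.
Proof.
move=> mN; rewrite fib21E; last by rewrite -[X in measurable X]setTI; exact: mphi'.
rewrite /= (hd_measure d2)// -integral_indic_setT//.
rewrite -(p2_null sub1 sub2 cap d0 d1 d2 mi ms mt mp2' product_null (F := fun x => (\1_N x)%:E))//;
  last exact: measurable_indicE.
rewrite (product_null (F := fun g => (\1_N (p2 Q H1 H2 g))%:E))//.
by apply: (measurableT_comp (measurable_indicE mN)).
Qed.

Lemma right_act_nonsingular : nonsingular X F21 phi.
Proof.
apply: (nonsingular_total fib21_sfinite mphi') => //.
  by move=> z _; exact: p2_in.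
by move=> N mN /(right_act_null mN).
Qed.

Lemma right_act_injective : vn_injective X F21 (fun (f : bG -> C) z => f (phi z)).
Proof.
apply: (pullback_vn_injective hX fib21_sfinite right_act_nonsingular) => N mN _ h.
apply/(right_act_null mN).
have mpN : measurable (phi' @^-1` N) by rewrite -[X in measurable X]setTI; exact: mphi'.
apply/(sfinite_conull fib21_sfinite mpN); rewrite -[RHS]h; congr (mmeas F21 _).
by apply/seteqP; split => z [Dz Nz]; split => //; move: Nz; rewrite /= phi_tmul.
Qed.

Lemma right_aid_nonsingular : nonsingular F21 XMMr (fun w => (phi w.1, w.2)).
Proof.
apply: (nonsingular_total right_fib21_sfinite (phi' := fun w => (phi' w.1, w.2))).
- by apply: measurable_fun_pair => //; exact: (measurableT_comp mphi').
- by move=> w [Dw _ _]; rewrite phi_tmul.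
- move=> w [[/= h1 h2 h3] h4 h5]; split => //=; first exact: p2_in.
  by rewrite src_p2// src_mul.
- move=> N mN; rewrite fib21E// => N0; rewrite right_fib21E.
    apply: (right_aid_null sub1 sub2 cap d0 d1 d2 mi ms mt mp2' product_null (f := fun z => (\1_N z)%:E)) => //.
    exact: measurable_indicE.
  rewrite -[X in measurable X]setTI.
  have : measurable_fun setT (fun w : bG * bG * bG => (phi' w.1, w.2)).
    by apply: measurable_fun_pair => //; exact: (measurableT_comp mphi').
  by apply.
Qed.

Lemma right_idD_nonsingular :
  nonsingular F21 XMMr (fun w => (w.1.1, mul w.1.2 w.2)).
Proof.
have mm : measurable_fun setT (fun w : bG * bG * bG => (w.1.1, tmul Q (w.1.2, w.2))).
  apply: measurable_fun_pair; first exact: (measurableT_comp measurable_fst).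
  apply: (measurableT_comp mt); apply: measurable_fun_pair => //.
  exact: (measurableT_comp measurable_snd).
apply: (nonsingular_total right_fib21_sfinite mm).
- by move=> [[x y] z] [_ _ /= e]; rewrite tmulE.
- move=> w [[/= h1 h2 h3] h4 h5]; split => //=; first exact: (proj2 sub1).
  by rewrite rng_mul.
- move=> N mN; rewrite fib21E// => N0; rewrite right_fib21E.
    apply: (right_idD_null d1 ms mt (f := fun z => (\1_N z)%:E)) => //.
    exact: measurable_indicE.
  by rewrite -[X in measurable X]setTI; exact: mm.
Qed.

Lemma right_prodset_fst :
  \forall w \ae mmeas XMMr, mdom XMMr w -> prodset Q H1 H2 (mul w.1.1 w.1.2).
Proof.
have [A [mA A0 CA]] := fib21_prodset.
exists (fst @^-1` A); split.
- by rewrite -[X in measurable X]setTI; exact: measurable_fst.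
- apply: right_fst_null => //; first exact: fib21_sfinite.
    exact: measurable_snd_src.
  by move=> x _; exact: units_src.
- move=> w /= /not_implyP[[Dw _ _] nP]; apply: CA => /=.
  by move=> /(_ Dw).
Qed.

Lemma matched_right_action :
  right_action Q nu H1 lam1 X s (mp_act Q H1 H2 : (bG -> C) -> _).
Proof.
have FX := sfinite_aeW right_fib21_sfinite.
split.
- exact: (pullback_vn_antihom base_sfinite hX right_base_nonsingular).
- exact: right_base_injective.
- exact: (pullback_vn_hom hX fib21_sfinite right_act_nonsingular).
- exact: right_act_injective.
- move=> n _; apply: (sfinite_aeW fib21_sfinite) => z [h1 h2 h3].
  by rewrite /mp_act /beta src_p2// src_mul.
(* The two extensions are compositions with (x, y, z) -> (p_2(xy), z) and (x, y, z) -> (x, yz). *)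
exists (fun F w => F (phi w.1, w.2)), (fun F w => F (w.1.1, mul w.1.2 w.2)); split.
- split; last by move=> f g _ _; exact: FX.
  exact: (pullback_vn_hom fib21_sfinite right_fib21_sfinite right_aid_nonsingular).
- split; last by move=> f g _ _; exact: FX.
  exact: (pullback_vn_hom fib21_sfinite right_fib21_sfinite right_idD_nonsingular).
move=> f _; have FF := sfinite_ae_filter right_fib21_sfinite.
(* Two elements must lie in G_1 G_2 for almost every triple: xy, and p_2(xy) z. The second condition
   is the pullback of [fib21_prodset] along the first of the two maps. *)
have := pullback_ae right_fib21_sfinite right_aid_nonsingular fib21_prodset.
have := right_prodset_fst.
rewrite /Linf_eq; apply: filterS2 => -[[x y] z] h1 h2 Dw.
have [[/= Hx Hy e] Hz e'] := Dw.
move: (h1 Dw) (h2 Dw) => /= {}h1 {}h2; rewrite /mp_act /=; congr f.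
have [e1 E] := factor_prodset sub1 sub2 cap h1.
have e2 : s (p2 Q H1 H2 (mul x y)) = r z by rewrite src_p2// src_mul.
(* Here x(yz) = (xy)z = p_1(xy) (p_2(xy) z), and a left factor from G_1 does not affect p_2. *)
rewrite -gmul_assoc// [in RHS]E gmul_assoc// [RHS]p2_mull//.
  exact: p1_in.
by rewrite rng_mul.
Qed.

End right.

Lemma K2_fibre x : K2 (s x) (~` rfib Q H2 (s x)) = 0%E.
Proof. by rewrite -[RHS](hd_fibre d2 (s x)) rng_src. Qed.

Lemma fib12_sfinite : sfinite_mspace F12.
Proof. exact: mflip_sfinite fib21_sfinite. Qed.

Lemma measurable_set_flip d d' (T : measurableType d) (T' : measurableType d')
  (A : set (T' * T)) : measurable A -> measurable [set z : T * T' | A (flip z)].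
Proof. by move=> mA; rewrite -[X in measurable X]setTI; exact: measurable_flip. Qed.

Lemma fib12E A : measurable A ->
  mmeas F12 A = (\int[M2]_x \int[K1 (s x)]_y (\1_A (y, x))%:E)%E.
Proof. by move=> mA; exact: etrans (fib21E (measurable_set_flip mA)) _. Qed.

(** The measures [left_ker] on pairs (a, x), indexed by b with s(b) = r(x), form an s-finite kernel;
    this makes the triple fibre product an instance of the general construction. *)
Lemma left_kernel : exists L : R.-sfker bG ~> (bG * bG)%type,
  forall b A, L b A = (\int[K2 (s b)]_x K1 (s x) [set a | A (a, x)])%E.
Proof.
have [k1 k1E] := kernel_precomp K2 ms.
have [k2 k2E] := kernel_precomp K1 (@measurable_snd_src _ bG).
have mg : measurable_fun setT (fun w : (bG * bG) * bG => (w.2, w.1.2)).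
  by apply: measurable_fun_pair => //; exact: (measurableT_comp measurable_snd).
have [k3 k3E] := kernel_push k2 mg.
have [L [LE _]] := kernel_comp k1 k3.
by exists L => b A; rewrite LE k1E; apply: eq_integral => x _; rewrite k3E k2E.
Qed.

Lemma measurable_K1_ysection (A : set (bG * bG)%type) : measurable A ->
  measurable_fun setT (fun x : bG => K1 (s x) ([set a | A (a, x)] : set bG)).
Proof.
move=> mA; have [k kE] := kernel_precomp K1 ms.
rewrite (_ : (fun x => _) = fun x => k x (xsection [set z | A (flip z)] x)).
  by apply: measurable_kernel_xsection; exact: measurable_set_flip.
by apply/funext => x; rewrite kE xsectionE.
Qed.

Lemma left_kerE b A : measurable A ->
  left_ker Q H2 lam2 H1 r (fun u => lam1 u) (s b) A =
    (\int[K2 (s b)]_x K1 (s x) [set a | A (a, x)])%E.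
Proof.
move=> mA; rewrite /left_ker /=.
transitivity (\int[K2 (s b)]_(x in H2) K1 (s x) [set a | A (a, x)])%E.
  by rewrite K2_src; apply: eq_integral => x _; rewrite K1_src xsectionE.
apply: integral_conull => //; last exact: measurable_K1_ysection.
apply: (@subset_measure0 _ _ _ (K2 (s b)) _ _ _ _ _ (K2_fibre b)).
- exact: measurableC.
- by apply: measurableC; exact: hd_rfib d2 _.
- by apply: subsetC => x [].
Qed.

Lemma left_fibprod_sfinite (L : R.-sfker bG ~> (bG * bG)%type) :
  (forall b A, L b A = (\int[K2 (s b)]_x K1 (s x) [set a | A (a, x)])%E) ->
  sfinite_mspace (fibprod (galg Q nu H2 lam2) s (mdom F12) (fun z => r z.2)
    (left_ker Q H2 lam2 H1 r (fun u => lam1 u))).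
Proof.
move=> LE; have mF := sfinite_mdom fib12_sfinite.
apply: (@fibprod_sfinite _ _ _ _ _ _ (galg Q nu H2 lam2) s (mdom F12) (fun z => r z.2) _ L).
- exact: galg_sfinite d2.
- by move=> b _ A mA; rewrite LE left_kerE.
- apply: measurable_fibprod_dom => //; exact: measurable_snd_rng.
- move=> b Hb; rewrite LE.
  set A := [set y | _].
  have mA : measurable A.
    rewrite (_ : A = mdom F12 `&` snd @^-1` (rfib Q setT (s b) : set bG)); last first.
      by apply/seteqP; split => z [h1] => [e|[_ e]]; split.
    apply: measurableI => //; rewrite -[X in measurable X]setTI.
    by apply: measurable_snd => //; exact: hd_rfib d0 _.
  transitivity (\int[K2 (s b)]_x 0)%E; last by rewrite integral0.
  apply: (hd_integral_fibre d2) => //.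
    by apply: measurable_K1_ysection; exact: measurableC.
  move=> x Hx; rewrite rng_src => e; rewrite -[RHS](K1_fibre x); congr (K1 _ _).
  apply/seteqP; split => a /= h [h1 h2]; apply: h; first by split.
  by case: h1.
Qed.

Lemma left_fib12_sfinite : sfinite_mspace XMMl.
Proof. by have [L LE] := left_kernel; apply: mflip_sfinite; exact: left_fibprod_sfinite LE. Qed.

(** Points are ((a, x), b) with a in G_1 and x, b in G_2, such that s(b) = r(x) and s(x) = r(a);
    because of the flips the integration runs in the order of the product b x a. *)
Lemma left_fib12E A : measurable A -> mmeas XMMl A =
  (\int[M2]_b \int[K2 (s b)]_x \int[K1 (s x)]_a (\1_A ((a, x), b))%:E)%E.
Proof.
move=> mA; have [L LE] := left_kernel.
have mA' := measurable_set_flip mA.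
rewrite -[LHS]/(mmeas (fibprod (galg Q nu H2 lam2) s (mdom F12) (fun z => r z.2)
    (left_ker Q H2 lam2 H1 r (fun u => lam1 u))) [set z | A (flip z)]).
rewrite (@fibprodE _ _ _ _ _ _ (galg Q nu H2 lam2) s (mdom F12) (fun z => r z.2) _ L _ M2)//; last 2 first.
- by move=> b _ B mB; rewrite LE left_kerE.
- exact: hd_measure d2.
rewrite integral_conull//; last 2 first.
- exact: hd_null_compl d2.
- exact: measurable_kernel_xsection.
apply: eq_integral => b _; rewrite LE; apply: eq_integral => x _.
have mB : measurable [set a | xsection [set z | A (flip z)] b (a, x)].
  rewrite -[X in measurable X]setTI.
  have := @measurable_pair2 _ _ bG bG x.
  by apply => //; exact: measurable_xsection.
rewrite -integral_indic_setT//.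
apply: eq_integral => a _; rewrite !indicE.
suff -> : (a \in [set a | xsection [set z | A (flip z)] b (a, x)]) = ((a, x, b) \in A) by [].
by apply/idP/idP => /set_mem h; apply/mem_set; move: h; rewrite /= xsectionE.
Qed.

Lemma fib12_prodset :
  \forall z \ae mmeas F12, mdom F12 z -> prodset Q H1 H2 (mul z.2 z.1).
Proof.
have [A [mA A0 CA]] := fib21_prodset.
exists [set z | A (flip z)]; split; first exact: measurable_set_flip.
  by rewrite -[RHS]A0; congr (mmeas F21 _); apply/seteqP; split => -[].
by move=> z h; exact: (CA (flip z)).
Qed.

(** * The left action on G_1 *)

Section left.
Let X := galg Q nu H1 lam1.
Let hX : sfinite_mspace X := galg_sfinite d1.

Lemma left_base_null (N : set bG) : measurable N ->
  mmeas X (r @^-1` N) = 0%E <-> mmeas (base Q nu) N = 0%E.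
Proof.
move=> mN; have mrN : measurable (r @^-1` N : set bG).
  by rewrite -[X in measurable X]setTI; exact: mr.
rewrite /= nu_rng// (hd_measure d1)// -integral_indic_setT//.
by apply: (hd_rng_null d1 mr (F := fun u => (\1_N u)%:E)) => //; exact: measurable_indicE.
Qed.

Lemma left_base_nonsingular : nonsingular (base Q nu) X r.
Proof.
apply: (@nonsingular_total _ _ _ _ _ (base Q nu) X r hX r mr) => //.
  by move=> y _; exact: units_rng.
by move=> N mN /(left_base_null mN).
Qed.

Lemma left_base_injective : vn_injective (base Q nu) X (fun (n : bG -> C) x => n (r x)).
Proof.
apply: (pullback_vn_injective base_sfinite hX left_base_nonsingular) => N mN _.
have mrN : measurable (r @^-1` N : set bG).
  by rewrite -[X in measurable X]setTI; exact: mr.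
by move=> /(sfinite_conull hX mrN)/(left_base_null mN).
Qed.

Let phi (z : bG * bG) : bG := p1 Q H1 H2 (mul z.2 z.1).
Let phi' (z : bG * bG) : bG := p1 Q H1 H2 (tmul Q (flip z)).

Let mphi' : measurable_fun setT phi'.
Proof. by apply: (measurableT_comp mp1'); apply: (measurableT_comp mt); exact: measurable_flip. Qed.

Let phi_tmul z : mdom F12 z -> phi z = phi' z.
Proof. by case: z => x y [h1 h2 h3]; rewrite /phi /phi' tmulE. Qed.

Lemma left_act_null N : measurable N ->
  mmeas F12 (phi' @^-1` N) = 0%E <-> mmeas X N = 0%E.
Proof.
move=> mN; rewrite fib12E; last by rewrite -[X in measurable X]setTI; exact: mphi'.
rewrite /= (hd_measure d1)// -integral_indic_setT//.
rewrite -(p1_null sub1 sub2 cap d0 d1 d2 mi mr ms mt mp1' product_null (F := fun x => (\1_N x)%:E))//;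
  last exact: measurable_indicE.
rewrite (product_null (F := fun g => (\1_N (p1 Q H1 H2 g))%:E))//.
by apply: (measurableT_comp (measurable_indicE mN)).
Qed.

Lemma left_act_nonsingular : nonsingular X F12 phi.
Proof.
apply: (nonsingular_total fib12_sfinite mphi') => //.
  by move=> z _; exact: p1_in.
by move=> N mN /(left_act_null mN).
Qed.

Lemma left_act_injective : vn_injective X F12 (fun (f : bG -> C) z => f (phi z)).
Proof.
apply: (pullback_vn_injective hX fib12_sfinite left_act_nonsingular) => N mN _ h.
apply/(left_act_null mN).
have mpN : measurable (phi' @^-1` N) by rewrite -[X in measurable X]setTI; exact: mphi'.
apply/(sfinite_conull fib12_sfinite mpN); rewrite -[RHS]h; congr (mmeas F12 _).
by apply/seteqP; split => z [Dz Nz]; split => //; move: Nz; rewrite /= phi_tmul.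
Qed.

Lemma left_aid_nonsingular : nonsingular F12 XMMl (fun w => (phi w.1, w.2)).
Proof.
have mm : measurable_fun setT (fun w : bG * bG * bG => (phi' w.1, w.2)).
  by apply: measurable_fun_pair => //; exact: (measurableT_comp mphi').
apply: (nonsingular_total left_fib12_sfinite mm).
- by move=> w [_ Dw _]; rewrite phi_tmul.
- move=> w [/= h1 [/= h2 h3 h4] h5]; split => //=; first exact: p1_in.
  by rewrite rng_p1// rng_mul.
- move=> N mN; rewrite fib12E// => N0; rewrite left_fib12E.
    apply: (left_aid_null sub1 sub2 cap d0 d1 d2 mi mr ms mt mp1' product_null
      (f := fun z => (\1_N (flip z))%:E)) => //.
    apply: (measurableT_comp (measurable_indicE mN)); exact: measurable_flip.
  by rewrite -[X in measurable X]setTI; exact: mm.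
Qed.

Lemma left_idD_nonsingular :
  nonsingular F12 XMMl (fun w => (w.1.1, mul w.2 w.1.2)).
Proof.
have mm : measurable_fun setT (fun w : bG * bG * bG => (w.1.1, tmul Q (w.2, w.1.2))).
  apply: measurable_fun_pair; first exact: (measurableT_comp measurable_fst).
  apply: (measurableT_comp mt); apply: measurable_fun_pair => //.
  exact: (measurableT_comp measurable_snd).
apply: (nonsingular_total left_fib12_sfinite mm).
- by move=> [[x y] z] [_ _ /= e]; rewrite tmulE.
- move=> w [/= h1 [/= h2 h3 h4] h5]; split => //=; first exact: (proj2 sub2).
  by rewrite src_mul.
- move=> N mN; rewrite fib12E// => N0; rewrite left_fib12E.
    apply: (left_idD_null d2 ms mt (f := fun z => (\1_N (flip z))%:E)) => //.
    apply: (measurableT_comp (measurable_indicE mN)); exact: measurable_flip.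
  by rewrite -[X in measurable X]setTI; exact: mm.
Qed.

Lemma left_prodset_fst :
  \forall w \ae mmeas XMMl, mdom XMMl w -> prodset Q H1 H2 (mul w.1.2 w.1.1).
Proof.
have [A [mA A0 CA]] := fib12_prodset.
have mfA : measurable (fst @^-1` A : set (bG * bG * bG)).
  by rewrite -[X in measurable X]setTI; exact: measurable_fst.
exists (fst @^-1` A); split => //.
- rewrite left_fib12E//.
  apply: (left_proj_null d2 mi mr ms (f := fun z => (\1_A (flip z))%:E)) => //.
  + apply: (measurableT_comp (measurable_indicE mA)); exact: measurable_flip.
  + by rewrite -[RHS]A0 fib12E.
- move=> w /= /not_implyP[[_ Dw _] nP]; apply: CA => /=.
  by move=> /(_ Dw).
Qed.

Lemma matched_left_action :
  left_action Q nu H2 lam2 H1 r (fun u => lam1 u) (mp_dual_act Q H1 H2 : (bG -> C) -> _).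
Proof.
have FX := sfinite_aeW left_fib12_sfinite.
split.
- exact: (pullback_vn_hom base_sfinite hX left_base_nonsingular).
- exact: left_base_injective.
- exact: (pullback_vn_hom hX fib12_sfinite left_act_nonsingular).
- exact: left_act_injective.
- move=> n _; apply: (sfinite_aeW fib12_sfinite) => z [h1 h2 h3].
  by rewrite /mp_dual_act /alpha rng_p1// rng_mul.
(* The two extensions are compositions with ((a, x), b) -> (p_1(xa), b) and ((a, x), b) -> (a, bx);
   the flipped coproduct accounts for the order in bx. *)
exists (fun F w => F (phi w.1, w.2)), (fun F w => F (w.1.1, mul w.2 w.1.2)); split.
- split; last by move=> f g _ _; exact: FX.
  exact: (pullback_vn_hom fib12_sfinite left_fib12_sfinite left_aid_nonsingular).
- split; last by move=> f g _ _; exact: FX.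
  exact: (pullback_vn_hom fib12_sfinite left_fib12_sfinite left_idD_nonsingular).
move=> f _; have FF := sfinite_ae_filter left_fib12_sfinite.
have := pullback_ae left_fib12_sfinite left_aid_nonsingular fib12_prodset.
have := left_prodset_fst.
rewrite /Linf_eq; apply: filterS2 => -[[a x] b] h1 h2 Dw.
have [/= Hb [/= Hx Ha e] e'] := Dw.
move: (h1 Dw) (h2 Dw) => /= {}h1 {}h2; rewrite /mp_dual_act /=; congr f.
have [e1 E] := factor_prodset sub1 sub2 cap h1.
have e2 : s b = r (p1 Q H1 H2 (mul x a)) by rewrite rng_p1// rng_mul.
(* Here (bx)a = b(xa) = (b p_1(xa)) p_2(xa), and a right factor from G_2 does not affect p_1. *)
rewrite gmul_assoc// [in RHS]E -gmul_assoc// [RHS]p1_mulr//.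
  exact: p2_in.
by rewrite src_mul.
Qed.

End left.

(** The equality r(p_2(g)) = s(p_1(g)) comes from the factorization, so it is used only where g_2
    g_1 lies in G_1 G_2, that is, almost everywhere. The two companion identities hold at every
    point of the domain. *)
Lemma act_rng_mid (n : bG -> C) : Linf_eq F21
  (mp_act Q H1 H2 (fun g => n (r g))) (fun z => n (mid Q H1 H2 (mult21 Q z))).
Proof.
have FF := sfinite_ae_filter fib21_sfinite.
apply: filterS fib21_prodset => z h Dz.
have [e _] := factor_prodset sub1 sub2 cap (h Dz).
by rewrite /mp_act /mid e.
Qed.

Lemma dual_act_src_mid (n : bG -> C) : Linf_eq F12
  (mp_dual_act Q H1 H2 (fun g => n (s g))) (fun z => n (mid Q H1 H2 (mult12 Q z))).
Proof. exact: (sfinite_aeW fib12_sfinite). Qed.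

Lemma act_src_mult (n : bG -> C) : Linf_eq F21
  (mp_act Q H1 H2 (fun g => n (s g))) (fun z => n (s (mult21 Q z))).
Proof.
by apply: (sfinite_aeW fib21_sfinite) => z [h1 h2 h3]; rewrite /mp_act src_p2.
Qed.

End matched_pairs.

Theorem mainTheorem3 (R : realType) (G : ptopologicalType) (Q : groupoid G)
  (lam : G -> {measure set (borel G) -> \bar R})
  (nu : {measure set (borel G) -> \bar R})
  (G1 G2 : set (borel G))
  (lam1 lam2 : G -> {measure set (borel G) -> \bar R})
  (hG : measured_groupoid Q lam nu)
  (hmatched : matched_pair Q lam nu G1 lam1 G2 lam2)
  (hident : product_identification Q nu G1 G2 lam1 lam2 lam) :
  [/\ right_action Q nu G1 lam1 (galg Q nu G2 lam2) (src Q)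
        (mp_act Q G1 G2),
      left_action Q nu G2 lam2 G1 (rng Q) (fun u => lam1 u)
        (mp_dual_act Q G1 G2)
    & forall n : borel G -> R[i], Linf (base Q nu) n ->
      [/\ Linf_eq (fib21 Q nu G1 G2 lam1 lam2)
            (mp_act Q G1 G2 (fun g => n (rng Q g)))
            (fun z => n (mid Q G1 G2 (mult21 Q z))),
          Linf_eq (fib12 Q nu G1 G2 lam1 lam2)
            (mp_dual_act Q G1 G2 (fun g => n (src Q g)))
            (fun z => n (mid Q G1 G2 (mult12 Q z)))
        & Linf_eq (fib21 Q nu G1 G2 lam1 lam2)
            (mp_act Q G1 G2 (fun g => n (src Q g)))
            (fun z => n (src Q (mult21 Q z)))]].
Proof.
have [cl1 cl2 _ _ haar1 haar2 cap _ _ qi1 qi2] := hmatched.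
have [K [M d0]] := exists_haar_data hG closedT (@subsetT _ _) (mg_haar hG)
  (mg_quasi_invariant hG).
have [K1 [M1 d1]] := exists_haar_data hG cl1 (units_sub1 cap) haar1 qi1.
have [K2 [M2 d2]] := exists_haar_data hG cl2 (units_sub2 cap) haar2 qi2.
split.
- exact: (matched_right_action hG hmatched hident d0 d1 d2).
- exact: (matched_left_action hG hmatched hident d0 d1 d2).
move=> n _; split.
- exact: (act_rng_mid hG hmatched hident d0 d1 d2).
- exact: (dual_act_src_mid hG d1 d2).
- exact: (act_src_mult hG hmatched d1 d2).
Qed.
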